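(* Let $\mathcal{N}^{A'\to BE}$ be a quantum wiretap channel with qubit input $A'$ that is degradable, i.e. there exists a quantum channel $\mathcal{D}^{B\to E}$ with $\mathcal{D}^{B\to E}\circ\mathcal{N}^{A'\to B}=\mathcal{N}^{A'\to E}$. Let $z\mapsto\rho_z^{A'}$ ($z\in\{0,1\}$) be a choice of two input states and let $0<\beta<1/2$. For $N=2^n$ let $\mathcal{B}$ be the set of inputs of the private polar coding scheme of block length $N$ that are assigned secret-key bits. Then the secret-key consumption rate vanishes: $$\lim_{N=2^n\to\infty}\frac{|\mathcal{B}|}{N}=0 .$$
   Context: Basic quantities. A binary-input classical-quantum (cq) channel $W:x\mapsto\rho_x$ assigns to each bit $x\in\{0,1\}$ a density operator $\rho_x$. Its fidelity is $F(W)=\|\sqrt{\rho_0}\sqrt{\rho_1}\|_1^2$. Wiretap channel. A quantum wiretap channel $\mathcal{N}^{A'\to BE}$ is a completely positive trace-preserving map from a qubit $A'$ to systems $B$ (legitimate receiver) and $E$ (wiretapper); $\mathcal{N}^{A'\to B}=\mathrm{Tr}_E\circ\mathcal{N}^{A'\to BE}$ and $\mathcal{N}^{A'\to E}=\mathrm{Tr}_B\circ\mathcal{N}^{A'\to BE}$. Let $U_{\mathcal N}^{A'\to BES_2}$ be an isometric extension of $\mathcal{N}^{A'\to BE}$ with environment $S_2$. Fix input states $\rho_z^{A'}$, $z\in\{0,1\}$, with purifications $|\psi_z\rangle^{A'S_1}$. Amplitude channel to Bob: $W_{A,B}:z\mapsto\mathcal{N}^{A'\to B}(\rho_z^{A'})$.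 Phase channel to Bob: with $|\varphi\rangle^{CA'S_1}=\frac1{\sqrt2}\sum_{z}|z\rangle^C|\psi_z\rangle^{A'S_1}$ and $Z$ the Pauli phase operator, $W_{P,B}:x\mapsto\omega_x^{BCS_1S_2}=\mathrm{Tr}_E\{U_{\mathcal N}(Z^x)^C|\varphi\rangle\langle\varphi|(Z^x)^C U_{\mathcal N}^\dagger\}$. Synthesized channels. Let $N=2^n$ and let $G_N$ be Arikan's $N\times N$ encoding matrix over $\mathbb{F}_2$, $G_N=R_NK^{\otimes n}$ with $K=\begin{pmatrix}1&0\\1&1\end{pmatrix}$ and $R_N$ the bit-reversal permutation matrix; bit strings are row vectors. For a cq channel $W:x\mapsto\rho_x$ write $\rho_{x^N}=\rho_{x_1}\otimes\cdots\otimes\rho_{x_N}$. The $i$-th synthesized amplitude channel $W_{A,B,N}^{(i)}$ (with $\rho_x$ the outputs of $W_{A,B}$) is $$u_i\mapsto\sum_{u_1^{i-1}}\frac1{2^{i-1}}|u_1^{i-1}\rangle\langle u_1^{i-1}|\otimes\sum_{u_{i+1}^N}\frac1{2^{N-i}}\rho_{u^NG_N},$$ i.e. previous bits are available and future bits are uniformly random. The $i$-th synthesized phase channel $W_{P,B,N}^{(i)}$ uses $G_N^T$ in place of $G_N$, with future bits available and previous bits uniformly random: $$x_i\mapsto\sum_{x_{i+1}^N}\frac1{2^{N-i}}|x_{i+1}^N\rangle\langle x_{i+1}^N|\otimes\sum_{x_1^{i-1}}\frac1{2^{i-1}}\omega_{x^NG_N^T}$$ (up to an input-independent unitary on $C^N$,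 which does not affect fidelities). Index sets. Let $\mathcal{G}_N(W_{A,B},\beta)=\{i\in[N]:\sqrt{F(W_{A,B,N}^{(i)})}<2^{-N^\beta}\}$, $\mathcal{G}_N(W_{P,B},\beta)=\{i\in[N]:\sqrt{F(W_{P,B,N}^{(i)})}<2^{-N^\beta}\}$, and let $\mathcal{B}_N(\cdot,\beta)=[N]\setminus\mathcal{G}_N(\cdot,\beta)$. Define $\mathcal{A}=\mathcal{G}_N(W_{A,B},\beta)\cap\mathcal{G}_N(W_{P,B},\beta)$, $\mathcal{X}=\mathcal{G}_N(W_{A,B},\beta)\cap\mathcal{B}_N(W_{P,B},\beta)$, $\mathcal{Z}=\mathcal{B}_N(W_{A,B},\beta)\cap\mathcal{G}_N(W_{P,B},\beta)$, $\mathcal{B}=\mathcal{B}_N(W_{A,B},\beta)\cap\mathcal{B}_N(W_{P,B},\beta)$. Scheme. The private polar coding scheme sends information bits through the inputs in $\mathcal{A}$, random bits through $\mathcal{X}$, frozen bits (known to sender and receiver) through $\mathcal{Z}$, and secret-key bits shared by sender and receiver through $\mathcal{B}$; the input string $u^N$ is encoded as $u^NG_N$ and each bit $z$ of the result is sent as $\rho_z^{A'}$ over one use of $\mathcal{N}$. The secret-key consumption rate is $|\mathcal{B}|/N$. *)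

(* Defs.v *)
From mathcomp Require Import all_boot all_order all_algebra.
From mathcomp Require Import complex mxtens.
From mathcomp Require Import all_classical all_reals all_analysis.
Set Implicit Arguments.
Unset Strict Implicit.
Unset Printing Implicit Defensive.
Import Order.TTheory GRing.Theory Num.Theory.
Import numFieldNormedType.Exports.
Local Open Scope ring_scope.
Local Open Scope sesquilinear_scope.
Local Open Scope classical_set_scope.

(* All Hilbert spaces are finite dimensional: a system of dimension d is C^d    *)
(* with C = R[i], kets are column vectors, and a composite system has dimension *)
(* m * n with the index convention of mxtens (first factor most significant).  *)

Section Operators.
Variable R : realType.
Local Notation C := R[i].

(* 0 <= z in R[i] includes that z is real, so a psd matrix is Hermitian. *)
Definition psd n (A : 'M[C]_n) : Prop :=
  forall v : 'cV[C]_n, 0 <= (v^t* *m A *m v) 0 0.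

Definition density n (A : 'M[C]_n) : Prop := psd A /\ \tr A = 1.

(* Positive square root, meant for psd A. *)
Definition psqrt n (A : 'M[C]_n) : 'M[C]_n :=
  invmx (spectralmx A) *m diag_mx (map_mx sqrtC (spectral_diag A))
    *m spectralmx A.

Definition trnorm n (A : 'M[C]_n) : R := complex.Re (\tr (psqrt (A^t* *m A))).

(* <e| (x) I and I (x) <e| *)
Definition lbra k n (e : 'I_k) : 'M[C]_(n, k * n) :=
  castmx (mul1n n, erefl) (delta_mx (0 : 'I_1) e *t 1%:M).
Definition rbra n k (e : 'I_k) : 'M[C]_(n, n * k) :=
  castmx (muln1 n, erefl) (1%:M *t delta_mx (0 : 'I_1) e).

Definition ptrace_l k n (X : 'M[C]_(k * n)) : 'M[C]_n :=
  \sum_(e < k) lbra n e *m X *m (lbra n e)^t*.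
Definition ptrace_r n k (X : 'M[C]_(n * k)) : 'M[C]_n :=
  \sum_(e < k) rbra n e *m X *m (rbra n e)^t*.

(* id_k (x) Phi, applied blockwise *)
Definition amplify k m n (Phi : 'M[C]_m -> 'M[C]_n) (X : 'M[C]_(k * m)) :
    'M[C]_(k * n) :=
  \sum_(i < k) \sum_(j < k)
    delta_mx i j *t Phi (lbra m i *m X *m (lbra m j)^t*).

Definition completely_positive m n (Phi : 'M[C]_m -> 'M[C]_n) : Prop :=
  forall k (X : 'M[C]_(k * m)), psd X -> psd (amplify Phi X).

Definition trace_preserving m n (Phi : 'M[C]_m -> 'M[C]_n) : Prop :=
  forall X, \tr (Phi X) = \tr X.

Definition quantum_channel m n (Phi : {linear 'M[C]_m -> 'M[C]_n}) : Prop :=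
  completely_positive Phi /\ trace_preserving Phi.

Fixpoint tensor_rec d k : ('I_k.+1 -> 'M[C]_d) -> 'M[C]_(d ^ k.+1) :=
  if k is k'.+1 return ('I_k.+1 -> 'M[C]_d) -> 'M[C]_(d ^ k.+1)
  then fun F => F ord0 *t tensor_rec (fun j => F (lift ord0 j))
  else fun F => F ord0.

(* F 0 (x) ... (x) F (N-1), with factors that may differ, unlike in ntensmx *)
Definition tensor d N : ('I_N -> 'M[C]_d) -> 'M[C]_(d ^ N) :=
  if N is k.+1 return ('I_N -> 'M[C]_d) -> 'M[C]_(d ^ N)
  then @tensor_rec d k else fun=> 1%:M.

(* |s><s| for a classical register whose basis is labelled by T *)
Definition register (T : finType) (s : T) : 'M[C]_#|T| :=
  delta_mx (enum_rank s) (enum_rank s).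

End Operators.

Section Fidelity.
Variable R : realType.

Definition cq_channel d := 'F_2 -> 'M[R[i]]_d.

Definition fidelity d (W : cq_channel d) : R :=
  trnorm (psqrt (W 0) *m psqrt (W 1)) ^+ 2.

End Fidelity.

Section Encoding.

Definition bitrev n (k : nat) : nat :=
  (\sum_(j < n) odd (k %/ 2 ^ j) * 2 ^ (n.-1 - j))%N.

Definition bitrev_mx n : 'M['F_2]_(2 ^ n) :=
  \matrix_(i, j) ((j : nat) == bitrev n i)%:R.

Definition arikan_kernel : 'M['F_2]_2 := \matrix_(i, j) ((j <= i)%N)%:R.

Definition arikan_mx n : 'M['F_2]_(2 ^ n) :=
  bitrev_mx n *m ntensmx arikan_kernel n.

(* The row vector (p, b, f): p lists the bits before position i, b is the bit  *)
(* at position i, and f lists the bits after it. Positions are numbered from 0. *)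
Definition bits N (p : seq 'F_2) (b : 'F_2) (f : seq 'F_2) : 'rV['F_2]_N :=
  \row_(j < N) nth 0 (p ++ b :: f) j.

End Encoding.

Section Synthesized.
Variables (R : realType) (d N : nat) (W : cq_channel R d).

Definition tensor_out (x : 'rV['F_2]_N) : 'M[R[i]]_(d ^ N) :=
  tensor (fun k => W (x 0 k)).

Variable G : 'M['F_2]_N.

(* Past bits in a register, future bits uniformly random. *)
Definition synth_past (i : 'I_N) :
    cq_channel R (#|{: i.-tuple 'F_2}| * d ^ N) :=
  fun b => \sum_(p : i.-tuple 'F_2) (2 ^+ i)^-1 *:
    (register R p *t
     \sum_(f : (N - i.+1).-tuple 'F_2) (2 ^+ (N - i.+1))^-1 *:
       tensor_out (bits N p b f *m G)).

(* Future bits in a register, past bits uniformly random. *)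
Definition synth_future (i : 'I_N) :
    cq_channel R (#|{: (N - i.+1).-tuple 'F_2}| * d ^ N) :=
  fun b => \sum_(f : (N - i.+1).-tuple 'F_2) (2 ^+ (N - i.+1))^-1 *:
    (register R f *t
     \sum_(p : i.-tuple 'F_2) (2 ^+ i)^-1 *:
       tensor_out (bits N p b f *m G)).

End Synthesized.

Section Wiretap.
Variable R : realType.
Local Notation C := R[i].
Variables dB dE : nat.

Definition to_B (N : 'M[C]_2 -> 'M[C]_(dB * dE)) (X : 'M[C]_2) : 'M[C]_dB :=
  ptrace_r (N X).
Definition to_E (N : 'M[C]_2 -> 'M[C]_(dB * dE)) (X : 'M[C]_2) : 'M[C]_dE :=
  ptrace_l (N X).

Definition degradable (N : 'M[C]_2 -> 'M[C]_(dB * dE)) : Prop :=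
  exists D : {linear 'M[C]_dB -> 'M[C]_dE},
    quantum_channel D /\ forall X, D (to_B N X) = to_E N X.

Definition isometric_extension (N : 'M[C]_2 -> 'M[C]_(dB * dE)) s2
    (U : 'M[C]_(dB * dE * s2, 2)) : Prop :=
  U^t* *m U = 1%:M /\ forall X, N X = ptrace_r (U *m X *m U^t*).

Definition purification d s (rho : 'M[C]_d) (psi : 'cV[C]_(d * s)) : Prop :=
  ptrace_r (psi *m psi^t*) = rho.

Definition amplitude_channel (N : 'M[C]_2 -> 'M[C]_(dB * dE))
    (rho : 'F_2 -> 'M[C]_2) : cq_channel R dB :=
  fun z => to_B N (rho z).

Variables s1 s2 : nat.
Variables (U : 'M[C]_(dB * dE * s2, 2)) (psi : 'F_2 -> 'cV[C]_(2 * s1)).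

Definition pauliZ : 'M[C]_2 := diag_mx (\row_(z < 2) (-1) ^+ z).

Definition phi_ket : 'cV[C]_(2 * (2 * s1)) :=
  (sqrtC 2)^-1 *: \sum_(z : 'F_2) (delta_mx (z : 'I_2) (0 : 'I_1) *t psi z).

(* U Z^x |phi>; its systems are in the order C, B, E, S2, S1. *)
Definition phase_ket (x : 'F_2) : 'cV[C]_(2 * (dB * dE * s2 * s1)) :=
  ((1%:M : 'M[C]_2) *t (U *t (1%:M : 'M[C]_s1)))
    *m ((pauliZ ^+ x *t (1%:M : 'M[C]_(2 * s1))) *m phi_ket).

Definition braE (e : 'I_dE) :
    'M[C]_(2 * (dB * s2 * s1), 2 * (dB * dE * s2 * s1)) :=
  1%:M *t (rbra R dB e *t 1%:M *t 1%:M).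

(* omega_x with E traced out; its systems are in the order C, B, S2, S1. *)
Definition phase_channel : cq_channel R (2 * (dB * s2 * s1)) :=
  fun x => \sum_(e < dE)
    braE e *m (phase_ket x *m (phase_ket x)^t*) *m (braE e)^t*.

End Wiretap.

Section IndexSets.
Variables (R : realType) (n : nat) (beta : R).

Definition is_good d (W : cq_channel R d) : bool :=
  Num.sqrt (fidelity W) < 2 `^ (- ((2 ^ n)%:R `^ beta)).

Definition good_amplitude d (W : cq_channel R d) : {set 'I_(2 ^ n)} :=
  [set i | is_good (synth_past W (arikan_mx n) i)]%SET.

Definition good_phase d (W : cq_channel R d) : {set 'I_(2 ^ n)} :=
  [set i | is_good (synth_future W (arikan_mx n)^T i)]%SET.

Variables (dA dP : nat) (WA : cq_channel R dA) (WP : cq_channel R dP).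

Definition info_set := good_amplitude WA :&: good_phase WP.
Definition random_set := good_amplitude WA :&: ~: good_phase WP.
Definition frozen_set := ~: good_amplitude WA :&: good_phase WP.
Definition key_set := ~: good_amplitude WA :&: ~: good_phase WP.

Definition key_rate : R := #|key_set|%:R / (2 ^ n)%:R.

End IndexSets.

(* Main.v *)
Require Import Defs.
From mathcomp Require Import all_boot all_order all_algebra.
From mathcomp Require Import complex mxtens.
From mathcomp Require Import all_classical all_reals all_analysis.
From mathcomp Require Import ring lra zify.
Set Implicit Arguments.
Unset Strict Implicit.
Unset Printing Implicit Defensive.
Import Order.TTheory GRing.Theory Num.Theory.
Import numFieldNormedType.Exports.
Local Open Scope ring_scope.
Local Open Scope classical_set_scope.

(** Write a_i and p_i for the root fidelities of the i-th synthesized amplitude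
    and phase channels to Bob.  A key index has a_i >= 2^-N^beta and
    p_i >= 2^-N^beta.

    Undoing the encoder turns the i-th phase channel into one whose two outputs
    are distinguished by the phase of u_i, which Bob can read off a Helstrom-type
    measurement built from Uhlmann's theorem: if e_i is the root fidelity of the
    i-th amplitude channel to Eve, then p_i^2 + e_i^2 <= 1.  Degradability and the
    monotonicity of the fidelity give a_i <= e_i, so a_i^2 + p_i^2 <= 1 and at a
    key index one of a_i, p_i lies between 2^-N^beta and sqrt(1/2).

    Both families polarize, so this happens for o(N) indices only.  One step of
    the recursion satisfies Z^+ <= Z^2 and Z^- <= 2Z - Z^2: measure with the
    Fuchs-Caves measurement, which attains the fidelity, and use the classical
    inequality.  These two upper bounds suffice, as they make the average of
    sqrt Z nonincreasing, and no mutual information is needed. *)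

(** * Positive semidefinite matrices and the root fidelity *)

(** The bounds Z^2 and 2Z - Z^2 add up to exactly 2Z, so by themselves they only keep the average of
    Z from growing and give no drop in the middle range. Concavity of the square root supplies one:
    for u = sqrt Z the average falls at each step by at least the mean of u (1 - u)^2 / 4. Being
    nonnegative, it falls very little after a suitable level m, where few u can then be far from
    both 0 and 1. Paths near 1 at level m mostly stay there, since leaving would lower the average;
    most paths near 0 decay doubly exponentially in the number of steps. On the quantum side the
    obstacle is that the phase channel uses the transposed encoder and knows the future bits.
    Reversing the order of all positions turns the transpose of G_N back into G_N and future into
    past, so one recursion and one polarization theorem serve both families. The trade-off in turn
    rests on G_N being its own inverse: the phase pattern x G_N^T paired with the encoded string u
    G_N is x paired with u. *)

Section PsdMatrices.
Local Open Scope sesquilinear_scope.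
Variable C : numClosedFieldType.

(* [psd] and [psqrt] over an abstract field; unlocking gives back [psqrt]. *)
Definition psdmx n (A : 'M[C]_n) : Prop :=
  forall v : 'cV[C]_n, 0 <= (v^t* *m A *m v) 0 0.

Definition sqrtmx n (A : 'M[C]_n) : 'M[C]_n :=
  locked (invmx (spectralmx A) *m diag_mx (map_mx sqrtC (spectral_diag A))
    *m spectralmx A).

Lemma adjmxM m n p (A : 'M[C]_(m, n)) (B : 'M[C]_(n, p)) :
  (A *m B)^t* = B^t* *m A^t*.
Proof. by rewrite trmx_mul map_mxM. Qed.

Lemma adjmxK m n (A : 'M[C]_(m, n)) : A^t*^t* = A.
Proof. exact: trmxCK. Qed.

Lemma adjmx1 n : (1%:M : 'M[C]_n)^t* = 1%:M.
Proof. by rewrite trmx1 map_mx1. Qed.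

Lemma adjmxB m n (A B : 'M[C]_(m, n)) : (A - B)^t* = A^t* - B^t*.
Proof. by apply/matrixP=> i j; rewrite !mxE rmorphB. Qed.

Lemma gram_diag m n (X : 'M[C]_(m, n)) j :
  (X^t* *m X) j j = \sum_i `|X i j| ^+ 2.
Proof. by rewrite !mxE; apply: eq_bigr => i _; rewrite !mxE normCKC. Qed.

Lemma gram_eq0 m n (X : 'M[C]_(m, n)) : X^t* *m X = 0 -> X = 0.
Proof.
move=> X0; apply/matrixP=> i j; rewrite mxE.
have := gram_diag X j; rewrite X0 mxE => /esym/eqP.
rewrite psumr_eq0 => [|k _]; last exact: exprn_ge0.
by move=> /allP/(_ i); rewrite mem_index_enum expf_eq0 normr_eq0 => /(_ isT)/eqP.
Qed.

Lemma psd_gram m n (X : 'M[C]_(m, n)) : psdmx (X^t* *m X).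
Proof.
move=> v; have -> : v^t* *m (X^t* *m X) *m v = (X *m v)^t* *m (X *m v).
  by rewrite adjmxM !mulmxA.
by rewrite gram_diag sumr_ge0// => i _; exact: exprn_ge0.
Qed.

Lemma psd_congr m n (X : 'M[C]_(m, n)) A : psdmx A -> psdmx (X^t* *m A *m X).
Proof.
move=> A0 v; have -> : v^t* *m (X^t* *m A *m X) *m v = (X *m v)^t* *m A *m (X *m v).
  by rewrite adjmxM !mulmxA.
exact: A0.
Qed.

Lemma psd_diag_ge0 n (A : 'M[C]_n) i : psdmx A -> 0 <= A i i.
Proof.
move=> /(_ (delta_mx i 0)); rewrite trmx_delta map_delta_mx -rowE -colE.
by rewrite !mxE.
Qed.

Lemma psd_tr_ge0 n (A : 'M[C]_n) : psdmx A -> 0 <= \tr A.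
Proof. by move=> A0; apply: sumr_ge0 => i _; exact: psd_diag_ge0. Qed.

(** The quadratic form of [A - A^t*] vanishes on all vectors; polarization with the coefficients 1
    and ['i] then kills every entry. *)
Lemma psd_adj n (A : 'M[C]_n) : psdmx A -> A^t* = A.
Proof.
move=> A0; have key (v : 'cV[C]_n) : v^t* *m (A - A^t*) *m v = 0.
  apply/matrixP=> i j; rewrite (ord1 i) (ord1 j) mulmxBr mulmxBl mxE [X in _ + X]mxE [RHS]mxE.
  apply/eqP; rewrite subr_eq0; apply/eqP.
  have /geC0_conj <- := A0 v.
  have -> : v^t* *m A^t* *m v = (v^t* *m A *m v)^t*.
    by rewrite !adjmxM adjmxK mulmxA.
  by rewrite [RHS]mxE; congr (_^*); rewrite [RHS]mxE.
apply/esym/eqP; rewrite -subr_eq0; apply/eqP; move: (A - _) key => B key.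
apply/matrixP=> i j; rewrite mxE.
have ent k l : (delta_mx k 0 : 'cV[C]__)^t* *m B *m delta_mx l 0 = (B k l)%:M.
  rewrite trmx_delta map_delta_mx -rowE -colE.
  by apply/matrixP=> a b; rewrite (ord1 a) (ord1 b) !mxE mulr1n.
have ortho k : B k k = 0.
  by have /matrixP/(_ 0 0) := key (delta_mx k 0); rewrite ent !mxE mulr1n.
have cross (c : C) : c * B i j + c^* * B j i = 0.
  have /matrixP/(_ 0 0) := key (delta_mx i 0 + c *: delta_mx j 0).
  have -> : (delta_mx i 0 + c *: delta_mx j 0 : 'cV[C]__)^t* =
            (delta_mx i 0)^t* + c^* *: (delta_mx j 0)^t*.
    by apply/matrixP=> a b; rewrite !mxE rmorphD rmorphM.
  rewrite !(mulmxDl, mulmxDr) -!(scalemxAr, scalemxAl) !ent !mxE !mulr1n !ortho.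
  by rewrite !(mulr0, add0r, addr0) addrC.
have e1 := cross 1; have e2 := cross 'i; rewrite conjCi rmorph1 in e1 e2.
have : 2 * B i j = 0.
  have -> : 2 * B i j = (1 * B i j + 1 * B j i) - 'i * ('i * B i j + - 'i * B j i).
    rewrite mulrDr mulrA (mulrA 'i (- 'i)) mulrN -expr2 sqrCi; ring.
  by rewrite e1 e2 mulr0 subr0.
by move/eqP; rewrite mulf_eq0 pnatr_eq0 /= => /eqP.
Qed.

Section FunctionalCalculus.
Variables (n : nat) (A : 'M[C]_n).

Let P := spectralmx A.
Let d := spectral_diag A.

Let PP : P *m P^t* = 1%:M.
Proof. exact/unitarymxP/spectral_unitarymx. Qed.

Definition fcalc (f : C -> C) : 'M[C]_n := P^t* *m diag_mx (map_mx f d) *m P.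

Lemma sqrtmxE : sqrtmx A = fcalc sqrtC.
Proof. by rewrite /sqrtmx -lock invmx_unitary// spectral_unitarymx. Qed.

Lemma fcalcM f g : fcalc f *m fcalc g = fcalc (fun x => f x * g x).
Proof.
rewrite /fcalc -!mulmxA (mulmxA P) PP mul1mx (mulmxA (diag_mx _)) mulmx_diag.
by congr (_ *m (_ *m _)); congr diag_mx; apply/rowP=> j; rewrite !mxE.
Qed.

Lemma eq_fcalc f g : (forall i, f (d 0 i) = g (d 0 i)) -> fcalc f = fcalc g.
Proof.
by move=> fg; congr (_ *m _ *m _); congr diag_mx; apply/matrixP=> i j; rewrite !mxE ord1.
Qed.

Lemma fcalc_adj f : (fcalc f)^t* = fcalc (fun x => (f x)^*).
Proof.
rewrite /fcalc !adjmxM adjmxK mulmxA; congr (_ *m _ *m _).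
by rewrite tr_diag_mx map_diag_mx; congr diag_mx; apply/matrixP=> i j; rewrite !mxE.
Qed.

Hypothesis A_psd : psdmx A.

Lemma fcalc_id : fcalc id = A.
Proof.
have /orthomx_spectralP E : A \is normalmx.
  by apply/normalmxP; rewrite psd_adj.
rewrite [RHS]E invmx_unitary ?spectral_unitarymx//.
by congr (_ *m _ *m _); congr diag_mx; apply/rowP=> j; rewrite !mxE.
Qed.

Lemma psd_eigenvalue_ge0 i : 0 <= d 0 i.
Proof.
have := psd_diag_ge0 i (psd_congr (P^t*) A_psd).
rewrite -[X in _ *m X *m _]fcalc_id adjmxK /fcalc -!mulmxA PP mulmx1.
by rewrite mulmxA PP mul1mx !mxE eqxx mulr1n.
Qed.

Lemma sqrtmx_sqr : sqrtmx A *m sqrtmx A = A.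
Proof.
rewrite sqrtmxE fcalcM -[RHS]fcalc_id; apply: eq_fcalc => i.
by rewrite -expr2 sqrtCK.
Qed.

Lemma sqrtmx_adj : (sqrtmx A)^t* = sqrtmx A.
Proof.
rewrite sqrtmxE fcalc_adj; apply: eq_fcalc => i.
by rewrite geC0_conj// sqrtC_ge0 psd_eigenvalue_ge0.
Qed.

Lemma sqrtmx_psd : psdmx (sqrtmx A).
Proof.
(* The fourth root displays the square root as a Gram matrix. *)
have -> : sqrtmx A = (fcalc (sqrtC \o sqrtC))^t* *m fcalc (sqrtC \o sqrtC).
  rewrite fcalc_adj fcalcM sqrtmxE; apply: eq_fcalc => i /=.
  by rewrite geC0_conj ?sqrtC_ge0 ?sqrtC_ge0 ?psd_eigenvalue_ge0// -expr2 sqrtCK.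
exact: psd_gram.
Qed.

(* As [0^-1 = 0], the witness is the pseudo-inverse of [sqrtmx A]. *)
Lemma sqrtmx_pinv : exists G : 'M[C]_n,
  [/\ G^t* = G, G *m sqrtmx A = sqrtmx A *m G,
      G *m sqrtmx A *m sqrtmx A = sqrtmx A & G *m sqrtmx A *m G = G].
Proof.
have ge0 i : 0 <= sqrtC (d 0 i) by rewrite sqrtC_ge0 psd_eigenvalue_ge0.
exists (fcalc (fun x => (sqrtC x)^-1)); rewrite sqrtmxE.
split; rewrite ?fcalc_adj ?fcalcM ?fcalcM; apply: eq_fcalc => i //=.
- by rewrite geC0_conj// invr_ge0.
- by rewrite mulrC.
- by have [->|nz] := eqVneq (sqrtC (d 0 i)) 0; rewrite ?mulr0// mulVf// mul1r.
- by have [->|nz] := eqVneq (sqrtC (d 0 i)) 0; rewrite ?invr0 ?mulr0// mulVf// mul1r.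
Qed.

End FunctionalCalculus.

Lemma tr_CauchySchwarz m n (X Y : 'M[C]_(m, n)) :
  `|\tr (X^t* *m Y)| ^+ 2 <= \tr (X^t* *m X) * \tr (Y^t* *m Y).
Proof.
have dotE (A B : 'M[C]_(m, n)) : dotmx (mxvec B) (mxvec A) = \tr (A^t* *m B).
  transitivity (\sum_i \sum_j (A i j)^* * B i j); last first.
    rewrite exchange_big; apply: eq_bigr => j _; rewrite mxE.
    by apply: eq_bigr => i _; rewrite !mxE.
  rewrite dotmxE mxE pair_bigA/=.
  rewrite (reindex _ (curry_mxvec_bij m n))/=; apply: eq_bigr => -[i j] _.
  by rewrite [X in _ * X]mxE [X in _ * _ X]mxE/= !mxvecE mulrC.
by rewrite -!dotE mulrC; have [] := CauchySchwarz (@dotmx _ _) (mxvec Y) (mxvec X).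
Qed.

Lemma tr_mul_psd_ge0 n (A B : 'M[C]_n) : psdmx A -> psdmx B -> 0 <= \tr (A *m B).
Proof.
move=> A0 B0; rewrite -(sqrtmx_sqr B0) mulmxA mxtrace_mulC mulmxA.
by rewrite -{1}(sqrtmx_adj B0); exact/psd_tr_ge0/psd_congr.
Qed.

Lemma proj_compl_psd n (P : 'M[C]_n) : P^t* = P -> P *m P = P -> psdmx (1%:M - P).
Proof.
move=> PH PP; have -> : 1%:M - P = (1%:M - P)^t* *m (1%:M - P).
  by rewrite adjmxB adjmx1 PH mulmxBl mul1mx mulmxBr mulmx1 PP subrr subr0.
exact: psd_gram.
Qed.

Definition tnorm n (A : 'M[C]_n) : C := \tr (sqrtmx (A^t* *m A)).

(** The adjoint polar factor [G *m A^t*], with [G] the pseudo-inverse of |A|. For singular [A] it is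
    only a partial isometry, whose range projector is [G] |A|; this is why the claim is an operator
    bound and not unitarity. *)
Lemma tnorm_polar n (A : 'M[C]_n) : exists U : 'M[C]_n,
  psdmx (1%:M - U *m U^t*) /\ \tr (U *m A) = tnorm A.
Proof.
have B0 := psd_gram A; have [G [GH GS GSS GSG]] := sqrtmx_pinv B0.
exists (G *m A^t*); split; last first.
  by rewrite /tnorm -mulmxA -{1}(sqrtmx_sqr B0) mulmxA GSS.
have -> : G *m A^t* *m (G *m A^t*)^t* = G *m sqrtmx (A^t* *m A).
  rewrite adjmxM adjmxK GH mulmxA -(mulmxA G) -{1}(sqrtmx_sqr B0) mulmxA GSS.
  by rewrite -GS.
apply: proj_compl_psd; first by rewrite adjmxM GH sqrtmx_adj.
by rewrite !mulmxA GSG.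
Qed.

(** Write the trace norm as tr (U sqrt r sqrt s) and insert the sum of the M_k between the two
    roots. Cauchy-Schwarz bounds each term, half of M_k going to either side, and the factor U U^*
    on the side of s is at most 1. *)
Lemma root_fidelity_le_povm n (r s : 'M[C]_n) (K : finType) (M : K -> 'M[C]_n) :
  psdmx r -> psdmx s -> (forall k, psdmx (M k)) -> \sum_k M k = 1%:M ->
  tnorm (sqrtmx r *m sqrtmx s) <=
  \sum_k sqrtC (\tr (M k *m r)) * sqrtC (\tr (M k *m s)).
Proof.
move=> r0 s0 M0 M1; have [U [U1 UE]] := tnorm_polar (sqrtmx r *m sqrtmx s).
rewrite -UE.
have UM : U *m (sqrtmx r *m sqrtmx s) =
    \sum_k U *m sqrtmx r *m M k *m sqrtmx s.
  by rewrite -mulmx_suml -mulmx_sumr M1 mulmx1 mulmxA.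
have trU0 : 0 <= \tr (U *m (sqrtmx r *m sqrtmx s)).
  by rewrite UE; exact/psd_tr_ge0/sqrtmx_psd/psd_gram.
rewrite -(ger0_norm trU0) => {trU0}; rewrite UM raddf_sum /=; apply: le_trans (ler_norm_sum _ _ _) _.
apply: ler_sum => k _.
pose X := sqrtmx (M k) *m sqrtmx r; pose Y := sqrtmx (M k) *m sqrtmx s *m U.
have -> : \tr (U *m sqrtmx r *m M k *m sqrtmx s) = \tr (X^t* *m Y).
  rewrite adjmxM !sqrtmx_adj// /Y !mulmxA -(mulmxA (sqrtmx r)) sqrtmx_sqr//.
  by rewrite -!mulmxA mxtrace_mulC !mulmxA.
rewrite -sqrtCM ?nnegrE ?tr_mul_psd_ge0// -[leLHS]sqrCK// ler_sqrtC ?nnegrE ?exprn_ge0// ?mulr_ge0 ?tr_mul_psd_ge0//.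
apply: le_trans (tr_CauchySchwarz X Y) _.
have XE : \tr (X^t* *m X) = \tr (M k *m r).
  rewrite mxtrace_mulC adjmxM !sqrtmx_adj// /X mulmxA -(mulmxA (sqrtmx (M k))).
  by rewrite sqrtmx_sqr// mxtrace_mulC mulmxA sqrtmx_sqr.
rewrite XE ler_wpM2l ?tr_mul_psd_ge0// -subr_ge0.
pose Z := sqrtmx (M k) *m sqrtmx s.
have ZE : \tr (M k *m s) = \tr (Z *m Z^t*).
  rewrite adjmxM !sqrtmx_adj// /Z mulmxA -(mulmxA (sqrtmx (M k))).
  by rewrite sqrtmx_sqr// [RHS]mxtrace_mulC mulmxA sqrtmx_sqr.
have -> : \tr (Y^t* *m Y) = \tr (Z *m (U *m U^t*) *m Z^t*).
  by rewrite mxtrace_mulC /Y -/Z adjmxM !mulmxA.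
have ZB : Z *m Z^t* - Z *m (U *m U^t*) *m Z^t* = Z *m (1%:M - U *m U^t*) *m Z^t*.
  by rewrite mulmxBr mulmx1 mulmxBl.
rewrite ZE -linearB/= ZB.
by rewrite -{1}(adjmxK Z); exact/psd_tr_ge0/psd_congr.
Qed.

(* The Fuchs-Caves measurement.  With G the pseudo-inverse of sqrt s and P the
   projector on the support of s, the matrix M = G (sqrt s r sqrt s)^(1/2) G
   satisfies M s M = P r P.  Shifting to M - (1 - P) marks the eigenvectors
   outside the support of s by the eigenvalue -1, so that every eigenvector is
   either in the kernel of s or in its support. *)
Lemma root_fidelity_attained n (r s : 'M[C]_n) : psdmx r -> psdmx s ->
  exists Q : 'M[C]_n, Q *m Q^t* = 1%:M /\
  \sum_k sqrtC ((Q *m r *m Q^t*) k k) * sqrtC ((Q *m s *m Q^t*) k k)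
    = tnorm (sqrtmx r *m sqrtmx s).
Proof.
move=> r0 s0; have [G [GH GS GSS GSG]] := sqrtmx_pinv s0.
set S := sqrtmx s in GS GSS GSG.
have SH : S^t* = S by exact: sqrtmx_adj.
have SS : S *m S = s by exact: sqrtmx_sqr.
have gramE : (sqrtmx r *m S)^t* *m (sqrtmx r *m S) = S *m r *m S.
  by rewrite adjmxM SH sqrtmx_adj// mulmxA -(mulmxA S) sqrtmx_sqr.
have B0 : psdmx (S *m r *m S) by rewrite -gramE; exact: psd_gram.
set T := sqrtmx (S *m r *m S).
have TT : T *m T = S *m r *m S by exact: sqrtmx_sqr.
have T0 : psdmx T by exact: sqrtmx_psd.
have TH : T^t* = T by exact: sqrtmx_adj.
pose P := G *m S.
have PH : P^t* = P by rewrite adjmxM GH SH /P GS.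
have PP : P *m P = P by rewrite /P mulmxA GSG.
have SP : S *m P = S by rewrite /P mulmxA -GS GSS.
have PS : P *m S = S by rewrite /P GSS.
(* The kernel of S lies in that of T: the Gram matrix of T (1 - P) is (1 - P) S r S (1 - P) = 0. *)
have TP : T *m P = T.
  apply/esym/eqP; rewrite -subr_eq0 -{1}(mulmx1 T) -mulmxBr; apply/eqP/gram_eq0.
  rewrite adjmxM TH adjmxB adjmx1 PH mulmxA -(mulmxA (1%:M - P)) TT.
  by rewrite -!mulmxA mulmxBr mulmx1 SP subrr !mulmx0.
have PT : P *m T = T by rewrite -[LHS]adjmxK adjmxM TH PH TP TH.
pose M := G *m T *m G.
have M0 : psdmx M by rewrite /M -{1}GH; exact: psd_congr.
have MH : M^t* = M by exact: psd_adj.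
have PG : P *m G = G by rewrite /P GSG.
have PM : P *m M = M by rewrite /M !mulmxA PG.
have MP : M *m P = M by rewrite -[LHS]adjmxK adjmxM MH PH PM MH.
have MsM : M *m s *m M = P *m r *m P.
  transitivity (G *m (T *m P *m (P *m T)) *m G).
    by rewrite /M -SS /P {2}GS !mulmxA.
  by rewrite TP PT TT /P {2}GS !mulmxA.
have tP : \tr (M *m s) = tnorm (sqrtmx r *m S).
  rewrite /tnorm gramE -/T /M -SS !mulmxA -(mulmxA _ G S) -/P -(mulmxA G T P) TP.
  by rewrite -mulmxA mxtrace_mulC -mulmxA -GS -/P TP.
clearbody M P.
pose H := M - (1%:M - P).
have HH : H^t* = H by rewrite !adjmxB adjmx1 MH PH.
pose Q := spectralmx H; pose d := spectral_diag H.
have QQ : Q *m Q^t* = 1%:M by exact/unitarymxP/spectral_unitarymx.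
have QQ' : Q^t* *m Q = 1%:M by exact/mulmx1C/QQ.
have HE : H = Q^t* *m diag_mx d *m Q.
  have /orthomx_spectralP : H \is normalmx by apply/normalmxP; rewrite HH.
  by rewrite invmx_unitary ?spectral_unitarymx.
exists Q; split=> //.
pose cj (A : 'M[C]_n) := Q *m A *m Q^t*.
have cjM A B : cj (A *m B) = cj A *m cj B.
  by rewrite /cj -!mulmxA (mulmxA (Q^t*)) QQ' mul1mx.
have cj1 : cj 1%:M = 1%:M by rewrite /cj mulmx1.
have cj_psd A : psdmx A -> psdmx (cj A).
  by move=> A0; rewrite /cj -{1}(adjmxK Q); exact: psd_congr.
have cjH : cj H = diag_mx d by rewrite /cj HE !mulmxA QQ mul1mx -mulmxA QQ mulmx1.
have tr_cj A : \tr (cj A) = \tr A by rewrite /cj mxtrace_mulC mulmxA QQ' mul1mx.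
have cjHE : cj M - (1%:M - cj P) = diag_mx d.
  by rewrite -cjH -cj1 /cj /H !(mulmxBr, mulmxBl).
have cM : cj M = diag_mx d *m cj P.
  by rewrite -cjHE mulmxBl -cjM MP mulmxBl mul1mx -cjM PP subrr subr0.
have cM' : cj M = cj P *m diag_mx d.
  by rewrite -cjHE mulmxBr -cjM PM mulmxBr mulmx1 -cjM PP subrr subr0.
have cPH : (cj P)^t* = cj P by rewrite /cj !adjmxM adjmxK PH mulmxA.
have cPC i j : cj P i j = (cj P j i)^* by rewrite -{1}cPH 2!mxE.
rewrite -![Q *m _ *m Q^t*]/(cj _); clearbody cj.
have term k : sqrtC (cj r k k) * sqrtC (cj s k k) = cj (M *m s) k k.
  have cPs : cj s = cj P *m cj s by rewrite -cjM -SS mulmxA PS.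
  have cMs : cj (M *m s) k k = d 0 k * cj s k k.
    by rewrite cjM cM -mulmxA -cPs mul_diag_mx mxE.
  (* H acts as -1 on the range of 1 - P, so an eigenvector with any other eigenvalue lies in the
     support of s. *)
  have rel : (d 0 k + 1) *: row k (1%:M - cj P) = 0.
    have : (diag_mx d + 1%:M) *m (1%:M - cj P) = 0.
      by rewrite mulmxDl mul1mx mulmxBr mulmx1 -cM -cjHE addrAC subrK subrr.
    move=> /matrixP E; apply/rowP=> j; have := E k j.
    by rewrite mulmxDl mul_diag_mx mul1mx !mxE mulrDl mul1r.
  have [dk|dk] := eqVneq (d 0 k + 1) 0.
    have {}dk : d 0 k = -1 by apply/eqP; rewrite -addr_eq0 dk.
    (* At the eigenvalue -1 the diagonal entry of M is minus that of P, and both are nonnegative. *)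
    have Pk0 : cj P k k = 0.
      apply/eqP; rewrite eq_le; apply/andP; split; last first.
        by apply/psd_diag_ge0/cj_psd; rewrite -PP -{1}PH; exact: psd_gram.
      rewrite -oppr_ge0; have := psd_diag_ge0 k (cj_psd _ M0).
      by rewrite cM mul_diag_mx mxE dk mulN1r.
    have row0 j : cj P k j = 0.
      have : (cj P *m cj P) k k = 0 by rewrite -cjM PP.
      rewrite -{1}cPH gram_diag => /eqP; rewrite psumr_eq0 => [|i _]; last exact: exprn_ge0.
      move=> /allP/(_ j); rewrite mem_index_enum expf_eq0 normr_eq0 => /(_ isT)/eqP jk.
      by rewrite cPC jk conjC0.
    have s00 : cj s k k = 0.
      by rewrite cPs mxE big1// => j _; rewrite row0 mul0r.
    by rewrite cMs s00 mulr0/= sqrtC0 mulr0.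
  have Prow j : cj P k j = (k == j)%:R.
    have /rowP/(_ j)/eqP := rel; rewrite !mxE mulf_eq0 (negbTE dk)/= subr_eq0.
    by move=> /eqP ->.
  have Pcol j : cj P j k = (k == j)%:R.
    by rewrite cPC Prow conjC_nat.
  have dk0 : 0 <= d 0 k.
    have := psd_diag_ge0 k (cj_psd _ M0).
    by rewrite cM mul_diag_mx mxE Prow eqxx mulr1.
  (* The k-th diagonal entry of M s M = P r P. It makes the geometric mean of the two probabilities
     equal to d_k s_kk, a diagonal entry of M s, and these sum to the trace norm. *)
  have rk : cj r k k = d 0 k ^+ 2 * cj s k k.
    have : (diag_mx d *m (cj s *m cj P) *m diag_mx d) k k = (cj P *m cj r *m cj P) k k.
      by rewrite -!cjM -MsM !cjM {1}cM cM' {1}cPs !mulmxA.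
    rewrite mul_mx_diag mxE mul_diag_mx mxE.
    have -> : (cj s *m cj P) k k = cj s k k.
      rewrite mxE (bigD1 k)//= big1 ?Pcol ?eqxx ?mulr1 ?addr0// => j jk.
      by rewrite Pcol eq_sym (negbTE jk) mulr0.
    have -> : (cj P *m cj r *m cj P) k k = cj r k k.
      rewrite mxE (bigD1 k)//= big1 ?Pcol ?eqxx ?mulr1 ?addr0// => [|j jk]; last first.
        by rewrite Pcol eq_sym (negbTE jk) mulr0.
      rewrite mxE (bigD1 k)//= big1 ?Prow ?eqxx ?mul1r ?addr0// => j jk.
      by rewrite Prow eq_sym (negbTE jk) mul0r.
    by move=> <-; rewrite expr2 mulrAC.
  have sk0 : 0 <= cj s k k by exact/psd_diag_ge0/cj_psd.
  rewrite cMs rk sqrtCM ?nnegrE ?exprn_ge0// sqrCK//.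
  by rewrite -mulrA -expr2 sqrtCK.
by rewrite (eq_bigr _ (fun k _ => term k)) -/(mxtrace _) tr_cj tP.
Qed.

Lemma psd_le_sqnorm m n (W : 'M[C]_(m, n)) (v : 'cV[C]_n) :
  psdmx (1%:M - W^t* *m W) ->
  \sum_i `|(W *m v) i 0| ^+ 2 <= \sum_i `|v i 0| ^+ 2.
Proof.
move=> /(_ v); rewrite mulmxBr mulmxBl mulmx1 mulmxA -mulmxA -adjmxM.
by rewrite -!gram_diag mxE [X in _ + X]mxE subr_ge0.
Qed.

Definition contraction m n (X : 'M[C]_(m, n)) : Prop :=
  forall v : 'cV[C]_n, \sum_i `|(X *m v) i 0| ^+ 2 <= \sum_i `|v i 0| ^+ 2.

Lemma contraction_mul m n p (X : 'M[C]_(m, n)) (Y : 'M[C]_(n, p)) :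
  contraction X -> contraction Y -> contraction (X *m Y).
Proof. by move=> cX cY v; rewrite -mulmxA; apply: le_trans (cY v). Qed.

Lemma vec_CauchySchwarz n (u v : 'cV[C]_n) :
  `|(u^t* *m v) 0 0| ^+ 2 <= (\sum_i `|u i 0| ^+ 2) * (\sum_i `|v i 0| ^+ 2).
Proof. by rewrite -!gram_diag -!trace_mx11; exact: tr_CauchySchwarz. Qed.

(** With a the squared norm of X^* v and b that of v, Cauchy-Schwarz for v and X X^* v gives a^2 <=
    b a. *)
Lemma contraction_adj m n (X : 'M[C]_(m, n)) : contraction X -> contraction (X^t*).
Proof.
move=> cX v; set a := \sum_i _; set b := \sum_i _.
have a0 : 0 <= a by apply: sumr_ge0 => i _; exact: exprn_ge0.
have b0 : 0 <= b by apply: sumr_ge0 => i _; exact: exprn_ge0.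
have aE : (v^t* *m (X *m (X^t* *m v))) 0 0 = a.
  by rewrite /a -gram_diag adjmxM adjmxK !mulmxA.
have := vec_CauchySchwarz v (X *m (X^t* *m v)).
rewrite aE -/b ger0_norm// => h.
have [->//|an0] := eqVneq a 0.
have a_gt0 : 0 < a by rewrite lt_def an0.
rewrite -(ler_pM2l a_gt0) -expr2 mulrC; apply: le_trans h _.
by rewrite ler_wpM2l// cX.
Qed.

(* Uhlmann's theorem for two arbitrary purifications, given as matrices. *)
Lemma root_fidelity_purifications m n (F0 F1 : 'M[C]_(m, n)) :
  exists X : 'M[C]_m, contraction X /\
    \tr (X *m (F0 *m F1^t*)) = tnorm (sqrtmx (F0^t* *m F0) *m sqrtmx (F1^t* *m F1)).
Proof.
have A0 := psd_gram F0; have A1 := psd_gram F1.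
have [U [U1 UE]] := tnorm_polar (sqrtmx (F0^t* *m F0) *m sqrtmx (F1^t* *m F1)).
have [G0 [G0H G0S G0SS G0SG]] := sqrtmx_pinv A0.
have [G1 [G1H G1S G1SS G1SG]] := sqrtmx_pinv A1.
have pinv_contr (F G : 'M[C]_(m, n)) (H : 'M[C]_n) : psdmx (F^t* *m F) -> H^t* = H ->
    H *m sqrtmx (F^t* *m F) = sqrtmx (F^t* *m F) *m H ->
    H *m sqrtmx (F^t* *m F) *m sqrtmx (F^t* *m F) = sqrtmx (F^t* *m F) ->
    H *m sqrtmx (F^t* *m F) *m H = H -> contraction (F *m H).
  move=> F2 HH HS HSS HSH v; apply: psd_le_sqnorm.
  have -> : (F *m H)^t* *m (F *m H) = H *m sqrtmx (F^t* *m F).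
    rewrite adjmxM HH !mulmxA -(mulmxA H) -{1}(sqrtmx_sqr F2) mulmxA HSS.
    by rewrite HS.
  apply: proj_compl_psd; first by rewrite adjmxM HH sqrtmx_adj.
  by rewrite mulmxA HSH.
(* [F0 *m G0] and [F1 *m G1] are the partial isometries in the polar decompositions of [F0] and
   [F1]; they carry [U] to the purifying space. *)
exists (F1 *m G1 *m U *m (F0 *m G0)^t*); split.
  apply: contraction_mul; last exact/contraction_adj/pinv_contr.
  apply: contraction_mul; first exact: pinv_contr.
  by rewrite -(adjmxK U); apply: contraction_adj => v; apply: psd_le_sqnorm; rewrite adjmxK.
rewrite -UE mxtrace_mulC; set S0 := sqrtmx _ in G0H G0S G0SS G0SG *.
set S1 := sqrtmx _ in G1H G1S G1SS G1SG *.
have e0 : (F0 *m G0)^t* *m F0 = S0.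
  by rewrite adjmxM G0H -mulmxA -{1}(sqrtmx_sqr A0) mulmxA G0SS.
have e1 : F1^t* *m (F1 *m G1) = S1.
  by rewrite mulmxA -{1}(sqrtmx_sqr A1) -/S1 -mulmxA -G1S mulmxA -G1S G1SS.
by rewrite -e0 -e1 [RHS]mxtrace_mulC -!mulmxA [RHS]mxtrace_mulC !mulmxA mxtrace_mulC !mulmxA.
Qed.

End PsdMatrices.

(** * Root fidelity under measurements and channels, and the two bounds for one polarization step *)

Section Measurements.
Local Open Scope sesquilinear_scope.
Variable C : numClosedFieldType.

Definition root_fidelity n (r s : 'M[C]_n) : C := tnorm (sqrtmx r *m sqrtmx s).

Lemma root_fidelity_ge0 n (r s : 'M[C]_n) : 0 <= root_fidelity r s.
Proof. exact/psd_tr_ge0/sqrtmx_psd/psd_gram. Qed.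

(** Positivity over an arbitrary finite index type: composite systems can be labelled by pairs,
    tuples and functions instead of the integers that code them. *)
Definition psdker (T : finType) (M : T -> T -> C) : Prop :=
  forall v : T -> C, 0 <= \sum_t \sum_t' (v t)^* * M t t' * v t'.

Lemma psdker_gram (T J : finType) (a : J -> T -> C) :
  psdker (fun t t' => \sum_j a j t * (a j t')^*).
Proof.
move=> v; have -> : \sum_t \sum_t' (v t)^* * (\sum_j a j t * (a j t')^*) * v t' =
    \sum_j `|\sum_t (a j t)^* * v t| ^+ 2.
  under eq_bigr do under eq_bigr do rewrite mulr_sumr mulr_suml.
  under eq_bigr do rewrite exchange_big/=.
  rewrite exchange_big/=; apply: eq_bigr => j _.
  rewrite normCKC rmorph_sum mulr_suml; apply: eq_bigr => t _.
  rewrite mulr_sumr; apply: eq_bigr => t' _.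
  by rewrite rmorphM /= conjCK; ring.
by apply: sumr_ge0 => j _; exact: exprn_ge0.
Qed.

Lemma quad_form n (A : 'M[C]_n) (v : 'cV[C]_n) :
  (v^t* *m A *m v) 0 0 = \sum_i \sum_j (v i 0)^* * A i j * v j 0.
Proof.
rewrite -mulmxA mxE; apply: eq_bigr => i _; rewrite !mxE mulr_sumr.
by apply: eq_bigr => j _; rewrite mulrA.
Qed.

Section Relabel.
Variables (n : nat) (T : finType) (g : T -> 'I_n).
Hypothesis g_bij : bijective g.

Lemma psdmx_psdker (A : 'M[C]_n) :
  psdmx A <-> psdker (fun t t' => A (g t) (g t')).
Proof.
have [h hK gK] := g_bij; split=> A0 v.
  have := A0 (\col_i v (h i)); rewrite quad_form (reindex g)/=; last exact: onW_bij.
  congr (_ <= _); apply: eq_bigr => t _; rewrite (reindex g)/=; last exact: onW_bij.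
  by apply: eq_bigr => t' _; rewrite !mxE !hK.
have := A0 (fun t => v (g t) 0); congr (_ <= _).
rewrite quad_form [RHS](reindex g)/=; last exact: onW_bij.
by apply: eq_bigr => t _; rewrite [RHS](reindex g)//=; exact: onW_bij.
Qed.

Lemma tr_relabel (A : 'M[C]_n) : \tr A = \sum_t A (g t) (g t).
Proof. by rewrite /mxtrace (reindex g)//; exact: onW_bij. Qed.

Lemma root_fidelity_le_povm_kernel (r s : 'M[C]_n) (K : finType) (M : K -> T -> T -> C) :
  psdmx r -> psdmx s -> (forall k, psdker (M k)) ->
  (forall t t', \sum_k M k t t' = (t == t')%:R) ->
  root_fidelity r s <=
  \sum_k sqrtC (\sum_t \sum_t' M k t t' * r (g t') (g t)) *
         sqrtC (\sum_t \sum_t' M k t t' * s (g t') (g t)).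
Proof.
move=> r0 s0 M0 M1; have [h hK gK] := g_bij.
pose B k : 'M[C]_n := \matrix_(i, j) M k (h i) (h j).
have trB k A : \tr (B k *m A) = \sum_t \sum_t' M k t t' * A (g t') (g t).
  rewrite tr_relabel; apply: eq_bigr => t _; rewrite mxE (reindex g)/=; last exact: onW_bij.
  by apply: eq_bigr => t' _; rewrite !mxE !hK.
under eq_bigr do rewrite -!trB.
apply: root_fidelity_le_povm => // [k|].
  apply/psdmx_psdker => v; have := M0 k v; congr (_ <= _).
  by apply: eq_bigr => t _; apply: eq_bigr => t' _; rewrite mxE !hK.
apply/matrixP=> i j; rewrite summxE !mxE -(can_eq gK) -M1.
by apply: eq_bigr => k _; rewrite mxE.
Qed.

End Relabel.

(* Pulling back the optimal measurement of [A] through the channel with Kraus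
   operators [L] gives a measurement of [B]. *)
Lemma root_fidelity_mono nA nB (TA TB J : finType) (gA : TA -> 'I_nA) (gB : TB -> 'I_nB)
    (A0 A1 : 'M[C]_nA) (B0 B1 : 'M[C]_nB) (L : J -> TA -> TB -> C) :
  bijective gA -> bijective gB ->
  psdmx A0 -> psdmx A1 -> psdmx B0 -> psdmx B1 ->
  (forall t t', \sum_j \sum_a (L j a t)^* * L j a t' = (t == t')%:R) ->
  (forall a a', A0 (gA a) (gA a') =
     \sum_j \sum_t \sum_t' L j a t * B0 (gB t) (gB t') * (L j a' t')^*) ->
  (forall a a', A1 (gA a) (gA a') =
     \sum_j \sum_t \sum_t' L j a t * B1 (gB t) (gB t') * (L j a' t')^*) ->
  root_fidelity B0 B1 <= root_fidelity A0 A1.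
Proof.
move=> gA_bij gB_bij A00 A10 B00 B10 L1 eA0 eA1.
have [Q [QQ QE]] := root_fidelity_attained A00 A10.
have QQ' : Q^t* *m Q = 1%:M by exact/mulmx1C.
rewrite /root_fidelity -QE.
(* The k-th pulled-back effect is the sum over j of L_j^* |q_k><q_k| L_j, where <q_k| is the k-th
   row of [Q]. *)
pose a k j t := \sum_x (Q k (gA x) * L j x t)^*.
pose M k t t' := \sum_j a k j t * (a k j t')^*.
have aC k j t : (a k j t)^* = \sum_x Q k (gA x) * L j x t.
  by rewrite rmorph_sum; apply: eq_bigr => x _; rewrite /= conjCK.
have main (A : 'M[C]_nA) (B : 'M[C]_nB) k : (forall a a', A (gA a) (gA a') =
     \sum_j \sum_t \sum_t' L j a t * B (gB t) (gB t') * (L j a' t')^*) ->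
   (Q *m A *m Q^t*) k k = \sum_t \sum_t' M k t t' * B (gB t') (gB t).
  move=> eA; transitivity (\sum_x \sum_x' Q k (gA x) * A (gA x) (gA x') * (Q k (gA x'))^*).
    rewrite -mulmxA mxE (reindex gA)/=; last exact: onW_bij.
    apply: eq_bigr => x _; rewrite mxE mulr_sumr (reindex gA)/=; last exact: onW_bij.
    by apply: eq_bigr => x' _; rewrite !mxE mulrA.
  transitivity (\sum_j \sum_t \sum_t' (a k j t)^* * B (gB t) (gB t') * a k j t').
    transitivity (\sum_x \sum_x' \sum_j \sum_t \sum_t'
        (Q k (gA x) * L j x t) * B (gB t) (gB t') * (Q k (gA x') * L j x' t')^*).
      apply: eq_bigr => x _; apply: eq_bigr => x' _; rewrite eA mulr_sumr mulr_suml.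
      apply: eq_bigr => j _; rewrite mulr_sumr mulr_suml; apply: eq_bigr => t _.
      rewrite mulr_sumr mulr_suml; apply: eq_bigr => t' _.
      by rewrite rmorphM /=; ring.
    under eq_bigr do rewrite exchange_big/=.
    rewrite exchange_big/=; apply: eq_bigr => j _.
    under eq_bigr do rewrite exchange_big/=.
    rewrite exchange_big/=; apply: eq_bigr => t _.
    under eq_bigr do rewrite exchange_big/=.
    rewrite exchange_big/=; apply: eq_bigr => t' _.
    rewrite aC mulr_suml mulr_suml; apply: eq_bigr => x _.
    by rewrite mulr_sumr.
  rewrite exchange_big/=; under eq_bigr do rewrite exchange_big/=.
  rewrite exchange_big/=; apply: eq_bigr => t' _; apply: eq_bigr => t _.
  by rewrite mulr_suml; apply: eq_bigr => j _; ring.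
under eq_bigr do rewrite (main _ _ _ eA0) (main _ _ _ eA1).
apply: root_fidelity_le_povm_kernel => // [k|t t']; first exact: psdker_gram.
rewrite -L1 exchange_big/=; apply: eq_bigr => j _.
transitivity (\sum_x \sum_x' (\sum_k (Q k (gA x))^* * Q k (gA x')) * ((L j x t)^* * L j x' t')).
  under [RHS]eq_bigr do under eq_bigr do rewrite mulr_suml.
  under [RHS]eq_bigr do rewrite exchange_big/=.
  rewrite [RHS]exchange_big/=; apply: eq_bigr => k _.
  rewrite aC /a mulr_suml; apply: eq_bigr => x _; rewrite mulr_sumr.
  by apply: eq_bigr => x' _; rewrite rmorphM; ring.
have orth x x' : \sum_k (Q k (gA x))^* * Q k (gA x') = (x == x')%:R.
  have /matrixP/(_ (gA x) (gA x')) := QQ'; rewrite !mxE (inj_eq (bij_inj gA_bij)) => <-.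
  by apply: eq_bigr => k _; rewrite !mxE.
apply: eq_bigr => x _; rewrite (bigD1 x)//= orth eqxx mul1r big1 ?addr0// => x' xx'.
by rewrite orth eq_sym (negbTE xx') mul0r.
Qed.

Lemma sum_F2 (V : nmodType) (f : 'F_2 -> V) : \sum_(c : 'F_2) f c = f 0 + f 1.
Proof.
by rewrite big_ord_recl big_ord1; congr (f _ + f _); apply: val_inj.
Qed.

Lemma sum_pair (V : nmodType) (I J : finType) (F : I * J -> V) :
  \sum_t F t = \sum_i \sum_j F (i, j).
Proof. by rewrite pair_bigA; apply: eq_bigr => -[]. Qed.

(** Arikan's bound for a single pair of outcomes, in terms of the square roots of the probabilities.
    The squares of the two sides differ by 2 x y x' y' (x - y)^2 (x' - y')^2. *)
Lemma arikan_minus_ineq (x y x' y' : C) : 0 <= x -> 0 <= y -> 0 <= x' -> 0 <= y' ->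
  sqrtC (x ^+ 2 * x' ^+ 2 + y ^+ 2 * y' ^+ 2) * sqrtC (y ^+ 2 * x' ^+ 2 + x ^+ 2 * y' ^+ 2)
  <= x ^+ 2 * (x' * y') + x * y * x' ^+ 2 + x * y * y' ^+ 2 + y ^+ 2 * (x' * y')
     - 2 * (x * y) * (x' * y').
Proof.
move=> x0 y0 x'0 y'0; set r := (X in _ <= X).
have rx : x \is Num.real by exact: ger0_real.
have ry : y \is Num.real by exact: ger0_real.
have rx' : x' \is Num.real by exact: ger0_real.
have ry' : y' \is Num.real by exact: ger0_real.
have d0 : 0 <= (x - y) ^+ 2 by rewrite -realEsqr rpredB.
have d0' : 0 <= (x' - y') ^+ 2 by rewrite -realEsqr rpredB.
have r0 : 0 <= r.
  have -> : r = (x' * y') * (x - y) ^+ 2 + (x * y) * (x' ^+ 2 + y' ^+ 2) by rewrite /r; ring.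
  by apply: addr_ge0; apply: mulr_ge0 => //; try exact: mulr_ge0; rewrite addr_ge0 ?exprn_ge0.
have pos (u v : C) : 0 <= u -> 0 <= v -> 0 <= u ^+ 2 * v ^+ 2.
  by move=> u0 v0; apply: mulr_ge0; exact: exprn_ge0.
rewrite -sqrtCM ?nnegrE ?addr_ge0 ?pos//.
rewrite -[leRHS]sqrCK// ler_sqrtC ?nnegrE ?exprn_ge0//; last first.
  by apply: mulr_ge0; rewrite addr_ge0 ?pos.
rewrite -subr_ge0.
have -> : r ^+ 2 - (x ^+ 2 * x' ^+ 2 + y ^+ 2 * y' ^+ 2) * (y ^+ 2 * x' ^+ 2 + x ^+ 2 * y' ^+ 2)
   = 2 * (x' * y') * (x * y) * ((x - y) ^+ 2 * (x' - y') ^+ 2) by rewrite /r; ring.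
by apply: mulr_ge0; last exact: mulr_ge0; apply: mulr_ge0; first apply: mulr_ge0 => //; exact: mulr_ge0.
Qed.

Section PolarStep.
Variables (n : nat) (V : 'F_2 -> 'M[C]_n).
Hypotheses (V_psd : forall b, psdmx (V b)) (V_tr : forall b, \tr (V b) = 1).

(** An optimal measurement, viewed as a classical channel [p] whose Bhattacharyya coefficient is the
    root fidelity of [V]. The last clause puts [p] in the form in which product measurements are
    computed. *)
Let measured : exists Q : 'M[C]_n, Q *m Q^t* = 1%:M /\
  exists p : 'I_n -> 'F_2 -> C,
    [/\ forall k b, 0 <= p k b, forall b, \sum_k p k b = 1,
       \sum_k sqrtC (p k 0) * sqrtC (p k 1) = root_fidelity (V 0) (V 1) &
       forall k b, p k b = \sum_t \sum_t' (Q k t' * (Q k t)^*) * V b t' t].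
Proof.
have [Q [QQ QE]] := root_fidelity_attained (V_psd 0) (V_psd 1).
exists Q; split=> //; exists (fun k b => (Q *m V b *m Q^t*) k k); split=> //.
- by move=> k b; apply: psd_diag_ge0; rewrite -{1}(adjmxK Q); exact: psd_congr.
- move=> b; rewrite -/(mxtrace _) mxtrace_mulC mulmxA.
  by rewrite (mulmx1C QQ) mul1mx.
- move=> k b; rewrite mxE; apply: eq_bigr => t _; rewrite !mxE mulr_suml.
  by apply: eq_bigr => t' _; ring.
Qed.

Let orth (Q : 'M[C]_n) t t' : Q *m Q^t* = 1%:M -> \sum_k Q k t * (Q k t')^* = (t == t')%:R.
Proof.
move=> /mulmx1C /matrixP/(_ t' t); rewrite !mxE eq_sym => <-.
by apply: eq_bigr => k _; rewrite !mxE mulrC.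
Qed.

(** Measuring both copies of [V] optimally can only increase the root fidelity of [W], and the
    outcomes are those of the classical minus channel built from [p]. *)
Lemma root_fidelity_minus m (W : 'F_2 -> 'M[C]_m) (g : 'I_n * 'I_n -> 'I_m) :
  bijective g -> (forall b, psdmx (W b)) ->
  (forall b s s' t t', W b (g (s, s')) (g (t, t')) =
     2^-1 * \sum_(c : 'F_2) V (b + c) s t * V c s' t') ->
  root_fidelity (W 0) (W 1) <= 2 * root_fidelity (V 0) (V 1) - root_fidelity (V 0) (V 1) ^+ 2.
Proof.
move=> g_bij W_psd WE; have [Q [QQ [p [p0 p1 pz pE]]]] := measured.
pose M (kl : 'I_n * 'I_n) (s t : 'I_n * 'I_n) :=
  (Q kl.1 t.1 * (Q kl.1 s.1)^*) * (Q kl.2 t.2 * (Q kl.2 s.2)^*).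
have prob kl b : \sum_t \sum_t' M kl t t' * W b (g t') (g t) =
    2^-1 * \sum_(c : 'F_2) p kl.1 (b + c) * p kl.2 c.
  rewrite mulr_sumr.
  transitivity (\sum_c \sum_t \sum_t' 2^-1 * (((Q kl.1 t'.1 * (Q kl.1 t.1)^*) * V (b + c) t'.1 t.1)
     * ((Q kl.2 t'.2 * (Q kl.2 t.2)^*) * V c t'.2 t.2))).
    rewrite [RHS]exchange_big/=; apply: eq_bigr => t _.
    rewrite [RHS]exchange_big/=; apply: eq_bigr => t' _.
    case: t t' => t1 t2 [t1' t2']; rewrite WE /M/= 2!mulr_sumr.
    by apply: eq_bigr => c _; ring.
  apply: eq_bigr => c _; rewrite !pE mulr_suml mulr_sumr.
  rewrite sum_pair/=.
  apply: eq_bigr => t1 _; rewrite mulr_sumr mulr_sumr; apply: eq_bigr => t2 _.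
  rewrite sum_pair/=.
  rewrite mulr_suml mulr_sumr; apply: eq_bigr => t1' _; rewrite 2!mulr_sumr.
  by apply: eq_bigr => t2' _.
have M0 kl : psdker (M kl).
  move=> v; pose a (j : unit) (s : 'I_n * 'I_n) := (Q kl.1 s.1 * Q kl.2 s.2)^*.
  have := @psdker_gram _ _ a v; congr (_ <= _); apply: eq_bigr => s _; apply: eq_bigr => t _.
  congr (_ * _ * _); rewrite (big_pred1 tt); last by case.
  by rewrite /M /a conjCK rmorphM /=; ring.
have M1 s t : \sum_kl M kl s t = (s == t)%:R.
  case: s t => s s' [t t']; rewrite sum_pair/=.
  transitivity ((\sum_k Q k t * (Q k s)^*) * (\sum_l Q l t' * (Q l s')^*)).
    rewrite mulr_suml; apply: eq_bigr => k _; rewrite mulr_sumr.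
    by apply: eq_bigr => l _.
  by rewrite !orth// -natrM mulnb xpair_eqE [t == s]eq_sym [t' == s']eq_sym.
apply: le_trans (root_fidelity_le_povm_kernel g_bij (W_psd 0) (W_psd 1) M0 M1) _.
under eq_bigr do rewrite !prob.
pose x k := sqrtC (p k 0); pose y k := sqrtC (p k 1).
have x0 k : 0 <= x k by rewrite sqrtC_ge0.
have y0 k : 0 <= y k by rewrite sqrtC_ge0.
have xx : \sum_k x k ^+ 2 = 1 by rewrite -(p1 0); apply: eq_bigr => k _; rewrite sqrtCK.
have yy : \sum_k y k ^+ 2 = 1 by rewrite -(p1 1); apply: eq_bigr => k _; rewrite sqrtCK.
(* Each of the four positive terms sums to z over all pairs, and the products of the last term sum
   to z^2: in total 4z - 2z^2. *)
pose f k l := x k ^+ 2 * (x l * y l) + x k * y k * x l ^+ 2 + x k * y k * y l ^+ 2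
   + y k ^+ 2 * (x l * y l) - 2 * (x k * y k) * (x l * y l).
apply: (@le_trans _ _ (\sum_k \sum_l 2^-1 * f k l)).
  rewrite (pair_bigA _ (fun k l => 2^-1 * f k l)); apply: ler_sum => -[k l] _ /=.
  rewrite !sum_F2 !add0r !addr0 (_ : 1 + 1 = 0 :> 'F_2); last exact: val_inj.
  have pp k' b : p k' b = (if b == 0 then x k' else y k') ^+ 2.
    by rewrite (fun_if (fun z => z ^+ 2)) !sqrtCK; case: b => [[|[|//]] ib] /=; congr p; apply: val_inj.
  rewrite !pp /= mulrC mulrC.
  have pos (u v : C) : 0 <= u -> 0 <= v -> 0 <= u ^+ 2 * v ^+ 2.
    by move=> u0 v0; apply: mulr_ge0; exact: exprn_ge0.
  rewrite !sqrtCM ?nnegrE ?invr_ge0 ?addr_ge0 ?pos// mulrACA -expr2 sqrtCK.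
  by rewrite ler_wpM2l ?invr_ge0// arikan_minus_ineq.
have -> : \sum_k \sum_l 2^-1 * f k l = 2^-1 * \sum_k \sum_l f k l.
  by rewrite mulr_sumr; apply: eq_bigr => k _; rewrite mulr_sumr.
set z := root_fidelity _ _; rewrite -/z in pz.
have -> : \sum_k \sum_l f k l = 4 * z - 2 * z ^+ 2.
  transitivity (\sum_k (x k ^+ 2 * z + 2 * (x k * y k) + y k ^+ 2 * z - 2 * z * (x k * y k))).
    apply: eq_bigr => k _; rewrite !big_split/= sumrN -!mulr_sumr xx yy pz; ring.
  rewrite !big_split/= sumrN -!mulr_sumr -!mulr_suml xx yy pz; ring.
rewrite le_eqVlt; apply/orP; left; apply/eqP.
by field.
Qed.

(** The same product measurement together with a readout of the classical bit. Given either value of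
    that bit the outcomes are independent and their coefficients multiply, so the measured
    coefficient is exactly z^2. *)
Lemma root_fidelity_plus m (W : 'F_2 -> 'M[C]_m) (g : 'F_2 * ('I_n * 'I_n) -> 'I_m) :
  bijective g -> (forall b, psdmx (W b)) ->
  (forall b c s s' c' t t', W b (g (c, (s, s'))) (g (c', (t, t'))) =
     (c == c')%:R * 2^-1 * (V (c + b) s t * V b s' t')) ->
  root_fidelity (W 0) (W 1) <= root_fidelity (V 0) (V 1) ^+ 2.
Proof.
move=> g_bij W_psd WE; have [Q [QQ [p [p0 p1 pz pE]]]] := measured.
pose M (kl : 'F_2 * ('I_n * 'I_n)) (s t : 'F_2 * ('I_n * 'I_n)) :=
  ((s.1 == kl.1) && (t.1 == kl.1))%:R *
  ((Q kl.2.1 t.2.1 * (Q kl.2.1 s.2.1)^*) * (Q kl.2.2 t.2.2 * (Q kl.2.2 s.2.2)^*)).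
have prob kl b : \sum_t \sum_t' M kl t t' * W b (g t') (g t) =
    2^-1 * (p kl.2.1 (kl.1 + b) * p kl.2.2 b).
  case: kl => d [k l] /=.
  rewrite sum_pair/=.
  rewrite (bigD1 d)//= [X in _ + X]big1 ?addr0 => [|c cd]; last first.
    by rewrite big1// => t _; rewrite big1// => t' _; rewrite /M/= (negbTE cd)/= !mul0r.
  transitivity (\sum_t \sum_t' 2^-1 * (((Q k t'.1 * (Q k t.1)^*) * V (d + b) t'.1 t.1)
     * ((Q l t'.2 * (Q l t.2)^*) * V b t'.2 t.2))).
    apply: eq_bigr => -[t1 t2] _.
    rewrite sum_pair/=.
    rewrite (bigD1 d)//= [X in _ + X]big1 ?addr0 => [|c cd]; last first.
      by rewrite big1// => t' _; rewrite /M/= (negbTE cd)/= andbF !mul0r.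
    by apply: eq_bigr => -[t1' t2'] _; rewrite WE /M/= eqxx/=; ring.
  rewrite !pE mulr_suml mulr_sumr.
  rewrite sum_pair/=.
  apply: eq_bigr => t1 _; rewrite mulr_sumr mulr_sumr; apply: eq_bigr => t2 _.
  rewrite sum_pair/=.
  rewrite mulr_suml mulr_sumr; apply: eq_bigr => t1' _; rewrite 2!mulr_sumr.
  by apply: eq_bigr => t2' _.
have M0 kl : psdker (M kl).
  move=> v; pose a (j : unit) (s : 'F_2 * ('I_n * 'I_n)) :=
    (s.1 == kl.1)%:R * (Q kl.2.1 s.2.1 * Q kl.2.2 s.2.2)^*.
  have := @psdker_gram _ _ a v; congr (_ <= _); apply: eq_bigr => s _; apply: eq_bigr => t _.
  congr (_ * _ * _); rewrite (big_pred1 tt); last by case.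
  by rewrite /M /a !rmorphM /= conjC_nat !conjCK -mulnb natrM; ring.
have M1 s t : \sum_kl M kl s t = (s == t)%:R.
  case: s t => c [s s'] [c' [t t']].
  rewrite sum_pair/=.
  transitivity (\sum_d ((c == d) && (c' == d))%:R * ((\sum_k Q k t * (Q k s)^*) * (\sum_l Q l t' * (Q l s')^*))).
    apply: eq_bigr => d _; rewrite sum_pair/=.
    rewrite mulr_suml mulr_sumr; apply: eq_bigr => k _; rewrite 2!mulr_sumr.
    by apply: eq_bigr => l _.
  rewrite !orth// -mulr_suml (bigD1 c)//= eqxx/= big1 ?addr0 => [|d dc]; last first.
    by rewrite eq_sym (negbTE dc).
  by rewrite -!natrM !mulnb !xpair_eqE [t == s]eq_sym [t' == s']eq_sym [c' == c]eq_sym.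
apply: le_trans (root_fidelity_le_povm_kernel g_bij (W_psd 0) (W_psd 1) M0 M1) _.
under eq_bigr do rewrite !prob.
rewrite sum_pair/=.
pose x k := sqrtC (p k 0); pose y k := sqrtC (p k 1).
have term d : \sum_kl sqrtC (2^-1 * (p kl.1 (d + 0) * p kl.2 0)) *
   sqrtC (2^-1 * (p kl.1 (d + 1) * p kl.2 1)) = 2^-1 * root_fidelity (V 0) (V 1) ^+ 2.
  rewrite expr2 -pz mulr_suml mulr_sumr.
  rewrite sum_pair/=; apply: eq_bigr => k _.
  rewrite 2!mulr_sumr; apply: eq_bigr => l _.
  rewrite !sqrtCM ?nnegrE ?mulr_ge0 ?invr_ge0// mulrACA -expr2 sqrtCK.
  case: d => [[|[|//]] id]; rewrite ?addr0.
    have -> : Ordinal id = 0 :> 'F_2 by exact: val_inj.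
    by rewrite add0r; ring.
  have -> : Ordinal id = 1 :> 'F_2 by exact: val_inj.
  by rewrite (_ : 1 + 1 = 0 :> 'F_2); [ring|exact: val_inj].
under eq_bigr do rewrite term.
rewrite (sum_F2 (fun=> _)); have half2 (z : C) : 2^-1 * z + 2^-1 * z = z by field.
by rewrite half2.
Qed.

End PolarStep.

End Measurements.

(** * Trade-off between Bob's phase information and Eve's amplitude information *)

Section Uncertainty.
Local Open Scope sesquilinear_scope.
Variable C : numClosedFieldType.
(** In the application [P] carries the past amplitude bits, [F] the known future phase bits, [E]
    Eve's systems, and [S] the future amplitude bits with all remaining systems on Bob's side. [Phi]
    lists the amplitudes and [chi] the signs caused by the future phase bits. *)
Variables (P F S E : finType) (Phi : P -> 'F_2 -> S -> E -> C) (chi : F -> S -> C).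
Variables (nA nB : nat) (A : 'F_2 -> 'M[C]_nA) (B : 'F_2 -> 'M[C]_nB).
Variables (gA : P * E -> 'I_nA) (gB : F * ('F_2 * (P * S)) -> 'I_nB) (wA wB : C).
Hypotheses (gA_bij : bijective gA) (gB_bij : bijective gB).
Hypothesis B_psd : forall b, psdmx (B b).
Hypothesis A_tr : forall b, \tr (A b) = 1.
Hypothesis chi_sqr : forall f s, chi f s * chi f s = 1.
Hypothesis chi_real : forall f s, (chi f s)^* = chi f s.
Hypothesis wA_ge0 : 0 <= wA.
Hypothesis wAB : #|F|%:R * wB = wA / 2.
Hypothesis A_entry : forall b p e p' e', A b (gA (p, e)) (gA (p', e')) =
  (p == p')%:R * (wA * \sum_s Phi p b s e * (Phi p' b s e')^*).
Hypothesis B_entry : forall b f c p s f' c' p' s',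
  B b (gB (f, (c, (p, s)))) (gB (f', (c', (p', s')))) =
  (f == f')%:R * (p == p')%:R * wB * (if (b != 0) && (c != c') then -1 else 1) *
  (chi f s * chi f s') * \sum_e Phi p c s e * (Phi p' c' s' e)^*.

Let K : finType := (P * S)%type.

Let overlap (k k' : K) : C :=
  (k.1 == k'.1)%:R * (wA * \sum_e (Phi k.1 0 k.2 e)^* * Phi k'.1 1 k'.2 e).

(** Eve's output is purified by Bob's systems [S] and a copy of the classical register [P], so
    Uhlmann's contraction acts on labels that Bob holds. *)
Lemma uhlmann_kernel : exists x : K -> K -> C,
  (forall y : K -> C, \sum_k `|\sum_k' x k k' * y k'| ^+ 2 <= \sum_k `|y k| ^+ 2) /\
  \sum_k \sum_k' x k k' * overlap k' k = root_fidelity (A 0) (A 1).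
Proof.
have [hA hAK gAK] := gA_bij.
pose Fm b : 'M[C]_(#|{: K}|, nA) := \matrix_(k, l)
  (((enum_val k).1 == (hA l).1)%:R *
   (sqrtC wA * (Phi (enum_val k).1 b (enum_val k).2 (hA l).2)^*)).
have sqwA : sqrtC wA * (sqrtC wA)^* = wA.
  by rewrite geC0_conj ?sqrtC_ge0// -expr2 sqrtCK.
have gram b : (Fm b)^t* *m Fm b = A b.
  apply/matrixP=> i j; rewrite -(gAK i) -(gAK j).
  case: (hA i) (hA j) => p e [p' e']; rewrite A_entry mxE.
  rewrite (reindex enum_rank)/=; last exact/onW_bij/enum_rank_bij.
  rewrite sum_pair (bigD1 p)//= [X in _ + X]big1 ?addr0 => [|q qp]; last first.
    rewrite big1// => s _; rewrite !mxE !hAK enum_rankK/= (negbTE qp) mul0r.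
    by rewrite conjC0 mul0r.
  rewrite 2!mulr_sumr; apply: eq_bigr => s _; rewrite !mxE !hAK !enum_rankK/= eqxx.
  rewrite !rmorphM /= conjCK conjC_nat -[in RHS]sqwA.
  have [->|_] := eqVneq p p'; last by rewrite !mul0r ?mulr0.
  by ring.
have [X [X1 XE]] := root_fidelity_purifications (Fm 0) (Fm 1).
exists (fun k k' => X (enum_rank k) (enum_rank k')); split.
  move=> y; have := X1 (\col_k y (enum_val k)); congr (_ <= _).
    rewrite (reindex enum_rank)/=; last exact/onW_bij/enum_rank_bij.
    apply: eq_bigr => k _; rewrite mxE; congr (`|_| ^+ 2).
    rewrite (reindex enum_rank)/=; last exact/onW_bij/enum_rank_bij.
    by apply: eq_bigr => k' _; rewrite mxE enum_rankK.
  rewrite (reindex enum_rank)/=; last exact/onW_bij/enum_rank_bij.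
  by apply: eq_bigr => k _; rewrite mxE enum_rankK.
rewrite /root_fidelity -!gram -XE /mxtrace [RHS](reindex enum_rank)/=; last exact/onW_bij/enum_rank_bij.
apply: eq_bigr => k _; rewrite mxE [RHS](reindex enum_rank)/=; last exact/onW_bij/enum_rank_bij.
apply: eq_bigr => k' _; congr (_ * _); rewrite mxE.
rewrite (reindex gA)/=; last exact: onW_bij.
rewrite sum_pair (bigD1 k'.1)//= [X in _ + X]big1 ?addr0 => [|q qp]; last first.
  by rewrite big1// => e _; rewrite !mxE !hAK !enum_rankK/= eq_sym (negbTE qp) !mul0r.
rewrite /overlap 2!mulr_sumr; apply: eq_bigr => e _; rewrite !mxE !hAK !enum_rankK/= eqxx.
rewrite !rmorphM /= conjCK conjC_nat -[in LHS]sqwA [k.1 == _]eq_sym.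
by ring.
Qed.

(* [A] is Eve's channel, with purification [Phi], and [B] is Bob's channel, with
   the phases [(-1)^(b c)].  A contraction [x] attaining the fidelity of [A] gives
   the observable T with off-diagonal blocks x and x^*, for which
   tr (T B_b) = (-1)^b e; measure (1 + T) / 2 and (1 - T) / 2. *)
Lemma phase_amplitude_uncertainty : root_fidelity (B 0) (B 1) ^+ 2 + root_fidelity (A 0) (A 1) ^+ 2 <= 1.
Proof.
have [x [xc xE]] := uhlmann_kernel.
set e := root_fidelity (A 0) (A 1) in xE *.
have e_real : e^* = e by rewrite geC0_conj// root_fidelity_ge0.
(* The signs [chi] cancel those in [B_entry], so every register value f contributes equally. *)
pose T (t t' : F * ('F_2 * K)) : C := (t.1 == t'.1)%:R * (chi t.1 t.2.2.2 * chi t'.1 t'.2.2.2) *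
  (if t.2.1 == 0 then if t'.2.1 == 0 then 0 else x t'.2.2 t.2.2
   else if t'.2.1 == 0 then (x t.2.2 t'.2.2)^* else 0).
have sumT (H : F * ('F_2 * K) -> F * ('F_2 * K) -> C) :
    \sum_t \sum_t' T t t' * H t t' = \sum_f \sum_k' \sum_k chi f k.2 * chi f k'.2 *
      (x k' k * H (f, (0, k)) (f, (1, k')) + (x k' k)^* * H (f, (1, k')) (f, (0, k))).
  rewrite sum_pair; apply: eq_bigr => f _.
  have inner (t : 'F_2 * K) : \sum_t' T (f, t) t' * H (f, t) t' =
      \sum_c \sum_k T (f, t) (f, (c, k)) * H (f, t) (f, (c, k)).
    rewrite sum_pair (bigD1 f)//= [X in _ + X]big1 ?addr0 => [|f' ff']; last first.
      by rewrite big1// => t' _; rewrite /T/= eq_sym (negbTE ff') !mul0r.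
    by rewrite sum_pair.
  under eq_bigr do rewrite inner.
  rewrite sum_pair sum_F2; under eq_bigr do rewrite sum_F2.
  under [X in _ + X]eq_bigr do rewrite sum_F2.
  rewrite [X in X + _](eq_bigr (fun k => \sum_k' chi f k.2 * chi f k'.2 *
     (x k' k * H (f, (0, k)) (f, (1, k'))))) => [|k _]; last first.
    rewrite big1 ?add0r => [|k' _]; last by rewrite /T/= mulr0 mul0r.
    by apply: eq_bigr => k' _; rewrite /T/= eqxx mul1r; ring.
  rewrite [X in _ + X](eq_bigr (fun k' => \sum_k chi f k.2 * chi f k'.2 *
     ((x k' k)^* * H (f, (1, k')) (f, (0, k))))) => [|k' _]; last first.
    rewrite [X in _ + X]big1 ?addr0 => [|k _]; last by rewrite /T/= mulr0 mul0r.
    by apply: eq_bigr => k _; rewrite /T/= eqxx mul1r; ring.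
  rewrite exchange_big/= -big_split/=; apply: eq_bigr => k' _.
  by rewrite -big_split/=; apply: eq_bigr => k _; rewrite mulrDr.
pose M (s : bool) t t' : C := 2^-1 * ((t == t')%:R + (-1) ^+ s * T t t').
have M0 s : psdker (M s).
  move=> v.
  pose y f k := chi f k.2 * v (f, (0, k)); pose z f k := chi f k.2 * v (f, (1, k)).
  pose w f k := \sum_k' x k k' * (y f k')^*.
  have diagE : \sum_t \sum_t' (v t)^* * (t == t')%:R * v t' =
      \sum_f \sum_k (`|y f k| ^+ 2 + `|z f k| ^+ 2).
    transitivity (\sum_t `|v t| ^+ 2).
      apply: eq_bigr => t _; rewrite (bigD1 t)//= eqxx mulr1 big1 ?addr0 => [|t' tt'].
        by rewrite normCKC.
      by rewrite eq_sym (negbTE tt') mulr0 mul0r.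
    rewrite sum_pair; apply: eq_bigr => f _; rewrite sum_pair sum_F2 -big_split/=.
    apply: eq_bigr => k _; rewrite !normCKC /y /z !rmorphM/= !chi_real.
    have := chi_sqr f k.2; set c := chi _ _ => cc.
    by rewrite !(mulrACA c _^*) cc !mul1r.
  have -> : \sum_t \sum_t' (v t)^* * M s t t' * v t' = 2^-1 *
      (\sum_t \sum_t' (v t)^* * (t == t')%:R * v t' +
       (-1) ^+ s * \sum_t \sum_t' T t t' * ((v t)^* * v t')).
    rewrite [X in _ + X]mulr_sumr -big_split/= mulr_sumr; apply: eq_bigr => t _.
    rewrite [X in _ + X]mulr_sumr -big_split/= mulr_sumr; apply: eq_bigr => t' _.
    by rewrite /M/=; ring.
  rewrite mulr_ge0 ?invr_ge0// diagE sumT mulr_sumr -big_split/=.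
  apply: sumr_ge0 => f _.
  (* Completing the square: the remainder |y|^2 - |w|^2 is nonnegative because [x] is a
     contraction. *)
  have -> : \sum_k (`|y f k| ^+ 2 + `|z f k| ^+ 2) +
      (-1) ^+ s * (\sum_k' \sum_k chi f k.2 * chi f k'.2 *
        (x k' k * ((v (f, (0, k)))^* * v (f, (1, k'))) +
        (x k' k)^* * ((v (f, (1, k')))^* * v (f, (0, k)))))
    = \sum_k `|(z f k)^* + (-1) ^+ s * w f k| ^+ 2 +
       (\sum_k `|y f k| ^+ 2 - \sum_k `|w f k| ^+ 2).
    rewrite -sumrB -big_split/= mulr_sumr -big_split/=; apply: eq_bigr => k' _.
    have -> : \sum_k chi f k.2 * chi f k'.2 *
        (x k' k * ((v (f, (0, k)))^* * v (f, (1, k'))) +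
        (x k' k)^* * ((v (f, (1, k')))^* * v (f, (0, k)))) =
        z f k' * w f k' + (z f k' * w f k')^*.
      rewrite rmorphM/= /w rmorph_sum/= !mulr_sumr -big_split/=; apply: eq_bigr => k _.
      by rewrite /y /z !rmorphM/= !chi_real conjCK; ring.
    move: (y f k') (z f k') (w f k') => yk zk wk.
    rewrite !normCK !rmorphD !rmorphM/= rmorphXn/= rmorphN1 conjCK.
    have ss : ((-1) ^+ s * (-1) ^+ s : C) = 1 by rewrite -expr2 sqrr_sign.
    have -> : (zk^* + (-1) ^+ s * wk) * (zk + (-1) ^+ s * wk^*) =
       zk^* * zk + (-1) ^+ s * (zk * wk + zk^* * wk^*) +
       ((-1) ^+ s * (-1) ^+ s) * (wk * wk^*) by ring.
    by rewrite ss; ring.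
  apply: addr_ge0; first by apply: sumr_ge0 => k _; exact: exprn_ge0.
  rewrite subr_ge0; apply: le_trans (xc _) _; apply: ler_sum => k _.
  by rewrite norm_conjC.
have M1 t t' : \sum_s M s t t' = (t == t')%:R.
  by rewrite big_bool/= /M expr0 expr1; field.
have wA0 : wA != 0.
  apply/eqP => wA0; have := A_tr 0; rewrite (tr_relabel gA_bij) big1 => [/esym/eqP|].
    by rewrite oner_eq0.
  by move=> [p e'] _; rewrite A_entry wA0 mul0r mulr0.
have trB b : \sum_t B b (gB t) (gB t) = 1.
  transitivity (\sum_(f : F) \sum_(c : 'F_2) wB * wA^-1 * \tr (A c)).
    rewrite sum_pair; apply: eq_bigr => f _; rewrite sum_pair; apply: eq_bigr => c _.
    rewrite (tr_relabel gA_bij) !sum_pair mulr_sumr; apply: eq_bigr => p _.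
    transitivity (\sum_s \sum_e wB * (Phi p c s e * (Phi p c s e)^*)).
      apply: eq_bigr => s _; rewrite B_entry !eqxx andbF chi_sqr !mul1r !mulr1.
      by rewrite mulr_sumr.
    rewrite exchange_big/= mulr_sumr; apply: eq_bigr => e' _.
    by rewrite A_entry eqxx mul1r mulrA divfK// mulr_sumr.
  under eq_bigr do rewrite sum_F2 !A_tr.
  rewrite sumr_const -mulr_natl !mulr1 -mulrDl -mulr2n -[wB *+ 2]mulr_natl.
  by rewrite mulrA mulrCA wAB; field.
have trT b : \sum_t \sum_t' T t t' * B b (gB t') (gB t) = (if b == 0 then 1 else -1) * e.
  rewrite sumT.
  have term f : \sum_k' \sum_k chi f k.2 * chi f k'.2 *
      (x k' k * B b (gB (f, (1, k'))) (gB (f, (0, k))) +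
      (x k' k)^* * B b (gB (f, (0, k))) (gB (f, (1, k')))) =
      wB * wA^-1 * (if b == 0 then 1 else -1) * (e + e^*).
    rewrite -xE rmorph_sum -big_split/= mulr_sumr; apply: eq_bigr => k' _.
    rewrite rmorph_sum -big_split/= mulr_sumr; apply: eq_bigr => k _.
    case: k k' => p s [p' s'] /=; rewrite !B_entry /= eqxx mul1r.
    rewrite /overlap/= !rmorphM/= conjC_nat rmorph_sum/= (geC0_conj wA_ge0).
    have -> : (b != 0) && (1 != 0 :> 'F_2) = (b != 0) by rewrite andbT.
    rewrite [p' == p]eq_sym if_neg.
    have -> : \sum_e (Phi p' 1 s' e * (Phi p 0 s e)^*) = \sum_e (Phi p 0 s e)^* * Phi p' 1 s' e.
      by apply: eq_bigr => e' _; rewrite mulrC.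
    have -> : \sum_e ((Phi p 0 s e)^* * Phi p' 1 s' e)^* = \sum_e (Phi p 0 s e * (Phi p' 1 s' e)^*).
      by apply: eq_bigr => e' _; rewrite rmorphM/= conjCK.
    set a := \sum_e (Phi p 0 s e)^* * _; set a' := \sum_e Phi p 0 s e * _.
    have c1 := chi_sqr f s; have c2 := chi_sqr f s'.
    set sg := (if _ then _ else _).
    transitivity ((chi f s * chi f s) * (chi f s' * chi f s') * ((p == p')%:R * wB * sg *
       (x (p', s') (p, s) * a + (x (p', s') (p, s))^* * a'))); first by ring.
    by rewrite c1 c2; field.
  under eq_bigr do rewrite term.
  rewrite sumr_const -mulr_natl e_real !mulrA wAB; field.
  by [].
have tr_M b s : \sum_t \sum_t' M s t t' * B b (gB t') (gB t) =
    2^-1 * (1 + (-1) ^+ s * ((if b == 0 then 1 else -1) * e)).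
  transitivity (2^-1 * (\sum_t B b (gB t) (gB t) +
      (-1) ^+ s * \sum_t \sum_t' T t t' * B b (gB t') (gB t))); last by rewrite trB trT.
  rewrite [X in _ + X]mulr_sumr -big_split/= mulr_sumr; apply: eq_bigr => t _.
  have -> : B b (gB t) (gB t) = \sum_t' (t == t')%:R * B b (gB t') (gB t).
    rewrite (bigD1 t)//= eqxx mul1r big1 ?addr0// => t' tt'.
    by rewrite eq_sym (negbTE tt') mul0r.
  rewrite [X in _ + X]mulr_sumr -big_split/= mulr_sumr; apply: eq_bigr => t' _ /=.
  by rewrite /M; ring.
have := root_fidelity_le_povm_kernel gB_bij (B_psd 0) (B_psd 1) M0 M1.
under eq_bigr do rewrite !tr_M.
rewrite big_bool/= expr0 expr1 !mul1r !mulN1r !opprK.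
set u := sqrtC (2^-1 * (1 - e)); set v := sqrtC (2^-1 * (1 + e)) => h.
(* The outcomes have probabilities (1 + e) / 2 and (1 - e) / 2, interchanged when b changes, so the
   coefficient is 2uv with 4 u^2 v^2 = 1 - e^2. *)
rewrite -lerBrDr; apply: (@le_trans _ _ ((u * v + v * u) ^+ 2)).
  by rewrite lerXn2r ?nnegrE ?root_fidelity_ge0// (le_trans (root_fidelity_ge0 _ _) h).
have -> : (u * v + v * u) ^+ 2 = 4 * (u ^+ 2 * v ^+ 2) by ring.
rewrite !sqrtCK le_eqVlt; apply/orP; left; apply/eqP.
by field.
Qed.

End Uncertainty.

(** * The encoding matrix *)

Section ArikanMatrix.
Implicit Types n i j : nat.
Local Open Scope nat_scope.

(** Entries of G_N. The bit reversal of the rows appears as the row losing its lowest bit while the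
    column loses its highest one; [<=] on bits is the kernel. *)
Fixpoint polar_bit n i j : bool :=
  if n is n'.+1 then (j %/ 2 ^ n' <= odd i) && polar_bit n' i./2 (j %% 2 ^ n') else true.

Fixpoint kron_bit n i j : bool :=
  if n is n'.+1 then (j %/ 2 ^ n' <= i %/ 2 ^ n') && kron_bit n' (i %% 2 ^ n') (j %% 2 ^ n')
  else true.

Lemma ntensmx_kernelE n (i j : 'I_(2 ^ n)) :
  ntensmx arikan_kernel n i j = (kron_bit n i j)%:R%R.
Proof.
case: n i j => [|n] i j.
  by rewrite mxE; case: i j => [[|//] ?] [[|//] ?].
rewrite /ntensmx; elim: n i j => [|n IH] i j.
  by rewrite mxE /= !divn1 andbT.
rewrite mxE mxE IH -natrM mulnb.
by congr (_%:R)%R.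
Qed.

Lemma bitrevS n i : bitrev n.+1 i = odd i * 2 ^ n + bitrev n i./2.
Proof.
rewrite /bitrev big_ord_recl /= divn1 subn0; congr (_ + _).
apply: eq_bigr => j _; rewrite /bump /= add1n expnS divnMA divn2.
by congr (_ * 2 ^ _); lia.
Qed.

Lemma bitrev_lt n i : bitrev n i < 2 ^ n.
Proof.
elim: n i => [|n IH] i; first by rewrite /bitrev big_ord0.
rewrite bitrevS expnS mul2n -addnn -addnS leq_add ?IH//.
by case: odd; rewrite ?mul1n ?mul0n.
Qed.

Lemma kron_bitrev n i j : kron_bit n (bitrev n i) j = polar_bit n i j.
Proof.
elim: n i j => //= n IH i j.
have bl := bitrev_lt n i./2.
by rewrite bitrevS divnMDl ?expn_gt0// modnMDl (divn_small bl) (modn_small bl) addn0 IH.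
Qed.

Lemma arikan_mxE n (i j : 'I_(2 ^ n)) : arikan_mx n i j = (polar_bit n i j)%:R%R.
Proof.
rewrite mxE (bigD1 (Ordinal (bitrev_lt n i)))//= big1 => [|l li].
  by rewrite GRing.addr0 mxE eqxx GRing.mul1r ntensmx_kernelE kron_bitrev.
by rewrite mxE -val_eqE /= in li *; rewrite (negbTE li) GRing.mul0r.
Qed.

Lemma half_mod_pow n i : (i %% 2 ^ n.+1)./2 = i./2 %% 2 ^ n.
Proof. by rewrite -!divn2 expnSr modn_divl. Qed.

Lemma odd_mod_pow n i : odd (i %% 2 ^ n.+1) = odd i.
Proof. by rewrite expnS odd_mod// oddM. Qed.

(** The dual recursion, with highest and lowest bits exchanged between row and column: bit reversal
    commutes with a Kronecker power of one kernel. *)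
Lemma polar_bit_top n i j : i < 2 ^ n.+1 -> j < 2 ^ n.+1 ->
  polar_bit n.+1 i j = (odd j <= i %/ 2 ^ n) && polar_bit n (i %% 2 ^ n) j./2.
Proof.
elim: n i j => [|n IH] i j i2 j2.
  by rewrite /= !divn1; case: i i2 j j2 => [|[|//]] _ [|[|//]].
rewrite [LHS]/= -/(polar_bit n.+1 _ _) IH; first last.
- by rewrite ltn_mod expn_gt0.
- by rewrite ltn_half_double -mul2n -expnS.
by rewrite [in RHS]/= !half_mod_pow !odd_mod_pow -!divn2 -!divnMA -!expnS andbCA.
Qed.

(** [2 ^ n - i.+1] complements every bit of i, which reverses the comparison of bits that defines
    the kernel. *)
Lemma polar_bit_rev n i j : i < 2 ^ n -> j < 2 ^ n ->
  polar_bit n (2 ^ n - i.+1) (2 ^ n - j.+1) = polar_bit n j i.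
Proof.
elim: n i j => // n IH i j i2 j2.
have lt_sub m k : k < m -> m - k.+1 < m by case: m => // m _; rewrite subSS ltnS leq_subr.
rewrite polar_bit_top ?lt_sub// [RHS]/= -(IH (i %% 2 ^ n) j./2); first last.
- by rewrite ltn_half_double -mul2n -expnS.
- by rewrite ltn_mod expn_gt0.
have M0 : 0 < 2 ^ n by rewrite expn_gt0.
move: i2 j2; rewrite expnS; move: (2 ^ n) M0 => M M0 i2 j2.
have -> : (2 * M - j.+1)./2 = M - (j./2).+1 by lia.
have -> : odd (2 * M - j.+1) = ~~ odd j by lia.
have [iM|iM] := ltnP i M.
  have -> : 2 * M - i.+1 = 1 * M + (M - i.+1) by lia.
  rewrite divnMDl// modnMDl (divn_small (lt_sub _ _ iM)) (modn_small (lt_sub _ _ iM)).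
  by rewrite (divn_small iM) (modn_small iM) leq_b1.
have -> : i %/ M = 1 by rewrite -(subnKC iM) divnDl// divnn M0 divn_small//; lia.
have -> : i %% M = i - M by rewrite -{1}(subnKC iM) modnDl modn_small//; lia.
have lt : 2 * M - i.+1 < M by lia.
rewrite (divn_small lt) (modn_small lt).
have -> : 2 * M - i.+1 = M - (i - M).+1 by lia.
by case: odd.
Qed.

End ArikanMatrix.

(** * Arikan's recursion for the encoder, on outputs and on inputs *)

Section ArikanTransform.
Variable n : nat.
Local Notation N := (2 ^ n)%N.

Fact ev_proof (j : 'I_N) : (j.*2 < 2 ^ n.+1)%N.
Proof. by rewrite expnS mul2n ltn_double. Qed.
Fact od_proof (j : 'I_N) : (j.*2.+1 < 2 ^ n.+1)%N.
Proof. by rewrite expnS mul2n ltn_Sdouble. Qed.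
Fact lo_proof (j : 'I_N) : (j < 2 ^ n.+1)%N.
Proof. by rewrite (leq_trans (ltn_ord j))// leq_exp2l. Qed.
Fact hi_proof (j : 'I_N) : (N + j < 2 ^ n.+1)%N.
Proof. by rewrite expnS mul2n -addnn ltn_add2l. Qed.

Definition ev j := Ordinal (ev_proof j).
Definition od j := Ordinal (od_proof j).
Definition lo j := Ordinal (lo_proof j).
Definition hi j := Ordinal (hi_proof j).

Lemma evod_bij : bijective (fun s : 'I_N + 'I_N => match s with inl j => ev j | inr j => od j end).
Proof.
apply: inj_card_bij; last by rewrite card_sum !card_ord expnS mul2n addnn.
move=> [j|j] [k|k] /(congr1 val) /= => [/double_inj|/(congr1 odd)|/(congr1 odd)|[/double_inj]].
- by move=> /val_inj ->.
- by rewrite /= !odd_double.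
- by rewrite /= !odd_double.
- by move=> /val_inj ->.
Qed.

Lemma lohi_bij : bijective (fun s : 'I_N + 'I_N => match s with inl j => lo j | inr j => hi j end).
Proof.
apply: inj_card_bij; last by rewrite card_sum !card_ord expnS mul2n addnn.
move=> [j|j] [k|k] /(congr1 val) /= => [/val_inj -> //|E|E|/addnI /val_inj -> //].
- by have := ltn_ord j; rewrite E ltnNge leq_addr.
- by have := ltn_ord k; rewrite -E ltnNge leq_addr.
Qed.

Lemma big_evod (V : Type) (idx : V) (op : Monoid.com_law idx) (F : 'I_(2 ^ n.+1) -> V) :
  \big[op/idx]_j F j = op (\big[op/idx]_j F (ev j)) (\big[op/idx]_j F (od j)).
Proof. by rewrite (reindex _ (onW_bij _ evod_bij)) big_sumType. Qed.

Lemma big_lohi (V : Type) (idx : V) (op : Monoid.com_law idx) (F : 'I_(2 ^ n.+1) -> V) :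
  \big[op/idx]_j F j = op (\big[op/idx]_j F (lo j)) (\big[op/idx]_j F (hi j)).
Proof. by rewrite (reindex _ (onW_bij _ lohi_bij)) big_sumType. Qed.

Implicit Type u : 'rV['F_2]_(2 ^ n.+1).

(** Inputs of the two half-length encoders, the first producing the lower half of the outputs and
    the second the upper half. Positions start from 0, so [od] marks the second bit of each pair. *)
Definition fold_sum u : 'rV['F_2]_N := \row_j (u 0 (ev j) + u 0 (od j)).
Definition fold_odd u : 'rV['F_2]_N := \row_j u 0 (od j).

Lemma arikan_lo u j : (u *m arikan_mx n.+1) 0 (lo j) = (fold_sum u *m arikan_mx n) 0 j.
Proof.
rewrite !mxE big_evod -big_split; apply: eq_bigr => k _.
rewrite !arikan_mxE mxE mulrDl /= (divn_small (ltn_ord j)) (modn_small (ltn_ord j)).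
by rewrite uphalf_double doubleK.
Qed.

Lemma arikan_hi u j : (u *m arikan_mx n.+1) 0 (hi j) = (fold_odd u *m arikan_mx n) 0 j.
Proof.
rewrite !mxE big_evod [X in _ + X = _](_ : _ = \sum_k fold_odd u 0 k * arikan_mx n k j).
  rewrite big1 ?add0r// => k _; rewrite !arikan_mxE /= odd_double.
  by rewrite -{1}[(2 ^ n)%N]mul1n divnMDl ?expn_gt0// mulr0.
apply: eq_bigr => k _; rewrite !arikan_mxE mxE /= odd_double uphalf_double.
rewrite -{1}[(2 ^ n)%N]mul1n divnMDl ?expn_gt0// modnDl.
by rewrite (divn_small (ltn_ord j)) (modn_small (ltn_ord j)).
Qed.

Lemma arikan_ev u j :
  (u *m arikan_mx n.+1) 0 (ev j) = (\row_k (u 0 (lo k) + u 0 (hi k)) *m arikan_mx n) 0 j.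
Proof.
rewrite !mxE big_lohi -big_split; apply: eq_bigr => k _.
rewrite !arikan_mxE mxE mulrDl !polar_bit_top ?ev_proof ?lo_proof ?hi_proof//.
rewrite /= odd_double doubleK (modn_small (ltn_ord k)) modnDl (modn_small (ltn_ord k)).
by [].
Qed.

Lemma arikan_od u j :
  (u *m arikan_mx n.+1) 0 (od j) = (\row_k u 0 (hi k) *m arikan_mx n) 0 j.
Proof.
rewrite !mxE big_lohi [X in _ + X = _](_ : _ = \sum_k u 0 (hi k) * arikan_mx n k j).
  rewrite [X in X + _]big1 => [|k _]; last first.
    rewrite arikan_mxE polar_bit_top ?od_proof ?lo_proof//= odd_double.
    by rewrite (divn_small (ltn_ord k)) mulr0.
  by rewrite add0r; apply: eq_bigr => k _; rewrite [X in _ = X * _]mxE.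
apply: eq_bigr => k _; rewrite !arikan_mxE polar_bit_top ?od_proof ?hi_proof//=.
rewrite odd_double uphalf_double -{1}[(2 ^ n)%N]mul1n divnMDl ?expn_gt0// modnDl.
by rewrite (divn_small (ltn_ord k)) (modn_small (ltn_ord k)).
Qed.

End ArikanTransform.

(** The outer product is expanded by halves of the output and the inner one by parity of the output;
    the repeated terms cancel in characteristic 2. *)
Lemma arikan_involutive n (u : 'rV['F_2]_(2 ^ n)) : u *m arikan_mx n *m arikan_mx n = u.
Proof.
elim: n u => [|n IH] u; apply/rowP=> k.
  rewrite mxE (big_ord1 _ (fun j => _)) mxE (big_ord1 _ (fun j => _)) !arikan_mxE !mulr1.
  by congr (u _ _); apply: val_inj; case: k => [[|]].
have [s ks] : exists s, k = match s with inl j => lo j | inr j => hi j end.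
  by have [h _ hK] := lohi_bij n; exists (h k); rewrite hK.
case: s ks => j ->; rewrite ?arikan_lo ?arikan_hi.
  have -> : fold_sum (u *m arikan_mx n.+1) = \row_k u 0 (lo k) *m arikan_mx n.
    apply/rowP=> i; rewrite mxE arikan_ev arikan_od -[RHS]addr0.
    rewrite !mxE -big_split/= addr0; apply: eq_bigr => l _; rewrite !mxE mulrDl -addrA -mulrDl.
    by rewrite -mulr2n -[_ *+ 2]mulr_natl (_ : 2%:R = 0 :> 'F_2) ?mul0r ?addr0//; apply: val_inj.
  by rewrite IH mxE.
have -> : fold_odd (u *m arikan_mx n.+1) = \row_k u 0 (hi k) *m arikan_mx n.
  by apply/rowP=> i; rewrite mxE arikan_od.
by rewrite IH mxE.
Qed.

(** The form in which the transposed encoder of the phase channel is traded for the encoder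
    itself. *)
Lemma arikan_tr_rev n (i j : 'I_(2 ^ n)) :
  (arikan_mx n)^T i j = arikan_mx n (rev_ord i) (rev_ord j).
Proof. by rewrite mxE !arikan_mxE /= polar_bit_rev. Qed.

(** * Synthesized channels *)

Section BitStrings.
Local Notation F2 := ('F_2).

(** Total in the position, with value 0 out of range, so that halved and shifted positions carry no
    bounds. *)
Definition bit N (u : 'rV[F2]_N) (j : nat) : F2 := if insub j is Some k then u 0 k else 0.

Lemma bit_ord N (u : 'rV[F2]_N) (k : 'I_N) : bit u k = u 0 k.
Proof. by rewrite /bit valK. Qed.

Lemma bit_lt N (u : 'rV[F2]_N) j (jN : (j < N)%N) : bit u j = u 0 (Ordinal jN).
Proof. by rewrite -bit_ord. Qed.

Lemma bit_out N (u : 'rV[F2]_N) j : (N <= j)%N -> bit u j = 0.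
Proof. by move=> Nj; rewrite /bit insubF// ltnNge Nj. Qed.

Lemma bit_row N (h : nat -> F2) j : (j < N)%N -> bit (\row_(k < N) h k) j = h j.
Proof. by move=> jN; rewrite bit_lt mxE. Qed.

Definition past N (u : 'rV[F2]_N) m : m.-tuple F2 := [tuple bit u j | j < m].

Definition future N (u : 'rV[F2]_N) i : (N - i.+1).-tuple F2 :=
  [tuple bit u (i.+1 + j) | j < N - i.+1].

Lemma nth_past N (u : 'rV[F2]_N) m j : (j < m)%N -> nth 0 (past u m) j = bit u j.
Proof. by move=> jm; rewrite -[j]/(val (Ordinal jm)) -tnth_nth tnth_mktuple. Qed.

Lemma nth_future N (u : 'rV[F2]_N) i j : (j < N - i.+1)%N ->
  nth 0 (future u i) j = bit u (i.+1 + j).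
Proof. by move=> jm; rewrite -[j in LHS]/(val (Ordinal jm)) -tnth_nth tnth_mktuple. Qed.

Lemma tuple_eqP m (p q : m.-tuple F2) :
  (forall j, (j < m)%N -> nth 0 p j = nth 0 q j) -> p = q.
Proof. by move=> pq; apply: eq_from_tnth => j; rewrite !(tnth_nth 0) pq. Qed.

Section Split.
Variables (N : nat) (i : 'I_N).

Definition of_bits (t : i.-tuple F2 * (F2 * (N - i.+1).-tuple F2)) : 'rV[F2]_N :=
  bits N t.1 t.2.1 t.2.2.

Definition to_bits (u : 'rV[F2]_N) := (past u i, (u 0 i, future u i)).

Lemma bit_bits (p : i.-tuple F2) b (f : (N - i.+1).-tuple F2) j : (j < N)%N ->
  bit (bits N p b f) j =
  if (j < i)%N then nth 0 p j else if j == i :> nat then b else nth 0 f (j - i.+1).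
Proof.
move=> jN; rewrite bit_row// nth_cat size_tuple; case: ltnP => // ij.
have [->|ji] := eqVneq j (i : nat); first by rewrite subnn.
have {}ij : (i < j)%N by rewrite ltn_neqAle eq_sym ji.
by rewrite -(subnSK ij).
Qed.

Lemma of_bitsK : cancel of_bits to_bits.
Proof.
case=> p [b f]; rewrite /to_bits /of_bits /=; congr (_, (_, _)).
- apply: tuple_eqP => j ji; rewrite nth_past// bit_bits ?ji//.
  exact: ltn_trans ji (ltn_ord i).
- by rewrite -bit_ord bit_bits// ltnn eqxx.
- apply: tuple_eqP => j jf; have jN : (i.+1 + j < N)%N by rewrite -ltn_subRL.
  rewrite nth_future// bit_bits// ltnNge addSn ltnW ?ltnS ?leq_addr//=.
  by rewrite gtn_eqF ?ltnS ?leq_addr// -addSn addKn.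
Qed.

Lemma to_bitsK : cancel to_bits of_bits.
Proof.
move=> u; apply/rowP=> j; rewrite -!bit_ord bit_bits//.
case: ltnP => ij; first by rewrite nth_past.
have [/val_inj ->|ji] := eqVneq (j : nat) i; first by rewrite bit_ord.
have {}ij : (i < j)%N by rewrite ltn_neqAle eq_sym ji.
by rewrite nth_future ?subnKC// ltn_sub2r// (leq_ltn_trans ij).
Qed.

Lemma of_bits_bij : bijective of_bits.
Proof. by exists to_bits; [exact: of_bitsK|exact: to_bitsK]. Qed.

(** Replaces the free bits by whole strings under an indicator, a form in which the strings can be
    reparametrized. *)
Lemma sum_future (V : pzSemiRingType) (p : i.-tuple F2) b (H : 'rV[F2]_N -> V) :
  \sum_(f : (N - i.+1).-tuple F2) H (bits N p b f) = \sum_u ((past u i == p) && (u 0 i == b))%:R * H u.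
Proof.
rewrite [RHS](reindex of_bits)/=; last exact/onW_bij/of_bits_bij.
have E t : (past (of_bits t) i, (of_bits t 0 i, future (of_bits t) i)) = t.
  exact: of_bitsK.
rewrite [RHS](eq_bigr (fun t => ((t.1 == p) && (t.2.1 == b))%:R * H (of_bits t))); last first.
  by move=> t _; have := E t; case: t => q [c f] [e1 e2 _]; rewrite e1 e2.
rewrite sum_pair/=.
rewrite (bigD1 p)//= [X in _ + X]big1 ?addr0 => [|q /negbTE qp]; last first.
  by rewrite big1// => s _; rewrite qp mul0r.
rewrite sum_pair/=.
rewrite (bigD1 b)//= [X in _ + X]big1 ?addr0 => [|q /negbTE qp]; last first.
  by rewrite big1// => s _; rewrite qp andbF mul0r.
by apply: eq_bigr => f _; rewrite !eqxx mul1r.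
Qed.

End Split.

End BitStrings.

(** * Synthesized channels described by a one-letter kernel, and their splitting into two halves *)

Section SynthesizedKernels.
Local Open Scope sesquilinear_scope.
Variable C : numClosedFieldType.

Section Synth.
Variables (X : finType) (w : 'F_2 -> X -> X -> C).

Definition letters N (G : 'M['F_2]_N) (u : 'rV['F_2]_N) (x x' : {ffun 'I_N -> X}) : C :=
  \prod_k w ((u *m G) 0 k) (x k) (x' k).

(* [idx] enumerates the rows of the channel [V]: the [i] past bits, then the N outputs. *)
Definition is_synth N (G : 'M['F_2]_N) (i : 'I_N) D (V : 'F_2 -> 'M[C]_D)
    (idx : i.-tuple 'F_2 * {ffun 'I_N -> X} -> 'I_D) : Prop :=
  bijective idx /\ forall b p x p' x', V b (idx (p, x)) (idx (p', x')) =
    (p == p')%:R * ((2 ^+ i)^-1 * (2 ^+ (N - i.+1))^-1 *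
       \sum_(f : (N - i.+1).-tuple 'F_2) letters G (bits N p b f) x x').

Lemma synth_weight N (i : 'I_N) : (2 ^+ i)^-1 * (2 ^+ (N - i.+1))^-1 = (2 ^+ N.-1)^-1 :> C.
Proof.
rewrite -invfM -exprD; congr (_ ^+ _)^-1.
by have := ltn_ord i; lia.
Qed.

Lemma synth_entry N (G : 'M['F_2]_N) (i : 'I_N) D (V : 'F_2 -> 'M[C]_D) idx :
  is_synth G V idx -> forall b p x p' x', V b (idx (p, x)) (idx (p', x')) =
  (p == p')%:R * ((2 ^+ N.-1)^-1 *
    \sum_u ((past u i == p) && (u 0 i == b))%:R * letters G u x x').
Proof.
move=> [_ VE] b p x p' x'; rewrite VE synth_weight.
by rewrite (sum_future p b (fun u => letters G u x x')).
Qed.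

Lemma synth_psd N (G : 'M['F_2]_N) (i : 'I_N) D (V : 'F_2 -> 'M[C]_D) idx
    (J : finType) (a : 'F_2 -> J -> X -> C) :
  is_synth (i := i) G V idx ->
  (forall b x x', w b x x' = \sum_j a b j x * (a b j x')^*) -> forall b, psdmx (V b).
Proof.
move=> [idx_bij VE] wE b; apply/(psdmx_psdker idx_bij).
set c := (2 ^+ i)^-1 * (2 ^+ (N - i.+1))^-1 in VE.
have c0 : 0 <= c by rewrite mulr_ge0// invr_ge0 exprn_ge0.
have sqc : sqrtC c * (sqrtC c)^* = c.
  by rewrite geC0_conj ?sqrtC_ge0// -expr2 sqrtCK.
pose e (s : i.-tuple 'F_2 * ((N - i.+1).-tuple 'F_2 * {ffun 'I_N -> J}))
    (t : i.-tuple 'F_2 * {ffun 'I_N -> X}) : C :=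
  (t.1 == s.1)%:R * (sqrtC c * \prod_k a ((bits N s.1 b s.2.1 *m G) 0 k) (s.2.2 k) (t.2 k)).
move=> v; have := psdker_gram e v; congr (_ <= _).
apply: eq_bigr => -[p x] _; apply: eq_bigr => -[p' x'] _; congr (_ * _ * _).
rewrite VE sum_pair (bigD1 p)//= [X in _ + X]big1 ?addr0 => [|q /negbTE qp]; last first.
  by rewrite big1// => s _; rewrite /e /= eq_sym qp !mul0r.
rewrite sum_pair 2!mulr_sumr; apply: eq_bigr => f _; rewrite /letters.
under [X in _ = _ * (_ * X)]eq_bigr do rewrite wE.
rewrite bigA_distr_bigA/= 2!mulr_sumr; apply: eq_bigr => h _.
rewrite /e /= eqxx mul1r !rmorphM/= conjC_nat rmorph_prod big_split/= -[in RHS]sqc [p' == p]eq_sym.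
by ring.
Qed.

Lemma synth_tr N (G : 'M['F_2]_N) (i : 'I_N) D (V : 'F_2 -> 'M[C]_D) idx :
  is_synth (i := i) G V idx ->
  (forall b, \sum_x w b x x = 1) -> forall b, \tr (V b) = 1.
Proof.
move=> [idx_bij VE] w1 b; rewrite (tr_relabel idx_bij) sum_pair.
have card2 m (c : C) : \sum_(p : m.-tuple 'F_2) c = 2 ^+ m * c.
  by rewrite sumr_const card_tuple card_ord -natrX mulr_natl.
have pow_neq0 m : 2 ^+ m != 0 :> C by rewrite expf_neq0// pnatr_eq0.
transitivity (\sum_(p : i.-tuple 'F_2) (2 ^+ i)^-1 : C); last first.
  by rewrite card2 mulfV.
apply: eq_bigr => p _.
transitivity ((2 ^+ i)^-1 * (2 ^+ (N - i.+1))^-1 *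
    \sum_(f : (N - i.+1).-tuple 'F_2) \sum_x letters G (bits N p b f) x x).
  rewrite exchange_big/= mulr_sumr; apply: eq_bigr => x _.
  by rewrite VE eqxx mul1r.
rewrite (eq_bigr (fun=> 1)) => [|f _]; last first.
  rewrite /letters -(bigA_distr_bigA (fun k x => w ((bits N p b f *m G) 0 k) x x)).
  by rewrite big1// => k _; rewrite w1.
by rewrite card2 mulr1 -mulrA mulVf// mulr1.
Qed.

End Synth.

Section Merge.
Variables (n : nat) (i : 'I_(2 ^ n)).

(** Inverse of the pair [fold_sum], [fold_odd]. *)
Definition unfold_bits (v w : 'rV['F_2]_(2 ^ n)) : 'rV['F_2]_(2 ^ n.+1) :=
  \row_k (if odd k then bit w k./2 else bit v k./2 + bit w k./2).

Lemma bit_unfold_bits v w k : bit (unfold_bits v w) k =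
  if odd k then bit w k./2 else bit v k./2 + bit w k./2.
Proof.
have [kN|Nk] := ltnP k (2 ^ n.+1).
  exact: (@bit_row _ (fun k => if odd k then bit w k./2 else bit v k./2 + bit w k./2)).
have Nk2 : (2 ^ n <= k./2)%N by have := half_leq Nk; rewrite expnS mul2n doubleK.
by rewrite !bit_out// addr0 if_same.
Qed.

Lemma fold_sum_unfold_bits v w : fold_sum (unfold_bits v w) = v.
Proof.
apply/rowP=> j; rewrite !mxE /= odd_double /= uphalf_double doubleK !bit_ord.
by rewrite -addrA -mulr2n -[_ *+ 2]mulr_natl (_ : 2%:R = 0 :> 'F_2) ?mul0r ?addr0//; apply: val_inj.
Qed.

Lemma fold_odd_unfold_bits v w : fold_odd (unfold_bits v w) = w.
Proof. by apply/rowP=> j; rewrite !mxE /= odd_double /= uphalf_double bit_ord. Qed.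

Lemma unfold_bits_bij : bijective (fun vw => unfold_bits vw.1 vw.2).
Proof.
apply: inj_card_bij => [[v w] [v' w'] /= E|].
  by rewrite -(fold_sum_unfold_bits v w) E fold_sum_unfold_bits -{1}(fold_odd_unfold_bits v w) E fold_odd_unfold_bits.
by rewrite card_prod !card_mx !mul1n -expnD addnn -mul2n -expnS.
Qed.

Definition interleave (p q : i.-tuple 'F_2) : (i.*2).-tuple 'F_2 :=
  [tuple if odd j then nth 0 q j./2 else nth 0 p j./2 + nth 0 q j./2 | j < i.*2].

Lemma nth_interleave p q j : (j < i.*2)%N -> nth 0 (interleave p q) j =
  if odd j then nth 0 q j./2 else nth 0 p j./2 + nth 0 q j./2.
Proof. by move=> jm; rewrite -[j in LHS]/(val (Ordinal jm)) -tnth_nth tnth_mktuple. Qed.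

Lemma interleave_inj p q p' q' : interleave p q = interleave p' q' -> (p, q) = (p', q').
Proof.
move=> E; have qq : q = q'.
  apply: tuple_eqP => j ji; have := nth_interleave p q (j := j.*2.+1).
  have := nth_interleave p' q' (j := j.*2.+1); rewrite E /= odd_double uphalf_double.
  by rewrite ltn_Sdouble => /(_ ji) -> /(_ ji).
congr (_, _) => //; apply: tuple_eqP => j ji; have := nth_interleave p q (j := j.*2).
have := nth_interleave p' q' (j := j.*2); rewrite E /= odd_double doubleK.
by rewrite ltn_double -qq => /(_ ji) -> /(_ ji) /addIr.
Qed.

Lemma eq_interleave p q p' q' : (interleave p q == interleave p' q') = (p == p') && (q == q').
Proof.
by apply/eqP/andP => [/interleave_inj[-> ->]|[/eqP -> /eqP ->]].
Qed.

Lemma past_unfold_bits v w : past (unfold_bits v w) i.*2 = interleave (past v i) (past w i).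
Proof.
apply: tuple_eqP => j ji; rewrite nth_past// nth_interleave// bit_unfold_bits !nth_past//.
all: by rewrite ltn_half_double.
Qed.

(** The last branch is never reached; [x i] only supplies an element of [Y]. *)
Definition concat_halves (Y : finType) (x y : {ffun 'I_(2 ^ n) -> Y}) : {ffun 'I_(2 ^ n.+1) -> Y} :=
  [ffun k : 'I_(2 ^ n.+1) => if insub (k : nat) is Some l then x l else
     if insub (k - 2 ^ n)%N is Some l then y l else x i].

Lemma concat_halves_lo (Y : finType) (x y : {ffun 'I_(2 ^ n) -> Y}) k : concat_halves x y (lo k) = x k.
Proof. by rewrite ffunE /= valK. Qed.

Lemma concat_halves_hi (Y : finType) (x y : {ffun 'I_(2 ^ n) -> Y}) k : concat_halves x y (hi k) = y k.
Proof. by rewrite ffunE /= insubF ?addKn ?valK// ltnNge leq_addr. Qed.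

Lemma concat_halves_inj (Y : finType) (x y x' y' : {ffun 'I_(2 ^ n) -> Y}) :
  concat_halves x y = concat_halves x' y' -> (x, y) = (x', y').
Proof.
move=> E; congr (_, _); apply/ffunP=> k.
  by rewrite -(concat_halves_lo x y) E concat_halves_lo.
by rewrite -(concat_halves_hi x y) E concat_halves_hi.
Qed.

Lemma letters_unfold_bits (X : finType) (ker : 'F_2 -> X -> X -> C) v w x y x' y' :
  letters ker (arikan_mx n.+1) (unfold_bits v w) (concat_halves x y) (concat_halves x' y') =
  letters ker (arikan_mx n) v x x' * letters ker (arikan_mx n) w y y'.
Proof.
rewrite /letters big_lohi; congr (_ * _); apply: eq_bigr => k _.
  by rewrite arikan_lo fold_sum_unfold_bits !concat_halves_lo.
by rewrite arikan_hi fold_odd_unfold_bits !concat_halves_hi.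
Qed.

End Merge.

End SynthesizedKernels.

(** * One level of the recursion for synthesized channels *)

Section SynthesizedSteps.
Local Open Scope sesquilinear_scope.
Variable C : numClosedFieldType.

Lemma F2_eqD (a b c : 'F_2) : (a == b + c) = (a + c == b).
Proof. by case: a b c => [[|[|//]] ?] [[|[|//]] ?] [[|[|//]] ?]. Qed.

Section Step.
Variables (X : finType) (w : 'F_2 -> X -> X -> C) (n : nat) (i : 'I_(2 ^ n)).
Variables (D : nat) (V : 'F_2 -> 'M[C]_D) (idx : i.-tuple 'F_2 * {ffun 'I_(2 ^ n) -> X} -> 'I_D).
Hypothesis V_synth : is_synth w (arikan_mx n) V idx.
Hypotheses (V_psd : forall b, psdmx (V b)) (V_tr : forall b, \tr (V b) = 1).

Let halve_weight : (2 ^+ (2 ^ n.+1).-1)^-1 = 2^-1 * ((2 ^+ (2 ^ n).-1)^-1 * (2 ^+ (2 ^ n).-1)^-1) :> C.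
Proof.
rewrite -!invfM -!exprD -exprS expnS; congr (_ ^+ _)^-1.
by have : (0 < 2 ^ n)%N; [rewrite expn_gt0|lia].
Qed.

Let sum_unfold_bits (H : 'rV['F_2]_(2 ^ n.+1) -> C) :
  \sum_u H u = \sum_v \sum_v' H (unfold_bits v v').
Proof. by rewrite (reindex _ (onW_bij _ (unfold_bits_bij n))) sum_pair. Qed.

(** At the even position 2i the known past interleaves the pasts of the two halves, the input is the
    sum of their i-th bits, and the i-th bit of the second half is random. *)
Lemma synth_minus D' (V' : 'F_2 -> 'M[C]_D') idx' :
  is_synth (i := ev i) w (arikan_mx n.+1) V' idx' -> (forall b, psdmx (V' b)) ->
  root_fidelity (V' 0) (V' 1) <= 2 * root_fidelity (V 0) (V 1) - root_fidelity (V 0) (V 1) ^+ 2.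
Proof.
move=> V'_synth V'_psd; have [hI hIK idxK] := V_synth.1.
pose g (s : 'I_D * 'I_D) := idx' (interleave (hI s.1).1 (hI s.2).1, concat_halves i (hI s.1).2 (hI s.2).2).
have g_inj : injective g.
  move=> [s s'] [t t'] /(bij_inj V'_synth.1) E.
  have [/= e1 e2] := interleave_inj (congr1 fst E).
  have [/= e3 e4] := concat_halves_inj (congr1 snd E).
  by congr (_, _); apply: (can_inj idxK); apply: injective_projections.
have g_bij : bijective g.
  apply: inj_card_bij => //.
  have := bij_eq_card V_synth.1; have := bij_eq_card V'_synth.1.
  rewrite !card_prod !card_tuple !card_ffun !card_ord => <- <-.
  by rewrite mulnACA -!expnD !addnn -[(2 ^ n).*2]mul2n -expnS.
apply: (root_fidelity_minus V_psd V_tr g_bij V'_psd) => b s s' t t'.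
rewrite -(idxK s) -(idxK s') -(idxK t) -(idxK t') /g /= !hIK.
case: (hI s) (hI s') (hI t) (hI t') => [p x] [q y] [p' x'] [q' y'] /=.
rewrite (synth_entry V'_synth) eq_interleave halve_weight.
under [RHS in _ = 2^-1 * RHS]eq_bigr do rewrite !(synth_entry V_synth).
set K := (2 ^+ _)^-1.
transitivity (2^-1 * ((p == p')%:R * (q == q')%:R * K * K *
   \sum_(c : 'F_2) (\sum_u ((past u i == p) && (u 0 i == b + c))%:R * letters w (arikan_mx n) u x x') *
    (\sum_u ((past u i == q) && (u 0 i == c))%:R * letters w (arikan_mx n) u y y'))); last first.
  by congr (_ * _); rewrite mulr_sumr; apply: eq_bigr => c _; ring.
rewrite sum_unfold_bits -mulnb natrM.
suff -> : \sum_v \sum_v' ((past (unfold_bits v v') (ev i) == interleave p q) && (unfold_bits v v' 0 (ev i) == b))%:R *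
     letters w (arikan_mx n.+1) (unfold_bits v v') (concat_halves i x y) (concat_halves i x' y') =
   \sum_(c : 'F_2) (\sum_u ((past u i == p) && (u 0 i == b + c))%:R * letters w (arikan_mx n) u x x') *
    (\sum_u ((past u i == q) && (u 0 i == c))%:R * letters w (arikan_mx n) u y y').
  by ring.
under [RHS]eq_bigr do rewrite mulr_suml.
rewrite [RHS]exchange_big/=; apply: eq_bigr => v _.
under [RHS]eq_bigr do rewrite mulr_sumr.
rewrite [RHS]exchange_big/=; apply: eq_bigr => v' _.
rewrite letters_unfold_bits -bit_ord bit_unfold_bits /= odd_double doubleK past_unfold_bits eq_interleave !bit_ord.
rewrite (bigD1 (v' 0 i))//= [X in _ = _ + X]big1 ?addr0 => [|c /negbTE cv]; last first.
  by rewrite [_ == c]eq_sym cv andbF mul0r mulr0.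
by rewrite eqxx andbT F2_eqD mulrACA -natrM mulnb andbAC.
Qed.

(** At position 2i + 1 the past also contains the sum c of the two i-th bits; the input b is the bit
    of the second half, so the first half receives c + b. *)
Lemma synth_plus D' (V' : 'F_2 -> 'M[C]_D') idx' :
  is_synth (i := od i) w (arikan_mx n.+1) V' idx' -> (forall b, psdmx (V' b)) ->
  root_fidelity (V' 0) (V' 1) <= root_fidelity (V 0) (V 1) ^+ 2.
Proof.
move=> V'_synth V'_psd; have [hI hIK idxK] := V_synth.1.
pose ext (p : (i.*2).-tuple 'F_2) (c : 'F_2) : (od i).-tuple 'F_2 := [tuple of rcons p c].
have ext_eq p c p' c' : (ext p c == ext p' c') = (p == p') && (c == c').
  by rewrite -val_eqE /= eqseq_rcons.
pose g (s : 'F_2 * ('I_D * 'I_D)) := idx'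
  (ext (interleave (hI s.2.1).1 (hI s.2.2).1) s.1, concat_halves i (hI s.2.1).2 (hI s.2.2).2).
have g_inj : injective g.
  move=> [c [s s']] [c' [t t']] /(bij_inj V'_synth.1) E.
  have /eqP := congr1 fst E; rewrite ext_eq /= => /andP[/eqP/interleave_inj[e1 e2] /eqP ->].
  have [/= e3 e4] := concat_halves_inj (congr1 snd E).
  by congr (_, (_, _)); apply: (can_inj idxK); apply: injective_projections.
have g_bij : bijective g.
  apply: inj_card_bij => //.
  have := bij_eq_card V_synth.1; have := bij_eq_card V'_synth.1.
  rewrite !card_prod !card_tuple !card_ffun !card_ord => <- <-.
  by rewrite mulnACA -!expnD !addnn -[(2 ^ n).*2]mul2n -expnS mulnA -expnS.
apply: (root_fidelity_plus V_psd V_tr g_bij V'_psd) => b c s s' c' t t'.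
rewrite -(idxK s) -(idxK s') -(idxK t) -(idxK t') /g /= !hIK.
case: (hI s) (hI s') (hI t) (hI t') => [p x] [q y] [p' x'] [q' y'] /=.
rewrite (synth_entry V'_synth) ext_eq eq_interleave halve_weight !(synth_entry V_synth).
set K := (2 ^+ _)^-1.
rewrite sum_unfold_bits -!mulnb !natrM.
suff -> : \sum_v \sum_v' ((past (unfold_bits v v') (od i) == ext (interleave p q) c) && (unfold_bits v v' 0 (od i) == b))%:R *
     letters w (arikan_mx n.+1) (unfold_bits v v') (concat_halves i x y) (concat_halves i x' y') =
   (\sum_u ((past u i == p) && (u 0 i == c + b))%:R * letters w (arikan_mx n) u x x') *
    (\sum_u ((past u i == q) && (u 0 i == b))%:R * letters w (arikan_mx n) u y y').
  by ring.
rewrite mulr_suml; apply: eq_bigr => v _.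
rewrite mulr_sumr; apply: eq_bigr => v' _.
rewrite letters_unfold_bits -bit_ord bit_unfold_bits /= odd_double /= uphalf_double !bit_ord.
have -> : past (unfold_bits v v') (od i) = ext (interleave (past v i) (past v' i)) (v 0 i + v' 0 i).
  apply: tuple_eqP => j; rewrite ltnS leq_eqVlt => /orP[/eqP ->|ji].
    rewrite nth_past// -[RHS]/(nth 0 (rcons (interleave _ _) _) _) nth_rcons size_tuple ltnn eqxx bit_unfold_bits odd_double doubleK.
    by rewrite !bit_ord.
  rewrite nth_past ?ltnS 1?ltnW// -[RHS]/(nth 0 (rcons (interleave _ _) _) _).
  by rewrite nth_rcons size_tuple ji -past_unfold_bits nth_past.
rewrite ext_eq eq_interleave mulrACA -natrM mulnb F2_eqD.
congr (_%:R * _); have [->|] := eqVneq (v' 0 i) b; rewrite ?andbT ?andbF//.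
by rewrite andbAC.
Qed.

End Step.

End SynthesizedSteps.

(** * Degrading, reversal of positions, and characters of F_2^m *)

Section SynthesizedRelations.
Local Open Scope sesquilinear_scope.
Variable C : numClosedFieldType.

Lemma prod_eq_ffun (N : nat) (X : finType) (x x' : {ffun 'I_N -> X}) :
  \prod_k (x k == x' k)%:R = (x == x')%:R :> C.
Proof.
have [->|xx'] := eqVneq x x'; first by rewrite big1// => k _; rewrite eqxx.
have /existsP[k xk] : [exists k, x k != x' k].
  apply: contra_neqT xx' => /existsPn h; apply/ffunP => k.
  by apply/eqP; rewrite -[_ == _]negbK h.
by rewrite (bigD1 k)//= (negbTE xk) mul0r.
Qed.

(** Synthesis commutes with degrading letter by letter: products of the one-letter Kraus operators
    act on the outputs and leave the register of past bits alone. *)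
Lemma synth_degrade (X Y J : finType) (wB : 'F_2 -> X -> X -> C) (wE : 'F_2 -> Y -> Y -> C)
    (l : J -> Y -> X -> C) N (G : 'M['F_2]_N) (i : 'I_N) DB (VB : 'F_2 -> 'M[C]_DB) idxB
    DE (VE : 'F_2 -> 'M[C]_DE) idxE :
  is_synth (i := i) wB G VB idxB -> is_synth (i := i) wE G VE idxE ->
  (forall b, psdmx (VB b)) -> (forall b, psdmx (VE b)) ->
  (forall x x', \sum_j \sum_y (l j y x)^* * l j y x' = (x == x')%:R) ->
  (forall b y y', wE b y y' = \sum_j \sum_x \sum_x' l j y x * wB b x x' * (l j y' x')^*) ->
  root_fidelity (VB 0) (VB 1) <= root_fidelity (VE 0) (VE 1).
Proof.
move=> [idxB_bij VBE] [idxE_bij VEE] VB_psd VE_psd l1 wEE.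
pose L (h : {ffun 'I_N -> J}) (t : i.-tuple 'F_2 * {ffun 'I_N -> Y})
    (s : i.-tuple 'F_2 * {ffun 'I_N -> X}) : C :=
  (t.1 == s.1)%:R * \prod_k l (h k) (t.2 k) (s.2 k).
have main b t t' : VE b (idxE t) (idxE t') =
    \sum_h \sum_s \sum_s' L h t s * VB b (idxB s) (idxB s') * (L h t' s')^*.
  case: t t' => p y [p' y']; rewrite VEE; set c := _^-1 * _^-1.
  transitivity (\sum_(h : {ffun 'I_N -> J}) \sum_(x : {ffun 'I_N -> X}) \sum_(x' : {ffun 'I_N -> X}) (p == p')%:R * (\prod_k l (h k) (y k) (x k) *
      (c * \sum_(f : (N - i.+1).-tuple 'F_2) letters wB G (bits N p b f) x x') *
      (\prod_k l (h k) (y' k) (x' k))^*)); last first.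
    apply: eq_bigr => h _; rewrite sum_pair [RHS](bigD1 p)//=.
    rewrite [X in _ = _ + X]big1 ?addr0 => [|q /negbTE qp]; last first.
      by rewrite big1// => x _; rewrite big1// => s _; rewrite /L /= eq_sym qp !mul0r.
    apply: eq_bigr => x _; rewrite sum_pair [RHS](bigD1 p)//=.
    rewrite [X in _ = _ + X]big1 ?addr0 => [|q /negbTE qp]; last first.
      by rewrite big1// => x' _; rewrite VBE eq_sym qp !mul0r mulr0 mul0r.
    apply: eq_bigr => x' _; rewrite VBE /L/= !eqxx !rmorphM/= conjC_nat [p' == p]eq_sym -/c.
    by ring.
  transitivity ((p == p')%:R * (c * \sum_(f : (N - i.+1).-tuple 'F_2) \sum_(h : {ffun 'I_N -> J}) \sum_(x : {ffun 'I_N -> X}) \sum_(x' : {ffun 'I_N -> X})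
      (\prod_k l (h k) (y k) (x k) * letters wB G (bits N p b f) x x' *
      (\prod_k l (h k) (y' k) (x' k))^*))).
    congr (_ * (_ * _)); apply: eq_bigr => f _; rewrite /letters.
    under eq_bigr do rewrite wEE.
    rewrite bigA_distr_bigA; apply: eq_bigr => h _.
    rewrite bigA_distr_bigA; apply: eq_bigr => x _.
    rewrite bigA_distr_bigA; apply: eq_bigr => x' _.
    by rewrite rmorph_prod -!big_split.
  rewrite exchange_big/= 2!mulr_sumr; apply: eq_bigr => h _.
  rewrite exchange_big/= 2!mulr_sumr; apply: eq_bigr => x _.
  rewrite exchange_big/= 2!mulr_sumr; apply: eq_bigr => x' _.
  by rewrite -mulr_suml -mulr_sumr; ring.
apply: (root_fidelity_mono (L := L) idxE_bij idxB_bij) => // [[q x] [q' x']].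
transitivity (\sum_(h : {ffun 'I_N -> J}) \sum_(y : {ffun 'I_N -> Y}) (q == q')%:R * \prod_k ((l (h k) (y k) (x k))^* * l (h k) (y k) (x' k))).
  apply: eq_bigr => h _; rewrite sum_pair (bigD1 q)//= [X in _ + X]big1 ?addr0; last first.
    move=> p /negbTE pq; rewrite big1// => y _; rewrite /L/= pq.
    by rewrite mul0r conjC0 mul0r.
  apply: eq_bigr => y _; rewrite /L /= eqxx mul1r big_split/= rmorph_prod.
  by rewrite mulrCA.
under eq_bigr do rewrite -mulr_sumr.
rewrite -mulr_sumr xpair_eqE -mulnb natrM -prod_eq_ffun.
under [X in _ = _ * X]eq_bigr do rewrite -l1.
rewrite bigA_distr_bigA; congr (_ * _); apply: eq_bigr => h _.
by rewrite bigA_distr_bigA.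
Qed.

Section Future.
Variables (X : finType) (w : 'F_2 -> X -> X -> C).

Definition is_synth_future N (G : 'M['F_2]_N) (i : 'I_N) D (V : 'F_2 -> 'M[C]_D)
    (idx : (N - i.+1).-tuple 'F_2 * {ffun 'I_N -> X} -> 'I_D) : Prop :=
  bijective idx /\ forall b f x f' x', V b (idx (f, x)) (idx (f', x')) =
    (f == f')%:R * ((2 ^+ (N - i.+1))^-1 * (2 ^+ i)^-1 *
       \sum_(p : i.-tuple 'F_2) letters w G (bits N p b f) x x').

Lemma sum_past N (i : 'I_N) (f : (N - i.+1).-tuple 'F_2) b (H : 'rV['F_2]_N -> C) :
  \sum_(p : i.-tuple 'F_2) H (bits N p b f) =
  \sum_u ((future u i == f) && (u 0 i == b))%:R * H u.
Proof.
rewrite [RHS](reindex (@of_bits N i))/=; last exact/onW_bij/of_bits_bij.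
have E t : (past (@of_bits N i t) i, (of_bits t 0 i, future (of_bits t) i)) = t.
  exact: of_bitsK.
rewrite [RHS](eq_bigr (fun t => ((t.2.2 == f) && (t.2.1 == b))%:R * H (of_bits t))); last first.
  by move=> t _; have := E t; case: t => q [c g] [_ e1 e2]; rewrite e1 e2.
rewrite sum_pair; apply: eq_bigr => p _; rewrite sum_pair (bigD1 b)//=.
rewrite [X in _ = _ + X]big1 ?addr0 => [|c /negbTE cb]; last first.
  by rewrite big1// => g _; rewrite cb andbF mul0r.
rewrite (bigD1 f)//= [X in _ = _ + X]big1 ?addr0 => [|g /negbTE gf]; last first.
  by rewrite gf mul0r.
by rewrite !eqxx mul1r.
Qed.

(** Reversing all positions exchanges past with future and, by the hypothesis on [G], the transpose
    with [G]. The channel [V] stays the same; only its rows are relabelled. *)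
Lemma synth_future_past N (G : 'M['F_2]_N) (i : 'I_N) D (V : 'F_2 -> 'M[C]_D) idx :
  (forall k k', G^T k k' = G (rev_ord k) (rev_ord k')) ->
  is_synth_future (i := i) G^T V idx ->
  exists idx' : (rev_ord i).-tuple 'F_2 * {ffun 'I_N -> X} -> 'I_D, is_synth w G V idx'.
Proof.
move=> GT [idx_bij VE].
pose rt (p : (rev_ord i).-tuple 'F_2) : (N - i.+1).-tuple 'F_2 := [tuple of rev p].
pose rx (x : {ffun 'I_N -> X}) : {ffun 'I_N -> X} := [ffun k => x (rev_ord k)].
have rtK p : rt (rt p) = p by apply: val_inj; rewrite /= revK.
have rt_eq p q : (rt p == rt q) = (p == q).
  by apply/eqP/eqP => [E|->//]; rewrite -(rtK p) E rtK.
have rxK x : rx (rx x) = x by apply/ffunP=> k; rewrite !ffunE rev_ordK.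
exists (fun t => idx (rt t.1, rx t.2)); split.
  apply: bij_comp idx_bij _; exists (fun t => (rt t.1, rx t.2)) => -[p x] /=;
  by rewrite rtK rxK.
move=> b p x p' x'; rewrite VE rt_eq synth_weight mulrC.
rewrite [(2 ^+ _)^-1 * _]mulrC synth_weight mulrC; congr (_ * (_ * _)).
rewrite /= (sum_past (rt p) b (fun u => letters w G^T u (rx x) (rx x'))).
rewrite (sum_future p b (fun u => letters w G u x x')).
pose ru (u : 'rV['F_2]_N) : 'rV['F_2]_N := \row_k u 0 (rev_ord k).
have ruK : involutive ru by move=> u; apply/rowP=> k; rewrite !mxE rev_ordK.
rewrite (reindex_inj (inv_inj ruK)); apply: eq_bigr => u _.
congr (_%:R * _).
  congr (_ && _); last by rewrite mxE.
  rewrite -(rt_eq (past u _)); congr (_ == _); apply: tuple_eqP => j ji.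
  rewrite nth_future// nth_rev ?size_tuple// nth_past; last by rewrite /= subnSK ?leq_subr.
  have jN : (i.+1 + j < N)%N by rewrite -ltn_subRL.
  rewrite bit_lt mxE -bit_ord; congr bit; rewrite /=.
  by rewrite -addnS subnDA.
rewrite /letters (reindex_inj rev_ord_inj); apply: eq_bigr => k _.
rewrite !ffunE rev_ordK; congr (w _ _ _).
rewrite !mxE (reindex_inj rev_ord_inj); apply: eq_bigr => k' _.
by rewrite mxE rev_ordK GT !rev_ordK.
Qed.

End Future.

Definition sgn (a : 'F_2) : C := if a == 0 then 1 else -1.

Lemma sgnD a b : sgn (a + b) = sgn a * sgn b.
Proof.
by rewrite /sgn; case: a b => [[|[|//]] ?] [[|[|//]] ?] /=; rewrite ?mulr1 ?mul1r ?mulN1r ?opprK.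
Qed.

Lemma sgn0 : sgn 0 = 1.
Proof. by []. Qed.

Lemma sgn_sum (I : finType) (h : I -> 'F_2) : sgn (\sum_i h i) = \prod_i sgn (h i).
Proof. exact: (big_morph sgn sgnD sgn0). Qed.

Lemma sgn_sqr a : sgn a * sgn a = 1.
Proof. by rewrite /sgn; case: ifP; rewrite ?mulr1// mulN1r opprK. Qed.

Lemma sgn_real a : (sgn a)^* = sgn a.
Proof. by rewrite /sgn; case: ifP; rewrite ?rmorphN rmorph1. Qed.

(** Orthogonality of the characters of F_2^m: uniformly random past phase bits dephase the past
    amplitude bits completely. *)
Lemma sgn_orthogonality m (p p' : m.-tuple 'F_2) :
  \sum_(q : m.-tuple 'F_2) sgn (\sum_j tnth q j * (tnth p j + tnth p' j)) =
  2 ^+ m * (p == p')%:R.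
Proof.
pose h (t : {ffun 'I_m -> 'F_2}) := [tuple t j | j < m].
have h_bij : bijective h.
  exists (fun q : m.-tuple 'F_2 => [ffun j => tnth q j]) => [t|q].
    by apply/ffunP=> j; rewrite ffunE tnth_mktuple.
  by apply: eq_from_tnth => j; rewrite tnth_mktuple ffunE.
rewrite (reindex h)/=; last exact: onW_bij.
under eq_bigr do rewrite sgn_sum.
transitivity (\sum_(t : {ffun 'I_m -> 'F_2}) \prod_j sgn (t j * (tnth p j + tnth p' j))).
  by apply: eq_bigr => t _; apply: eq_bigr => j _; rewrite tnth_mktuple.
rewrite -(bigA_distr_bigA (fun j a => sgn (a * (tnth p j + tnth p' j)))).
have -> : (p == p') = ([ffun j => tnth p j] == [ffun j => tnth p' j]).
  apply/eqP/eqP => [->//|/ffunP E]; apply: eq_from_tnth => j.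
  by have := E j; rewrite !ffunE.
rewrite -prod_eq_ffun -[m in 2 ^+ m]card_ord -prodr_const -big_split.
apply: eq_bigr => j _; rewrite sum_F2 mul0r mul1r !ffunE sgn0 /sgn.
by case: (tnth p j) (tnth p' j) => [[|[|//]] ?] [[|[|//]] ?] /=; rewrite ?subrr ?mulr0 ?mulr1.
Qed.

End SynthesizedRelations.

(** * The trade-off at one synthesized position *)

Section SynthesizedUncertainty.
Local Open Scope sesquilinear_scope.
Variable C : numClosedFieldType.

Lemma sum_bits N (i : 'I_N) (p : i.-tuple 'F_2) b (f : (N - i.+1).-tuple 'F_2) (u : 'rV['F_2]_N) :
  \sum_k bits N p b f 0 k * u 0 k =
  \sum_(j < i) tnth p j * bit u j + b * u 0 i + \sum_(j < N - i.+1) tnth f j * bit u (i.+1 + j).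
Proof.
under eq_bigr do rewrite -!bit_ord.
rewrite -(big_mkord xpredT (fun k => bit (bits N p b f) k * bit u k)).
have iN := ltn_ord i.
rewrite (big_cat_nat (leq0n i) (ltnW iN))/= [X in _ + X]big_ltn//.
rewrite addrA; congr (_ + _ + _).
- rewrite big_mkord; apply: eq_bigr => j _.
  by rewrite (bit_bits p b f (ltn_trans (ltn_ord j) iN)) ltn_ord (tnth_nth 0).
- by rewrite bit_bits// ltnn eqxx bit_ord.
- rewrite -{1}[i.+1]add0n big_addn big_mkord; apply: eq_bigr => j _.
  have jN : (i.+1 + j < N)%N by rewrite -ltn_subRL.
  rewrite [(j + i.+1)%N]addnC bit_bits// (tnth_nth 0).
  by rewrite ltnNge addSn ltnW ?ltnS ?leq_addr//= gtn_eqF ?ltnS ?leq_addr// -addSn addKn.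
Qed.

Lemma sgn_mulD (b c c' : 'F_2) :
  sgn C (b * (c + c')) = if (b != 0) && (c != c') then -1 else 1.
Proof. by case: b c c' => [[|[|//]] ?] [[|[|//]] ?] [[|[|//]] ?]. Qed.

Variables (S E : finType) (Psi : 'F_2 -> S -> E -> C).
Variables (wE : 'F_2 -> E -> E -> C) (wP : 'F_2 -> 'F_2 * S -> 'F_2 * S -> C).
Hypothesis wE_entry : forall b e e', wE b e e' = \sum_s Psi b s e * (Psi b s e')^*.
Hypothesis wP_entry : forall x z s z' s', wP x (z, s) (z', s') =
  2^-1 * sgn C (x * (z + z')) * \sum_e Psi z s e * (Psi z' s' e)^*.
Hypothesis Psi_norm : forall b, \sum_e \sum_s Psi b s e * (Psi b s e)^* = 1.

Lemma phase_kernel_gram x t t' : wP x t t' =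
  \sum_e ((sqrtC 2)^-1 * sgn C (x * t.1) * Psi t.1 t.2 e) *
         ((sqrtC 2)^-1 * sgn C (x * t'.1) * Psi t'.1 t'.2 e)^*.
Proof.
have half : (sqrtC 2)^-1 * ((sqrtC 2)^-1)^* = 2^-1 :> C.
  by rewrite geC0_conj ?invr_ge0 ?sqrtC_ge0// -invfM -expr2 sqrtCK.
case: t t' => z s [z' s']; rewrite wP_entry mulr_sumr; apply: eq_bigr => e _ /=.
by rewrite !rmorphM /= sgn_real mulrDr sgnD -half; ring.
Qed.

Lemma phase_kernel_norm x : \sum_t wP x t t = 1.
Proof.
have diag (z : 'F_2) : \sum_s wP x (z, s) (z, s) = 2^-1.
  have z0 : z + z = 0 by case: z => [[|[|//]] ?]; exact: val_inj.
  transitivity (2^-1 * \sum_e \sum_s Psi z s e * (Psi z s e)^*); last first.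
    by rewrite Psi_norm mulr1.
  rewrite exchange_big/= mulr_sumr; apply: eq_bigr => s _.
  by rewrite wP_entry z0 mulr0 sgn0 mulr1.
by rewrite sum_pair sum_F2 !diag; field.
Qed.

(** Labelling the basis of C^N by the string u before encoding splits the phase into past, present
    and future parts. The past part averages to a delta, the present one is the sign carrying the
    input, and the future one is [chi]. *)
Lemma synth_uncertainty N (G : 'M['F_2]_N) (i : 'I_N) DE (VE : 'F_2 -> 'M[C]_DE) idxE
    DP (VP : 'F_2 -> 'M[C]_DP) idxP :
  (forall u : 'rV['F_2]_N, u *m G *m G = u) ->
  is_synth (i := i) wE G VE idxE -> is_synth_future (i := i) wP G^T VP idxP ->
  (forall b, psdmx (VE b)) -> (forall b, psdmx (VP b)) ->
  root_fidelity (VP 0) (VP 1) ^+ 2 + root_fidelity (VE 0) (VE 1) ^+ 2 <= 1.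
Proof.
move=> GG VE_synth [idxP_bij VPE] VE_psd VP_psd.
have VE_tr : forall b, \tr (VE b) = 1.
  by apply: (synth_tr VE_synth) => b; under eq_bigr do rewrite wE_entry.
case: VE_synth => idxE_bij VEE.
pose Ft : finType := (N - i.+1).-tuple 'F_2.
pose St : finType := (Ft * {ffun 'I_N -> S})%type.
pose Phi (p : i.-tuple 'F_2) (b : 'F_2) (s : St) (e : {ffun 'I_N -> E}) : C :=
  \prod_k Psi ((bits N p b s.1 *m G) 0 k) (s.2 k) (e k).
pose chi (f : Ft) (s : St) : C := sgn C (\sum_j tnth f j * tnth s.1 j).
(* C^N holds the encoded string, which determines u because [G] is invertible. *)
pose gB (t : Ft * ('F_2 * (i.-tuple 'F_2 * St))) := idxP (t.1,
  [ffun k => ((bits N t.2.2.1 t.2.1 t.2.2.2.1 *m G) 0 k, t.2.2.2.2 k)]).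
have gB_bij : bijective gB.
  apply: inj_card_bij => [[f [c [p [g s]]]] [f' [c' [p' [g' s']]]] /(bij_inj idxP_bij)/= E0|].
    have := congr1 fst E0; have /ffunP := congr1 snd E0 => /= {}E0 ->.
    have ss : s = s' by apply/ffunP=> k; have := E0 k; rewrite !ffunE => -[].
    have uu : of_bits (p, (c, g)) *m G = of_bits (p', (c', g')) *m G.
      by apply/rowP=> k; have := E0 k; rewrite !ffunE => -[].
    have := congr1 (mulmx^~ G) uu; rewrite /= !GG => /(bij_inj (of_bits_bij i)).
    by move=> [-> -> ->]; rewrite ss.
  have := bij_eq_card idxP_bij; rewrite !card_prod !card_tuple !card_ffun !card_prod !card_ord => <-.
  rewrite leq_pmul2l ?expn_gt0// expnMn !mulnA leq_mul2r -expnS -expnD addSn -addSn.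
  by rewrite subnKC ?ltn_ord// leqnn orbT.
pose c := (2 ^+ i)^-1 * (2 ^+ (N - i.+1))^-1 : C.
have c0 : 0 <= c by rewrite mulr_ge0// invr_ge0 exprn_ge0.
(* 2^-N normalizes the N superpositions in C, and 2^i comes from the character sum over the past
   phase bits. *)
pose cB := c * (2 ^+ N)^-1 * 2 ^+ i.
have pow_neq0 m : 2 ^+ m != 0 :> C by rewrite expf_neq0// pnatr_eq0.
have ccB : #|{: Ft}|%:R * cB = c / 2.
  rewrite card_tuple card_ord natrX /cB.
  have -> : 2 ^+ N = 2 ^+ (N - i.+1) * 2 ^+ i * 2 :> C.
    by rewrite -exprD -exprSr; congr (_ ^+ _); have := ltn_ord i; lia.
  by field; rewrite !pow_neq0.
apply: (phase_amplitude_uncertainty (Phi := Phi) (chi := chi) idxE_bij gB_bij VP_psd VE_tr _ _ c0 ccB).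
- by move=> f s; exact: sgn_sqr.
- by move=> f s; exact: sgn_real.
- move=> b p e p' e'; rewrite VEE -/c.
  have [->|_] := eqVneq p p'; last by rewrite !mul0r.
  congr (_ * (_ * _)); rewrite sum_pair; apply: eq_bigr => g _; rewrite /letters /Phi.
  under eq_bigr do rewrite wE_entry.
  rewrite bigA_distr_bigA; apply: eq_bigr => s _.
  by rewrite rmorph_prod -big_split.
move=> b f a p [g s] f' a' p' [g' s']; rewrite /gB /= VPE -/c [(2 ^+ _)^-1 * _]mulrC -/c.
have [_|_] := eqVneq f f'; last by rewrite !mul0r.
rewrite !mul1r; set Ov := (X in _ = _ * X).
pose u := bits N p a g; pose u' := bits N p' a' g'; pose d := u + u'.
(* The two encoders cancel in the pairing because [G] is its own inverse. *)
have dG q : \sum_k (bits N q b f *m G^T) 0 k * ((u *m G) 0 k + (u' *m G) 0 k) =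
    \sum_k bits N q b f 0 k * d 0 k.
  transitivity (((bits N q b f *m G^T) *m (d *m G)^T) 0 0).
    rewrite [RHS]mxE; apply: eq_bigr => k _; congr (_ * _).
    by rewrite [RHS]mxE /d mulmxDl [RHS]mxE.
  rewrite -mulmxA -trmx_mul GG mxE; apply: eq_bigr => k _.
  by rewrite [X in _ * X]mxE.
have bitD j : bit d j = bit u j + bit u' j.
  have [jN|Nj] := ltnP j N; first by rewrite !bit_lt mxE.
  by rewrite !bit_out// addr0.
have [pu au gu] : [/\ past u i = p, u 0 i = a & future u i = g].
  by have [] := of_bitsK (p, (a, g)).
have [pu' au' gu'] : [/\ past u' i = p', u' 0 i = a' & future u' i = g'].
  by have [] := of_bitsK (p', (a', g')).
have one (q : i.-tuple 'F_2) : letters wP G^T (bits N q b f) [ffun k => ((u *m G) 0 k, s k)]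
      [ffun k => ((u' *m G) 0 k, s' k)] =
    (2 ^+ N)^-1 * (sgn C (\sum_j tnth q j * (tnth p j + tnth p' j)) * sgn C (b * (a + a')) *
     (chi f (g, s) * chi f (g', s'))) * Ov.
  rewrite /letters; under eq_bigr do rewrite !ffunE wP_entry.
  rewrite 2!big_split /=; congr (_ * _ * _).
  - by rewrite prodr_const card_ord exprVn.
  - rewrite -sgn_sum dG sum_bits !sgnD; congr (_ * _ * _).
    + congr (sgn C _); apply: eq_bigr => j _; congr (_ * _).
      by rewrite bitD -pu -pu' !tnth_mktuple.
    + by rewrite -au -au' mxE.
    + rewrite /chi /= -sgnD -big_split; congr (sgn C _); apply: eq_bigr => j _ /=.
      by rewrite bitD mulrDr -gu -gu' !tnth_mktuple.
  rewrite bigA_distr_bigA; apply: eq_bigr => e _.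
  by rewrite rmorph_prod -big_split.
under eq_bigr do rewrite one.
rewrite -mulr_suml -mulr_sumr -!mulr_suml sgn_orthogonality.
rewrite sgn_mulD /cB; move: (if _ then _ else _) (chi _ _ * chi _ _) ((2 ^+ N)^-1) (2 ^+ i).
by move=> sg ch x y; ring.
Qed.

End SynthesizedUncertainty.

(** * Entries of the channels of the wiretap setting *)

Section TensorEntries.
Local Open Scope sesquilinear_scope.

Section Generic.
Variable C : numClosedFieldType.

Lemma rbra_entry n k (e : 'I_k) i t :
  (castmx (muln1 n, erefl) (1%:M *t delta_mx (0 : 'I_1) e) : 'M[C]_(n, n * k)) i t =
  (t == mxtens_index (i, e))%:R.
Proof.
case: (mxtens_indexP t) => t1 t2; rewrite castmxE /= cast_ord_id.
have -> : cast_ord (esym (muln1 n)) i = mxtens_index (i, 0 : 'I_1).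
  by apply: val_inj; rewrite /= muln1 addn0.
by rewrite tensmxE !mxE (can_eq (@mxtens_indexK _ _)) xpair_eqE -natrM mulnb [i == _]eq_sym.
Qed.

Lemma rbra_sandwich n k (e : 'I_k) (X : 'M[C]_(n * k)) i j :
  let b := castmx (muln1 n, erefl) (1%:M *t delta_mx (0 : 'I_1) e) : 'M[C]_(n, n * k) in
  (b *m X *m b^t*) i j = X (mxtens_index (i, e)) (mxtens_index (j, e)).
Proof.
set b := castmx _ _ => /=.
have bE i' t : b i' t = (t == mxtens_index (i', e))%:R by exact: rbra_entry.
rewrite mxE (bigD1 (mxtens_index (j, e)))//= big1 ?addr0 => [|t tj]; last first.
  by rewrite !mxE bE (negbTE tj) conjC0 mulr0.
rewrite [X in _ * X]mxE [X in _ * _ X]mxE bE eqxx conjC1 mulr1.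
rewrite mxE (bigD1 (mxtens_index (i, e)))//= big1 ?addr0 => [|t ti]; last first.
  by rewrite bE (negbTE ti) mul0r.
by rewrite bE eqxx mul1r.
Qed.

Lemma lbra_sandwich k n (e e' : 'I_k) (X : 'M[C]_(k * n)) i j :
  let b e := castmx (mul1n n, erefl) (delta_mx (0 : 'I_1) e *t 1%:M) : 'M[C]_(n, k * n) in
  (b e *m X *m (b e')^t*) i j = X (mxtens_index (e, i)) (mxtens_index (e', j)).
Proof.
set b := fun e => castmx _ _ => /=.
have bE e0 i' t : b e0 i' t = (t == mxtens_index (e0, i'))%:R.
  case: (mxtens_indexP t) => t1 t2.
  rewrite castmxE /= cast_ord_id.
  have -> : cast_ord (esym (mul1n n)) i' = mxtens_index (0 : 'I_1, i') by exact: val_inj.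
  by rewrite tensmxE !mxE (can_eq (@mxtens_indexK _ _)) xpair_eqE -natrM mulnb [i' == _]eq_sym.
rewrite mxE (bigD1 (mxtens_index (e', j)))//= big1 ?addr0 => [|t tj]; last first.
  by rewrite !mxE bE (negbTE tj) conjC0 mulr0.
rewrite [X in _ * X]mxE [X in _ * _ X]mxE bE eqxx conjC1 mulr1.
rewrite mxE (bigD1 (mxtens_index (e, i)))//= big1 ?addr0 => [|t ti]; last first.
  by rewrite bE (negbTE ti) mul0r.
by rewrite bE eqxx mul1r.
Qed.

Lemma tens_mul1_entry m n s (U : 'M[C]_(m, n)) (v : 'cV[C]_(n * s)) i t :
  ((U *t (1%:M : 'M[C]_s)) *m v) (mxtens_index (i, t)) 0 =
  \sum_a U i a * v (mxtens_index (a, t)) 0.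
Proof.
have mx_bij : bijective (@mxtens_index n s).
  by exists (@mxtens_unindex n s); [exact: mxtens_indexK|exact: mxtens_unindexK].
rewrite mxE (reindex _ (onW_bij _ mx_bij))/= sum_pair; apply: eq_bigr => a _.
rewrite (bigD1 t)//= big1 ?addr0 => [|t' tt'].
  by rewrite tensmxE !mxE eqxx mulr1.
by rewrite tensmxE !mxE eq_sym (negbTE tt') mulr0 mul0r.
Qed.

Lemma phase_ket_entry m s1 (U : 'M[C]_(m, 2)) (psi : 'F_2 -> 'cV[C]_(2 * s1)) (x z : 'F_2) r :
  (((1%:M : 'M[C]_2) *t (U *t (1%:M : 'M[C]_s1)))
    *m ((diag_mx (\row_(z < 2) (-1) ^+ z) ^+ x *t (1%:M : 'M[C]_(2 * s1))) *m
     ((sqrtC 2)^-1 *: \sum_(z : 'F_2) (delta_mx (z : 'I_2) (0 : 'I_1) *t psi z) : 'cV[C]_(2 * (2 * s1)))))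
   (mxtens_index (z : 'I_2, r)) 0 =
  (sqrtC 2)^-1 * sgn C (x * z) * ((U *t (1%:M : 'M[C]_s1)) *m psi z) r 0.
Proof.
set Zx := _ ^+ x.
have ZxE (i j : 'F_2) : Zx (i : 'I_2) (j : 'I_2) = (i == j)%:R * sgn C (x * i).
  rewrite /Zx; case: x {Zx} => [[|[|//]] ?].
    by rewrite expr0 mxE /sgn mulr1; case: i j => [[|[|//]] ?] [[|[|//]] ?].
  rewrite expr1 !mxE /sgn; case: i j => [[|[|//]] ?] [[|[|//]] ?];
  by rewrite ?mulr1n ?mulr0n ?expr0 ?expr1 ?mul1r ?mul0r.
rewrite mulmxA tensmx_mul mul1mx mulmx1 -scalemxAr mxE -mulrA; congr (_ * _).
have mulE (z' : 'F_2) : (Zx *t (U *t 1%:M) *m (delta_mx (z' : 'I_2) (0 : 'I_1) *t psi z'))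
    (mxtens_index (z : 'I_2, r)) 0 = Zx (z : 'I_2) (z' : 'I_2) * ((U *t 1%:M) *m psi z') r 0.
  transitivity (((Zx *m delta_mx (z' : 'I_2) (0 : 'I_1)) *t ((U *t 1%:M) *m psi z'))
      (mxtens_index (z : 'I_2, r)) (mxtens_index (0 : 'I_1, 0 : 'I_1))).
    by rewrite -tensmx_mul; congr (fun_of_matrix _ _ _); apply: val_inj.
  by rewrite tensmxE -colE mxE.
rewrite mulmx_sumr summxE (bigD1 z)//= big1 ?addr0 => [|z' zz'].
  by rewrite mulE ZxE eqxx mul1r.
by rewrite mulE ZxE eq_sym (negbTE zz') !mul0r.
Qed.

End Generic.

End TensorEntries.

Section QuantumEntries.
Local Open Scope sesquilinear_scope.
Variable R : realType.
Local Notation C := R[i].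

Lemma mxtens_index_bij m n : bijective (@mxtens_index m n).
Proof. by exists (@mxtens_unindex m n); [exact: mxtens_indexK|exact: mxtens_unindexK]. Qed.

Lemma ptrace_rE n k (X : 'M[C]_(n * k)) i j :
  ptrace_r X i j = \sum_(e < k) X (mxtens_index (i, e)) (mxtens_index (j, e)).
Proof. by rewrite summxE; apply: eq_bigr => e _; exact: rbra_sandwich. Qed.

Lemma ptrace_lE k n (X : 'M[C]_(k * n)) i j :
  ptrace_l X i j = \sum_(e < k) X (mxtens_index (e, i)) (mxtens_index (e, j)).
Proof. by rewrite summxE; apply: eq_bigr => e _; exact: lbra_sandwich. Qed.

(** Follows the recursion of [tensor_rec], so that entries of a tensor product become products of
    entries. *)
Fixpoint tensor_index_rec d k : ('I_k.+1 -> 'I_d) -> 'I_(d ^ k.+1) :=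
  if k is k'.+1 return ('I_k.+1 -> 'I_d) -> 'I_(d ^ k.+1)
  then fun x => mxtens_index (x ord0, tensor_index_rec (fun j => x (lift ord0 j)))
  else fun x => x ord0.

Definition tensor_index d N : ('I_N -> 'I_d) -> 'I_(d ^ N) :=
  if N is k.+1 return ('I_N -> 'I_d) -> 'I_(d ^ N)
  then @tensor_index_rec d k else fun=> ord0.

Lemma tensor_entry d N (F : 'I_N -> 'M[C]_d) x y :
  tensor F (tensor_index x) (tensor_index y) = \prod_k F k (x k) (y k).
Proof.
case: N F x y => [|k] F x y; first by rewrite big_ord0 mxE.
rewrite /tensor /tensor_index; elim: k F x y => [|k IH] F x y.
  by rewrite big_ord1.
by rewrite big_ord_recl tensmxE IH.
Qed.

Lemma tensor_index_inj d N (x y : 'I_N -> 'I_d) : tensor_index x = tensor_index y -> x =1 y.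
Proof.
case: N x y => [|k] x y; first by move=> _ [].
rewrite /tensor_index; elim: k x y => [|k IH] x y.
  by move=> E j; rewrite (ord1 j).
move=> /(can_inj (@mxtens_indexK _ _)) [E0 /IH E] j.
by case: (unliftP ord0 j) => [j' ->|->] //; exact: E.
Qed.

Section Letters.
Variables (d N : nat) (W : cq_channel R d) (X : finType) (h : X -> 'I_d).
Hypothesis h_bij : bijective h.

Definition ket_index (T : finType) (t : T * {ffun 'I_N -> X}) : 'I_(#|T| * d ^ N) :=
  mxtens_index (enum_rank t.1, tensor_index (fun k => h (t.2 k))).

Lemma ket_index_bij T : bijective (@ket_index T).
Proof.
apply: inj_card_bij => [[s x] [t y] /(can_inj (@mxtens_indexK _ _)) /= E|].
  have [/enum_rank_inj -> {}E] : enum_rank s = enum_rank t /\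
      tensor_index (fun k => h (x k)) = tensor_index (fun k => h (y k)) by case: E.
  congr (_, _); apply/ffunP=> k; apply: (bij_inj h_bij).
  exact: (tensor_index_inj E).
have := bij_eq_card h_bij.
by rewrite card_prod card_ffun !card_ord => ->.
Qed.

Lemma synth_past_is_synth (G : 'M['F_2]_N) (i : 'I_N) :
  is_synth (i := i) (fun b x x' => W b (h x) (h x')) G (synth_past W G i)
    (@ket_index _).
Proof.
split; first exact: ket_index_bij.
move=> b p x p' x'; rewrite /synth_past summxE (bigD1 p)//= [X in _ + X]big1 ?addr0 => [|q qp]; last first.
  by rewrite mxE tensmxE mxE (inj_eq enum_rank_inj) eq_sym (negbTE qp) mul0r mulr0.
rewrite mxE tensmxE mxE eqxx [enum_rank p' == _](inj_eq enum_rank_inj) [p' == p]eq_sym /=.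
rewrite summxE mulrCA -mulrA; congr (_ * (_ * _)).
rewrite mulr_sumr; apply: eq_bigr => f _; rewrite mxE tensor_entry.
by [].
Qed.

Lemma synth_future_is_synth (G : 'M['F_2]_N) (i : 'I_N) :
  is_synth_future (i := i) (fun b x x' => W b (h x) (h x')) G (synth_future W G i)
    (@ket_index _).
Proof.
split; first exact: ket_index_bij.
move=> b f x f' x'; rewrite /synth_future summxE (bigD1 f)//= [X in _ + X]big1 ?addr0 => [|q qp]; last first.
  by rewrite mxE tensmxE mxE (inj_eq enum_rank_inj) eq_sym (negbTE qp) mul0r mulr0.
rewrite mxE tensmxE mxE eqxx [enum_rank f' == _](inj_eq enum_rank_inj) [f' == f]eq_sym /=.
rewrite summxE mulrCA -mulrA; congr (_ * (_ * _)).
rewrite mulr_sumr; apply: eq_bigr => p _; rewrite mxE tensor_entry.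
by [].
Qed.

End Letters.

Lemma sqrt_fidelity d (W : cq_channel R d) :
  (Num.sqrt (fidelity W))%:C%C = root_fidelity (W 0) (W 1).
Proof.
have tn0 (A : 'M[C]_d) : (trnorm A)%:C%C = tnorm A.
  have E : \tr (psqrt (A^t* *m A)) = tnorm A by rewrite /tnorm /sqrtmx -lock.
  rewrite /trnorm E RRe_real// ger0_real//.
  exact/psd_tr_ge0/sqrtmx_psd/psd_gram.
have E : psqrt (W 0) *m psqrt (W 1) = sqrtmx (W 0) *m sqrtmx (W 1).
  by rewrite /sqrtmx -!lock.
rewrite /fidelity sqrtr_sqr ger0_norm; last first.
  by rewrite -lecR tn0; exact/psd_tr_ge0/sqrtmx_psd/psd_gram.
by rewrite tn0 E.
Qed.

End QuantumEntries.

Section OneLetterGeneric.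
Local Open Scope sesquilinear_scope.
Variable C : numClosedFieldType.

Lemma outer_entry n (v : 'cV[C]_n) i j : (v *m v^t*) i j = v i 0 * (v j 0)^*.
Proof. by rewrite mxE big_ord1 !mxE. Qed.

Lemma outer_conj_entry m n (B : 'M[C]_(m, n)) (v : 'cV[C]_n) i j :
  (B *m (v *m v^t*) *m B^t*) i j = (B *m v) i 0 * ((B *m v) j 0)^*.
Proof.
have -> : B *m (v *m v^t*) *m B^t* = (B *m v) *m (B *m v)^t* by rewrite adjmxM !mulmxA.
exact: outer_entry.
Qed.

Lemma purified_conj_entry m n s (U : 'M[C]_(m, n)) (v : 'cV[C]_(n * s)) (rho : 'M[C]_n) i j :
  (forall a a', rho a a' = \sum_t v (mxtens_index (a, t)) 0 * (v (mxtens_index (a', t)) 0)^*) ->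
  (U *m rho *m U^t*) i j = \sum_t ((U *t (1%:M : 'M[C]_s)) *m v) (mxtens_index (i, t)) 0 *
     (((U *t (1%:M : 'M[C]_s)) *m v) (mxtens_index (j, t)) 0)^*.
Proof.
move=> rhoE; under [RHS]eq_bigr do rewrite !tens_mul1_entry.
transitivity (\sum_t \sum_a' \sum_a U i a * v (mxtens_index (a, t)) 0 *
   (U j a' * v (mxtens_index (a', t)) 0)^*).
  rewrite exchange_big/= mxE; apply: eq_bigr => a' _.
  rewrite mxE mulr_suml exchange_big/=; apply: eq_bigr => a _.
  rewrite rhoE mulr_sumr mulr_suml; apply: eq_bigr => t _.
  by rewrite !mxE rmorphM/=; ring.
apply: eq_bigr => t _; rewrite rmorph_sum mulr_sumr; apply: eq_bigr => a' _.
by rewrite mulr_suml.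
Qed.

Lemma rbra_tens_mul c n k s2 s1 (e : 'I_k) (v : 'cV[C]_(c * (n * k * s2 * s1))) z b t2 t1 :
  let B := castmx (muln1 n, erefl) (1%:M *t delta_mx (0 : 'I_1) e) : 'M[C]_(n, n * k) in
  (((1%:M : 'M[C]_c) *t (B *t (1%:M : 'M[C]_s2) *t (1%:M : 'M[C]_s1))) *m v)
    (mxtens_index (z, mxtens_index (mxtens_index (b, t2), t1))) 0 =
  v (mxtens_index (z, mxtens_index (mxtens_index (mxtens_index (b, e), t2), t1))) 0.
Proof.
set B := castmx _ _ => /=.
have BE i' t : B i' t = (t == mxtens_index (i', e))%:R by exact: rbra_entry.
set r := mxtens_index (z, mxtens_index (mxtens_index (mxtens_index (b, e), t2), t1)).
rewrite mxE (bigD1 r)//= big1 ?addr0 => [|q qr].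
  by rewrite !tensmxE BE !mxE !eqxx !mul1r.
case: (mxtens_indexP q) qr => z' q1; case: (mxtens_indexP q1) => q2 t1'.
case: (mxtens_indexP q2) => be t2' qr; rewrite !tensmxE BE !mxE.
rewrite /r (can_eq (@mxtens_indexK _ _)) xpair_eqE (can_eq (@mxtens_indexK _ _)) xpair_eqE in qr.
rewrite (can_eq (@mxtens_indexK _ _)) xpair_eqE in qr.
rewrite -!natrM !mulnb [z == _]eq_sym [t2 == _]eq_sym [t1 == _]eq_sym.
by rewrite (negbTE qr) mul0r.
Qed.

End OneLetterGeneric.

(** * Kraus operators of the degrading map *)

Section Kraus.
Local Open Scope sesquilinear_scope.
Variable R : realType.
Local Notation C := R[i].

Lemma amplify_entry k m n (Phi : 'M[C]_m -> 'M[C]_n) X i j a b :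
  amplify (k := k) Phi X (mxtens_index (i, a)) (mxtens_index (j, b)) =
  Phi (lbra R m i *m X *m (lbra R m j)^t*) a b.
Proof.
rewrite /amplify summxE (bigD1 i)//= [X in _ + X]big1 ?addr0 => [|i' ii']; last first.
  rewrite summxE big1// => j' _.
  by rewrite tensmxE mxE eq_sym (negbTE ii') mul0r.
rewrite summxE (bigD1 j)//= [X in _ + X]big1 ?addr0 => [|j' jj']; last first.
  by rewrite tensmxE mxE [j == _]eq_sym (negbTE jj') andbF mul0r.
by rewrite tensmxE mxE !eqxx mul1r.
Qed.

(* The Kraus operators are read off a square root of the Choi matrix. *)
Lemma kraus_decomposition m n (Phi : {linear 'M[C]_m -> 'M[C]_n}) : quantum_channel Phi ->
  exists l : 'I_(m * n) -> 'I_n -> 'I_m -> C,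
    (forall x x', \sum_j \sum_y (l j y x)^* * l j y x' = (x == x')%:R) /\
    (forall X y y', Phi X y y' = \sum_j \sum_x \sum_x' l j y x * X x x' * (l j y' x')^*).
Proof.
move=> [cp tp].
(* The unnormalized maximally entangled vector, so that [amplify Phi X0] is the Choi matrix. *)
pose v : 'cV[C]_(m * m) := \col_k ((mxtens_unindex k).1 == (mxtens_unindex k).2)%:R.
pose X0 := v *m v^t*.
have X0_psd : psdmx X0 by rewrite /X0 -{1}(adjmxK v); exact: psd_gram.
have Choi_psd : psdmx (amplify Phi X0) := cp m X0 X0_psd.
pose S := sqrtmx (amplify Phi X0).
have SS : amplify Phi X0 = S *m S^t* by rewrite sqrtmx_adj// sqrtmx_sqr.
have blk i j : lbra R m i *m X0 *m (lbra R m j)^t* = delta_mx i j.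
  apply/matrixP=> a b; rewrite (_ : (lbra R m i *m X0 *m (lbra R m j)^t*) a b =
    X0 (mxtens_index (i, a)) (mxtens_index (j, b))); last exact: lbra_sandwich.
  rewrite outer_entry [v]lock !mxE -lock !mxE !mxtens_indexK conjC_nat -natrM mulnb.
  by rewrite [i == a]eq_sym [j == b]eq_sym.
have choi i j y y' : Phi (delta_mx i j) y y' =
    \sum_k S (mxtens_index (i, y)) k * (S (mxtens_index (j, y')) k)^*.
  rewrite -blk -amplify_entry SS mxE; apply: eq_bigr => k _.
  by rewrite [X in _ * X]mxE [X in _ * _ X]mxE.
exists (fun j y x => S (mxtens_index (x, y)) j); split.
  move=> x x'; transitivity (\tr (Phi (delta_mx x' x))).
    rewrite exchange_big/=; apply: eq_bigr => y _; rewrite choi.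
    by apply: eq_bigr => k _; rewrite mulrC.
  rewrite tp /mxtrace (bigD1 x)//= big1 ?addr0 => [|y yx].
    by rewrite mxE eqxx andbT.
  by rewrite mxE (negbTE yx) andbF.
move=> X y y'; rewrite {1}[X]matrix_sum_delta linear_sum summxE.
transitivity (\sum_x \sum_x' \sum_j S (mxtens_index (x, y)) j * X x x' *
    (S (mxtens_index (x', y')) j)^*).
  apply: eq_bigr => x _; rewrite linear_sum summxE; apply: eq_bigr => x' _.
  rewrite linearZ mxE choi mulr_sumr; apply: eq_bigr => k _; ring.
under eq_bigr do rewrite exchange_big/=.
by rewrite exchange_big/=.
Qed.

End Kraus.

(** * One-letter channels to Bob and to Eve in terms of common amplitudes *)

Section Wiretap.
Local Open Scope sesquilinear_scope.
Variables (R : realType) (dB dE s1 s2 : nat).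
Local Notation C := R[i].
Variables (N : {linear 'M[C]_2 -> 'M[C]_(dB * dE)}) (U : 'M[C]_(dB * dE * s2, 2)).
Variables (rho : 'F_2 -> 'M[C]_2) (psi : 'F_2 -> 'cV[C]_(2 * s1)).
Hypotheses (N_channel : quantum_channel N) (U_extends_N : isometric_extension N U).
Hypotheses (rho_states : forall z, density (rho z)).
Hypothesis psi_purifies_rho : forall z, purification (rho z) (psi z).

Let S : finType := ('I_dB * 'I_s2 * 'I_s1)%type.

(* Amplitudes of U |psi_z>, with the systems B, S2, S1 collected in [s]. *)
Definition ket_amp (z : 'F_2) (s : S) (e : 'I_dE) : C :=
  ((U *t (1%:M : 'M[C]_s1)) *m psi z)
    (mxtens_index (mxtens_index (mxtens_index (s.1.1, e), s.1.2), s.2)) 0.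

Let rho_entry z a a' :
  rho z a a' = \sum_t psi z (mxtens_index (a, t)) 0 * (psi z (mxtens_index (a', t)) 0)^*.
Proof.
rewrite -(psi_purifies_rho z) ptrace_rE; apply: eq_bigr => t _; exact: outer_entry.
Qed.

Let N_entry z b e b' e' : N (rho z) (mxtens_index (b, e)) (mxtens_index (b', e')) =
  \sum_t2 \sum_t1 ket_amp z (b, t2, t1) e * (ket_amp z (b', t2, t1) e')^*.
Proof.
rewrite (U_extends_N.2 (rho z)) ptrace_rE; apply: eq_bigr => t2 _.
exact: (purified_conj_entry _ _ _ (rho_entry z)).
Qed.

Lemma to_E_entry z e e' : to_E N (rho z) e e' = \sum_s ket_amp z s e * (ket_amp z s e')^*.
Proof.
rewrite /to_E ptrace_lE 2!sum_pair; apply: eq_bigr => b _; rewrite N_entry.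
by apply: eq_bigr => t2 _; apply: eq_bigr => t1 _.
Qed.

Lemma to_B_entry z b b' : to_B N (rho z) b b' =
  \sum_(j : 'I_dE * 'I_s2 * 'I_s1)
    ket_amp z (b, j.1.2, j.2) j.1.1 * (ket_amp z (b', j.1.2, j.2) j.1.1)^*.
Proof.
rewrite /to_B ptrace_rE 2!sum_pair; apply: eq_bigr => e _; rewrite N_entry.
by apply: eq_bigr => t2 _; apply: eq_bigr => t1 _.
Qed.

Lemma ket_amp_norm z : \sum_e \sum_s ket_amp z s e * (ket_amp z s e)^* = 1.
Proof.
rewrite -(rho_states z).2 -(N_channel.2 (rho z)) (tr_relabel (mxtens_index_bij dB dE)).
rewrite sum_pair [RHS]exchange_big; apply: eq_bigr => e _; rewrite 2!sum_pair.
by apply: eq_bigr => b _; rewrite N_entry.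
Qed.

Lemma to_B_norm z : \sum_b to_B N (rho z) b b = 1.
Proof.
rewrite -(ket_amp_norm z); under eq_bigr do rewrite to_B_entry 2!sum_pair.
rewrite exchange_big/=; apply: eq_bigr => e _; rewrite 2!sum_pair.
by apply: eq_bigr => b _.
Qed.

Definition phase_index (t : 'F_2 * S) : 'I_(2 * (dB * s2 * s1)) :=
  mxtens_index (t.1 : 'I_2, mxtens_index (mxtens_index (t.2.1.1, t.2.1.2), t.2.2)).

Lemma phase_index_bij : bijective phase_index.
Proof.
apply: inj_card_bij => [[z [[b t2] t1]] [z' [[b' t2'] t1']]|].
  move=> /(bij_inj (mxtens_index_bij _ _))/= E.
  have -> : z = z' by have := congr1 fst E.
  have /(bij_inj (mxtens_index_bij _ _)) E1 := congr1 snd E.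
  have -> : t1 = t1' by have := congr1 snd E1.
  have /(bij_inj (mxtens_index_bij _ _)) [-> ->] := congr1 fst E1.
  by [].
by rewrite !card_prod !card_ord.
Qed.

Lemma phase_channel_entry x z s z' s' :
  phase_channel U psi x (phase_index (z, s)) (phase_index (z', s')) =
  2^-1 * sgn C (x * (z + z')) * \sum_e ket_amp z s e * (ket_amp z' s' e)^*.
Proof.
case: s s' => [[b t2] t1] [[b' t2'] t1'].
rewrite /phase_channel summxE mulr_sumr; apply: eq_bigr => e _.
transitivity ((braE R dB s1 s2 e *m phase_ket U psi x) (phase_index (z, (b, t2, t1))) 0 *
  ((braE R dB s1 s2 e *m phase_ket U psi x) (phase_index (z', (b', t2', t1'))) 0)^*).
  exact: outer_conj_entry.
have ketE z0 b0 t20 t10 :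
    (braE R dB s1 s2 e *m phase_ket U psi x) (phase_index (z0, (b0, t20, t10))) 0 =
    (sqrtC 2)^-1 * sgn C (x * z0) * ket_amp z0 (b0, t20, t10) e.
  transitivity (phase_ket U psi x (mxtens_index
      (z0 : 'I_2, mxtens_index (mxtens_index (mxtens_index (b0, e), t20), t10))) 0).
    exact: rbra_tens_mul.
  exact: phase_ket_entry.
rewrite !ketE !rmorphM/= sgn_real mulrDr sgnD.
have -> : ((sqrtC 2)^-1)^* = (sqrtC 2)^-1 :> C.
  by rewrite geC0_conj// invr_ge0 sqrtC_ge0.
have -> : 2^-1 = (sqrtC 2)^-1 * (sqrtC 2)^-1 :> C.
  by rewrite -invfM -expr2 sqrtCK.
by ring.
Qed.

End Wiretap.

(** * Polarization *)

Section Polarization.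
Variable R : realType.
Implicit Types (f g : nat -> R) (m n i j : nat).

Lemma ltr_powR (a x y : R) : 1 < a -> x < y -> a `^ x < a `^ y.
Proof.
move=> a1 xy; rewrite /powR gt_eqF ?(lt_trans ltr01)//.
by rewrite ltr_expR ltr_pM2r// ln_gt0.
Qed.

Definition avg n f : R := (\sum_(0 <= i < 2 ^ n) f i) / (2 ^ n)%:R.

Let pow2_gt0 n : (0 : R) < (2 ^ n)%:R.
Proof. by rewrite ltr0n expn_gt0. Qed.

Let pow2_neq0 n : (2 ^ n)%:R != 0 :> R.
Proof. by rewrite gt_eqF. Qed.

Lemma avg0 f : avg 0 f = f 0%N.
Proof. by rewrite /avg expn0 big_nat1 divr1. Qed.

Lemma big_nat_double k f :
  \sum_(0 <= i < k.*2) f i = \sum_(0 <= i < k) (f i.*2 + f i.*2.+1).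
Proof.
elim: k => [|k IH]; first by rewrite !big_nil.
by rewrite doubleS !big_nat_recr//= IH addrA.
Qed.

Lemma avgS n f : avg n.+1 f = avg n (fun i => (f i.*2 + f i.*2.+1) / 2).
Proof.
rewrite /avg expnS mul2n big_nat_double -mulr_suml -muln2 natrM invfM.
by rewrite -!mulrA; congr (_ * _); rewrite mulrC.
Qed.

Lemma le_avg n f g : (forall i, (i < 2 ^ n)%N -> f i <= g i) -> avg n f <= avg n g.
Proof.
move=> fg; rewrite ler_pM2r ?invr_gt0// !big_nat.
by apply: ler_sum => i /andP[_ ?]; exact: fg.
Qed.

Lemma eq_avg n f g : (forall i, (i < 2 ^ n)%N -> f i = g i) -> avg n f = avg n g.
Proof.
by move=> fg; congr (_ / _); rewrite !big_nat; apply: eq_bigr => i /andP[_ ?]; exact: fg.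
Qed.

Lemma avgD n f g : avg n (fun i => f i + g i) = avg n f + avg n g.
Proof. by rewrite /avg big_split mulrDl. Qed.

Lemma avgZ n (c : R) f : avg n (fun i => c * f i) = c * avg n f.
Proof. by rewrite /avg -mulr_sumr mulrA. Qed.

Lemma avgC n (c : R) : avg n (fun=> c) = c.
Proof. by rewrite /avg sumr_const_nat subn0 -[c *+ _]mulr_natr mulfK. Qed.

Lemma avgB n f g : avg n (fun i => f i - g i) = avg n f - avg n g.
Proof.
have <- : avg n (fun i => -1 * g i) = - avg n g by rewrite avgZ mulN1r.
by rewrite -avgD; apply: eq_avg => i _; rewrite mulN1r.
Qed.

(** A path of m + n steps is a path of m steps followed by one of n steps in the subtree below
    it. *)
Lemma avg_shift m n f :
  avg (m + n) f = avg m (fun i => avg n (fun j => f (i * 2 ^ n + j)%N)).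
Proof.
elim: n f => [|n IH] f.
  by rewrite addn0; apply: eq_avg => i _; rewrite avg0 expn0 muln1 addn0.
rewrite addnS avgS IH; apply: eq_avg => i _; rewrite avgS; apply: eq_avg => j _.
by rewrite doubleD expnS mulnCA mul2n addnS.
Qed.

(* [j < 2 ^ n] encodes a path: [ones n j] is its number of plus steps, and
   [loss n j] sums 2^-(number of plus steps so far) along it. *)
Fixpoint ones n j : nat := if n is n'.+1 then (ones n' j./2 + odd j)%N else 0%N.

Fixpoint loss n j : R :=
  if n is n'.+1 then loss n' j./2 + (2 ^+ ones n j)^-1 else 0.

Lemma avg_half_pow n : avg n (fun j => (2 ^+ ones n j)^-1) = (3 / 4) ^+ n.
Proof.
elim: n => [|n IH]; first by rewrite avg0 invr1.
rewrite avgS exprS -IH -avgZ; apply: eq_avg => i _ /=.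
rewrite uphalf_double doubleK odd_double /= addn0 addn1 exprS.
by rewrite invfM; field; rewrite expf_neq0.
Qed.

(** Each step multiplies the mean of 2^-[ones] by (1 + 1/2) / 2 = 3/4; the geometric series keeps
    the mean loss below 3 for every n. *)
Lemma avg_loss n : avg n (loss n) = 3 - 3 * (3 / 4) ^+ n.
Proof.
elim: n => [|n IH]; first by rewrite avg0 /= expr0; ring.
have -> : avg n.+1 (loss n.+1) = avg n (loss n) + (3 / 4) ^+ n.+1.
  rewrite -avg_half_pow !avgS -avgD; apply: eq_avg => i _ /=.
  by rewrite uphalf_double doubleK; field; rewrite !expf_neq0.
by rewrite IH exprS; field.
Qed.

Lemma avg_ones_var n : avg n (fun j => ((ones n j)%:R * 2 - n%:R) ^+ 2) = n%:R.
Proof.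
elim: n => [|n IH]; first by rewrite avg0 /= mul0r subrr expr0n.
rewrite avgS -[RHS]natr1 -[X in X + 1]IH -[X in _ + X](avgC n 1) -avgD; apply: eq_avg => i _ /=.
by rewrite uphalf_double doubleK odd_double /= addn0 addn1 -!(natr1 (ones _ _)) -(natr1 n); field.
Qed.

Lemma loss_ge0 n j : 0 <= loss n j.
Proof. by elim: n j => //= n IH j; rewrite addr_ge0// invr_ge0 exprn_ge0. Qed.

(** Markov's inequality with the mean below 3. *)
Lemma avg_loss_tail n (c : R) : 0 < c -> avg n (fun j => (c <= loss n j)%R%:R) <= 3 / c.
Proof.
move=> c0; rewrite ler_pdivlMr// mulrC -avgZ; apply: (@le_trans _ _ (avg n (loss n))).
  apply: le_avg => i _; have [h|h] := leP c (loss n i); first by rewrite mulr1.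
  by rewrite mulr0 loss_ge0.
by rewrite avg_loss gerBl mulr_ge0// exprn_ge0// divr_ge0.
Qed.

(** Chebyshev's inequality for 2 [ones] - n, a sum of n independent signs with variance n. *)
Lemma avg_ones_tail n (b : R) : 0 < b -> b < 1 / 2 -> (0 < n)%N ->
  avg n (fun j => ((ones n j)%:R <= b * n%:R)%R%:R) <= 1 / ((1 - 2 * b) ^+ 2 * n%:R).
Proof.
move=> b0 b2 n0; have n0' : (0 : R) < n%:R by rewrite ltr0n.
have c0 : 0 < (1 - 2 * b) ^+ 2 by apply: exprn_gt0; lra.
have cn0 : 0 < (1 - 2 * b) ^+ 2 * n%:R by exact: mulr_gt0.
rewrite (ler_pdivlMr _ _ cn0) [leLHS]mulrC -avgZ.
rewrite -(@ler_pM2r _ n%:R)// mul1r [leLHS]mulrC -avgZ -[leRHS]avg_ones_var.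
apply: le_avg => i _; have [h|h] := leP (ones n i)%:R (b * n%:R); last by rewrite !mulr0 sqr_ge0.
rewrite mulr1 mulrCA -expr2 -exprMn -subr_ge0 subr_sqr.
by apply: mulr_le0; nra.
Qed.

(** * Processes obeying the two one-step bounds *)

Section Process.
Variable Z : nat -> nat -> R.
Hypotheses (Z0 : forall n i, 0 <= Z n i) (Z1 : forall n i, Z n i <= 1).
Hypothesis Z_minus : forall n i, Z n.+1 i.*2 <= 2 * Z n i - Z n i ^+ 2.
Hypothesis Z_plus : forall n i, Z n.+1 i.*2.+1 <= Z n i ^+ 2.

(* A plus step doubles -log2 Z and a minus step lowers it by at most 1, which
   after normalization by 2^ones is the increment of [loss]. *)
Lemma process_decay m n i j (lam : R) : (j < 2 ^ n)%N -> Z m i <= 2 `^ (- lam) ->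
  Z (m + n) (i * 2 ^ n + j) <= 2 `^ (- (2 ^+ ones n j * (lam - loss n j))).
Proof.
elim: n j => [|n IH] j jn small; first last.
  have jn2 : (j./2 < 2 ^ n)%N by rewrite ltn_half_double -mul2n -expnS.
  have := IH j./2 jn2 small; rewrite addnS /=.
  have -> : (i * 2 ^ n.+1 + j = (i * 2 ^ n + j./2).*2 + odd j)%N.
    by rewrite doubleD expnS mulnCA mul2n -addnA [(_.*2 + odd j)%N]addnC odd_double_half.
  set z := Z _ _; set a := _ * (lam - _); set k := ones n _; move=> za.
  have z0 : 0 <= z by exact: Z0.
  have k0 : (2 : R) ^+ k != 0 by rewrite expf_neq0.
  have h2 : (2 : R) `^ (1 - a) = 2 * 2 `^ (- a).
    by rewrite powRD ?pnatr_eq0 ?implybT// powRr1.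
  case: (odd j) => /=.
    rewrite !addn1; apply: le_trans (Z_plus _ _) _; rewrite -/z.
    apply: (@le_trans _ _ ((2 `^ (- a)) ^+ 2)).
      by rewrite ler_sqr ?nnegrE ?powR_ge0.
    rewrite -powR_mulrn ?powR_ge0// -powRrM ler_powR ?ler1n// exprS.
    have -> : - (2 * 2 ^+ k * (lam - (loss n j./2 + (2 * 2 ^+ k)^-1))) = - a * 2 + 1.
      by rewrite /a; field.
    by rewrite lerDl.
  rewrite !addn0; apply: le_trans (Z_minus _ _) _; rewrite -/z.
  have -> : - (2 ^+ k * (lam - (loss n j./2 + (2 ^+ k)^-1))) = 1 - a.
    by rewrite /a; field.
  rewrite h2; apply: (@le_trans _ _ (2 * z)); first by rewrite gerBl sqr_ge0.
  by rewrite ler_wpM2l.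
by move: jn; rewrite expn0 ltnS leqn0 => /eqP ->; rewrite !addn0 muln1 /= expr0 mul1r subr0.
Qed.

Let u n i := Num.sqrt (Z n i).

Let u_ge0 n i : 0 <= u n i. Proof. exact: sqrtr_ge0. Qed.

Let u_le1 n i : u n i <= 1. Proof. by rewrite -sqrtr1 ler_wsqrtr. Qed.

Let u_sqr n i : u n i ^+ 2 = Z n i. Proof. exact: sqr_sqrtr. Qed.

Let dec_ge0 n i : 0 <= u n i * (1 - u n i) ^+ 2 / 4.
Proof. by apply: divr_ge0 => //; apply: mulr_ge0 (sqr_ge0 _). Qed.

Lemma sqrt_process_decrement n i :
  (u n.+1 i.*2 + u n.+1 i.*2.+1) / 2 <= u n i - u n i * (1 - u n i) ^+ 2 / 4.
Proof.
have h1 : u n.+1 i.*2.+1 <= u n i ^+ 2.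
  rewrite u_sqr -[leRHS]ger0_norm// -sqrtr_sqr; exact/ler_wsqrtr/Z_plus.
have r0 := u_ge0 n i; have r1 := u_le1 n i; set r := u n i in h1 r0 r1 *.
(* With t = 1 - r the minus bound is r sqrt (1 + 2t - t^2), and 1 + t - t^2 / 2 dominates that root:
   the squares differ by (t (1 - t / 2))^2. The plus bound r^2 then cancels all but the claimed
   drop. *)
have h2 : u n.+1 i.*2 <= r * (2 - r - (1 - r) ^+ 2 / 2).
  have w0 : 0 <= 2 - r - (1 - r) ^+ 2 / 2 by nra.
  rewrite -[leRHS]ger0_norm ?mulr_ge0// -sqrtr_sqr; apply/ler_wsqrtr.
  apply: le_trans (Z_minus _ _) _; rewrite -u_sqr -/r -subr_ge0.
  have -> : (r * (2 - r - (1 - r) ^+ 2 / 2)) ^+ 2 - (2 * r ^+ 2 - (r ^+ 2) ^+ 2)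
      = (r * (1 - r) * (1 - (1 - r) / 2)) ^+ 2 by field.
  exact: sqr_ge0.
by nra.
Qed.

(** The supermartingale property inside the subtree below i, as needed for each starting point
    separately. *)
Lemma sqrt_process_super m n i :
  avg n (fun j => u (m + n) (i * 2 ^ n + j)) <= u m i.
Proof.
elim: n => [|n IH]; first by rewrite avg0 expn0 muln1 !addn0.
rewrite avgS; apply: le_trans IH; apply: le_avg => j _.
rewrite addnS expnS mulnCA mul2n addnS -doubleD.
apply: le_trans (sqrt_process_decrement _ _) _.
by rewrite gerBl dec_ge0.
Qed.

Let phi n := avg n (u n).

Let phi_ge0 n : 0 <= phi n.
Proof. by rewrite -[leLHS](avgC n); apply: le_avg. Qed.

Let phiS n : avg n (fun i => u n i * (1 - u n i) ^+ 2 / 4) <= phi n - phi n.+1.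
Proof.
rewrite lerBrDr -lerBrDl -avgB /phi avgS; apply: le_avg => i _.
exact: sqrt_process_decrement.
Qed.

(** [m] brings [phi] within [eta] of its infimum, below which no later value can fall. *)
Let phi_settles (eta : R) : 0 < eta -> exists m, forall n, phi m - phi (m + n) <= eta.
Proof.
move=> eta0; have hi : has_inf (range phi).
  by split; [exists (phi 0%N), 0%N|exists 0 => _ [n _ <-]].
have [_ [m _ <-] hm] := inf_adherent eta0 hi.
exists m => n; rewrite lerBlDr; apply/ltW/(lt_le_trans hm).
by rewrite addrC lerD2l; apply: ge_inf; [case: hi|exists (m + n)%N].
Qed.

(* The decrement of the average of sqrt Z bounds the mass away from 0 and 1. *)
Let mid_bound m (zeta delta : R) : 0 < zeta -> 0 < delta ->
  avg m (fun i => ((zeta < u m i) && (u m i < 1 - delta))%R%:R)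
    <= 4 / (zeta * delta ^+ 2) * (phi m - phi m.+1).
Proof.
move=> z0 d0; apply: (@le_trans _ _ (4 / (zeta * delta ^+ 2) *
    avg m (fun i => u m i * (1 - u m i) ^+ 2 / 4))); last first.
  apply: ler_wpM2l (phiS _); apply: divr_ge0 => //.
  by apply: mulr_ge0 (sqr_ge0 _); exact: ltW.
have c0 : 0 < zeta * delta ^+ 2 by rewrite mulr_gt0// exprn_gt0.
rewrite -avgZ; apply: le_avg => i _; case: andP => [[h1 h2]|_]; last first.
  by apply: mulr_ge0 (dec_ge0 _ _); rewrite divr_ge0// ltW.
have -> : 4 / (zeta * delta ^+ 2) * (u m i * (1 - u m i) ^+ 2 / 4) =
    (u m i * (1 - u m i) ^+ 2) / (zeta * delta ^+ 2).
  by field; rewrite !gt_eqF.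
rewrite ler_pdivlMr// mul1r ler_pM ?sqr_ge0 ?ltW//.
by rewrite ltr_sqr ?nnegrE; lra.
Qed.

(** Markov's inequality for the drop: from a start above 1 - [delta], the drop plus [delta] is
    nonnegative on every path and at least 1 - [kappa] on the paths that end below [kappa]. *)
Let drop_bound m n i (kappa delta : R) : kappa < 1 -> 0 <= delta ->
  avg n (fun j => ((1 - delta <= u m i) && (u (m + n) (i * 2 ^ n + j) <= kappa))%R%:R)
    <= (1 - kappa)^-1 * (u m i - avg n (fun j => u (m + n) (i * 2 ^ n + j)) + delta).
Proof.
move=> k1 d0; have c0 : 0 < 1 - kappa by lra.
have [h|h] := leP (1 - delta) (u m i); last first.
  rewrite avgC; apply: mulr_ge0; first by rewrite invr_ge0 ltW.
  by apply: addr_ge0 => //; rewrite subr_ge0; exact: sqrt_process_super.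
have -> : (1 - kappa)^-1 * (u m i - avg n (fun j => u (m + n) (i * 2 ^ n + j)) + delta)
    = avg n (fun j => (1 - kappa)^-1 * (u m i - u (m + n) (i * 2 ^ n + j) + delta)).
  by rewrite avgZ avgD avgB !avgC.
apply: le_avg => j _; rewrite mulrC ler_pdivlMr//.
have := u_le1 (m + n) (i * 2 ^ n + j).
have [h2 _|_ h2] /= := leP (u (m + n) (i * 2 ^ n + j)) kappa; lra.
Qed.

(** Unless the loss reaches [lam] / 2 or at most b n steps are plus steps, the exponent 2^[ones]
    ([lam] - [loss]) exceeds 2^(b n), which is at least N^beta. [lam] >= 4 makes the factor [lam] -
    [loss] larger than 1. *)
Let decay_bound m n i (lam b beta : R) : 4 <= lam -> 0 < b -> b < 1 / 2 ->
  (0 < n)%N -> (m + n)%:R * beta <= b * n%:R ->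
  avg n (fun j => ((u m i <= Num.sqrt (2 `^ (- lam))) &&
      (2 `^ (- (2 ^ (m + n))%:R `^ beta) <= Z (m + n) (i * 2 ^ n + j)))%R%:R)
    <= 6 / lam + 1 / ((1 - 2 * b) ^+ 2 * n%:R).
Proof.
move=> lam4 b0 b2 n0 hn.
have lam2 : 0 < lam / 2 by lra.
have -> : 6 / lam = 3 / (lam / 2) by field; rewrite gt_eqF//; lra.
apply: (@le_trans _ _ (avg n (fun j => (lam / 2 <= loss n j)%R%:R +
    ((ones n j)%:R <= b * n%:R)%R%:R))); last first.
  by rewrite avgD lerD ?avg_loss_tail ?avg_ones_tail.
apply: le_avg => j jn; have [h1|h1] /= := leP (u m i) _; last by rewrite addr_ge0.
have [hl|hl] /= := leP (lam / 2) (loss n j).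
  by apply: (@le_trans _ _ 1); rewrite ?lerDl// lern1 leq_b1.
have [ho|ho] /= := leP (ones n j)%:R (b * n%:R).
  by rewrite add0r lern1 leq_b1.
have hZ : Z m i <= 2 `^ (- lam).
  have p0 : 0 <= (2 : R) `^ (- lam) by exact: powR_ge0.
  by rewrite -u_sqr -(sqr_sqrtr p0) ler_sqr ?nnegrE ?sqrtr_ge0 ?u_ge0.
suff : Z (m + n) (i * 2 ^ n + j) < 2 `^ (- (2 ^ (m + n))%:R `^ beta).
  by rewrite ltNge => /negbTE ->; rewrite addr0.
apply: le_lt_trans (process_decay jn hZ) _.
apply: ltr_powR; rewrite ?ltr1n// ltrN2.
have k0 : (0 : R) < 2 ^+ ones n j by exact: exprn_gt0.
apply: (@le_lt_trans _ _ (2 ^+ ones n j)); last first.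
  by rewrite ltr_pMr//; lra.
rewrite natrX -powR_mulrn// -powRrM -powR_mulrn// ler_powR ?ler1n//.
exact: le_trans hn (ltW ho).
Qed.

Theorem polarization (beta kappa eps : R) :
  0 < beta -> beta < 1 / 2 -> kappa < 1 -> 0 < eps ->
  exists n0, forall n, (n0 <= n)%N ->
    avg n (fun i => ((2 `^ (- (2 ^ n)%:R `^ beta) <= Z n i) && (Z n i <= kappa))%R%:R)
      <= eps.
Proof.
move=> b0 b2 k1 e0; set kap := Num.sqrt kappa.
have kap1 : kap < 1 by rewrite /kap -sqrtr1 ltr_sqrt.
(* A fraction of plus steps below the typical 1/2 but above beta, leaving room to absorb the first m
   steps. *)
pose b := (beta + 1 / 2) / 2.
have bb : beta < b by rewrite /b; lra.
have b2' : b < 1 / 2 by rewrite /b; lra.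
pose c := 1 - kap; have c0 : 0 < c by rewrite /c; lra.
(* The drop bound becomes (delta + delta) / c = eps / 4. *)
pose delta := c * eps / 8; have d0 : 0 < delta by rewrite /delta; nra.
(* The term 48 / eps gives 6 / lam <= eps / 8. *)
pose lam := 4 + 48 / eps; have lam4 : 4 <= lam by rewrite /lam lerDl divr_ge0// ltW.
pose zeta := Num.sqrt (2 `^ (- lam) : R).
have z0 : 0 < zeta by rewrite sqrtr_gt0 powR_gt0.
pose q := zeta * delta ^+ 2; have q0 : 0 < q by rewrite mulr_gt0// exprn_gt0.
(* The first entry bounds the mass in the middle range by 4 / q * eta <= eps / 4; the second bounds
   the later drop by delta. *)
pose eta := Num.min (q * eps / 16) delta.
have eta0 : 0 < eta by rewrite lt_min d0 andbT divr_gt0// mulr_gt0.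
have [m hm] := phi_settles eta0.
pose w := (1 - 2 * b) ^+ 2; have w0 : 0 < w by rewrite exprn_gt0//; lra.
(* The two entries ensure (m + n) beta <= b n and 1 / (w n) <= eps / 8. *)
pose n1 := Num.bound (Num.max (m%:R * beta / (b - beta)) (8 / (w * eps))).
exists (m + n1)%N => n' hn'.
have [n -> hn] : exists2 n, n' = (m + n)%N & (n1 <= n)%N.
  have mn' : (m <= n')%N by exact: leq_trans (leq_addr _ _) hn'.
  by exists (n' - m)%N; [rewrite subnKC|rewrite -(leq_add2l m) subnKC].
have n1n : Num.max (m%:R * beta / (b - beta)) (8 / (w * eps)) < n%:R.
  apply: (@lt_le_trans _ _ n1%:R); last by rewrite ler_nat.
  apply: archi_boundP; rewrite le_max; apply/orP; right.
  by apply: divr_ge0 => //; apply: mulr_ge0; exact: ltW.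
move: n1n; rewrite gt_max => /andP[h1 h2].
have n0 : (0 < n)%N.
  rewrite -(ltr0n R); apply: le_lt_trans h2.
  by apply: divr_ge0 => //; apply: mulr_ge0; exact: ltW.
have hmn : (m + n)%:R * beta <= b * n%:R.
  have {}h1 : m%:R * beta < n%:R * (b - beta) by rewrite -ltr_pdivrMr// subr_gt0.
  by rewrite natrD; lra.
rewrite avg_shift.
(* An index counted at level m + n was in the middle range at level m, or near 1 and has dropped, or
   near 0 and has not decayed. *)
pose rhs i := ((zeta < u m i) && (u m i < 1 - delta))%R%:R
  + (avg n (fun j => ((1 - delta <= u m i) && (u (m + n) (i * 2 ^ n + j) <= kap))%R%:R)
  + avg n (fun j => ((u m i <= zeta) &&
      (2 `^ (- (2 ^ (m + n))%:R `^ beta) <= Z (m + n) (i * 2 ^ n + j)))%R%:R)) : R.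
apply: (@le_trans _ _ (avg m rhs)).
  apply: le_avg => i _; rewrite /rhs -(avgC n (((zeta < _) && _)%R%:R)) -!avgD.
  apply: le_avg => j _.
  have hk : Z (m + n) (i * 2 ^ n + j) <= kappa -> u (m + n) (i * 2 ^ n + j) <= kap.
    by move=> h; apply: ler_wsqrtr.
  case: (leP _ (Z _ _)) => h3 /=; last by rewrite !addr_ge0.
  case: (leP _ kappa) => h4 /=; last by rewrite !addr_ge0.
  rewrite (hk h4) !andbT.
  have [h5|h5] := leP (u m i) zeta; first by rewrite /= add0r lerDr.
  by have [h6|h6] := ltP (u m i) (1 - delta); rewrite /= ?addr0 ?add0r.
rewrite /rhs 2!avgD.
have t1 : avg m (fun i => ((zeta < u m i) && (u m i < 1 - delta))%R%:R) <= eps / 4.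
  apply: le_trans (mid_bound _ z0 d0) _; rewrite -/q.
  have := hm 1%N; rewrite addn1 => h.
  apply: (@le_trans _ _ (4 / q * (q * eps / 16))).
    by rewrite ler_wpM2l ?divr_ge0 ?(ltW q0)//; apply: le_trans h _; rewrite ge_min lexx.
  by rewrite le_eqVlt; apply/orP; left; apply/eqP; field; rewrite gt_eqF.
have t2 : avg m (fun i => avg n (fun j => ((1 - delta <= u m i) &&
    (u (m + n) (i * 2 ^ n + j) <= kap))%R%:R)) <= eps / 4.
  apply: le_trans (le_avg (fun i _ => drop_bound m n i kap1 (ltW d0))) _.
  rewrite avgZ avgD avgB avgC -avg_shift -/c -/(phi m) -/(phi (m + n)).
  rewrite mulrC ler_pdivrMr//.
  have {}h : phi m - phi (m + n) <= delta by apply: le_trans (hm n) _; rewrite ge_min lexx orbT.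
  have -> : eps / 4 * c = delta + delta by rewrite /delta; field.
  by rewrite lerD2r.
have t3 : avg m (fun i => avg n (fun j => ((u m i <= zeta) &&
      (2 `^ (- (2 ^ (m + n))%:R `^ beta) <= Z (m + n) (i * 2 ^ n + j)))%R%:R)) <= eps / 4.
  have b0' : 0 < b by lra.
  apply: le_trans (le_avg (fun i _ => decay_bound i lam4 b0' b2' n0 hmn)) _.
  rewrite avgC -/w.
  have l1 : 6 / lam <= eps / 8.
    rewrite ler_pdivrMr; last lra.
    have -> : eps / 8 * lam = eps / 2 + 6 by rewrite /lam; field; rewrite gt_eqF.
    by rewrite lerDr; lra.
  have l2 : 1 / (w * n%:R) <= eps / 8.
    have {}h2 : 8 < n%:R * (w * eps) by rewrite -ltr_pdivrMr// mulr_gt0.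
    have wn : 0 < w * n%:R by rewrite mulr_gt0// ltr0n.
    by rewrite ler_pdivrMr//; move: h2; nra.
  by lra.
by lra.
Qed.

End Process.

End Polarization.

(** * Root fidelities of synthesized channels as such a process *)

Section PolarizationOfFidelities.
Local Open Scope sesquilinear_scope.
Variable R : realType.
Local Notation C := R[i].

(** The measurement with a single outcome already gives the value 1. *)
Lemma root_fidelity_le1 d (W : 'F_2 -> 'M[C]_d) :
  (forall b, psdmx (W b)) -> (forall b, \tr (W b) = 1) -> root_fidelity (W 0) (W 1) <= 1.
Proof.
move=> W0 W1; have psd1 : psdmx (1%:M : 'M[C]_d).
  by rewrite -(mulmx1 1%:M) -{1}adjmx1; exact: psd_gram.
have := @root_fidelity_le_povm _ d (W 0) (W 1) unit (fun=> 1%:M) (W0 0) (W0 1) (fun=> psd1).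
rewrite !(big_pred1 tt); try by case.
by rewrite !mul1mx !W1 sqrtC1 mulr1; apply.
Qed.

Section Process.
Variables (X J : finType) (w : 'F_2 -> X -> X -> C) (a : 'F_2 -> J -> X -> C).
Hypothesis wE : forall b x x', w b x x' = \sum_j a b j x * (a b j x')^*.
Hypothesis w1 : forall b, \sum_x w b x x = 1.
Variable z : nat -> nat -> R.
Hypothesis z_synth : forall n (i : 'I_(2 ^ n)), exists d (W : cq_channel R d) idx,
  is_synth (i := i) w (arikan_mx n) W idx /\ (z n i)%:C%C = root_fidelity (W 0) (W 1).
(** Padding by 0 makes both step bounds hold at every natural index. *)
Hypothesis z_out : forall n i, (2 ^ n <= i)%N -> z n i = 0.

Lemma process_ge0 n i : 0 <= z n i.
Proof.
have [iN|/z_out -> //] := ltnP i (2 ^ n).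
have [d [W [idx [_ E]]]] := z_synth (Ordinal iN).
by rewrite -lecR; rewrite E; exact: root_fidelity_ge0.
Qed.

Lemma process_le1 n i : z n i <= 1.
Proof.
have [iN|/z_out -> //] := ltnP i (2 ^ n).
have [d [W [idx [W_synth E]]]] := z_synth (Ordinal iN).
rewrite -lecR; rewrite E; apply: root_fidelity_le1; first exact: (synth_psd W_synth wE).
exact: (synth_tr W_synth w1).
Qed.

Lemma process_minus n i : z n.+1 i.*2 <= 2 * z n i - z n i ^+ 2.
Proof.
have [iN|Ni] := ltnP i (2 ^ n); last first.
  rewrite !z_out//; first by rewrite mulr0 expr0n subrr.
  by rewrite expnS mul2n leq_double.
have [d [W [idx [W_synth E]]]] := z_synth (Ordinal iN).
have [d' [W' [idx' [W'_synth E']]]] := z_synth (ev (Ordinal iN)).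
have := synth_minus W_synth (synth_psd W_synth wE) (synth_tr W_synth w1)
  W'_synth (synth_psd W'_synth wE).
rewrite -E -E' /= => h; rewrite -lecR rmorphB rmorphM rmorphXn /= rmorph_nat.
exact: h.
Qed.

Lemma process_plus n i : z n.+1 i.*2.+1 <= z n i ^+ 2.
Proof.
have [iN|Ni] := ltnP i (2 ^ n); last first.
  by rewrite !z_out ?expr0n// expnS mul2n ltnW// ltnS leq_double.
have [d [W [idx [W_synth E]]]] := z_synth (Ordinal iN).
have [d' [W' [idx' [W'_synth E']]]] := z_synth (od (Ordinal iN)).
have := synth_plus W_synth (synth_psd W_synth wE) (synth_tr W_synth w1)
  W'_synth (synth_psd W'_synth wE).
rewrite -E -E' /= => h; rewrite -lecR rmorphXn /=.
exact: h.
Qed.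

End Process.

End PolarizationOfFidelities.

Theorem mainTheorem3 (R : realType) (dB dE s1 s2 : nat)
  (N : {linear 'M[R[i]]_2 -> 'M[R[i]]_(dB * dE)})
  (N_channel : quantum_channel N)
  (N_degradable : degradable N)
  (U : 'M[R[i]]_(dB * dE * s2, 2))
  (U_extends_N : isometric_extension N U)
  (rho : 'F_2 -> 'M[R[i]]_2)
  (rho_states : forall z, density (rho z))
  (psi : 'F_2 -> 'cV[R[i]]_(2 * s1))
  (psi_purifies_rho : forall z, purification (rho z) (psi z))
  (beta : R) (beta_gt0 : 0 < beta) (beta_lt_half : beta < 1 / 2) :
  (fun n : nat =>
     key_rate n beta (amplitude_channel N rho) (phase_channel U psi))
  @ \oo --> (0 : R).
Proof.
pose WA := amplitude_channel N rho; pose WP := phase_channel U psi.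
pose WE : cq_channel R dE := fun z => to_E N (rho z).
pose amp := ket_amp U psi.
pose aA b (j : 'I_dE * 'I_s2 * 'I_s1) x := amp b (x, j.1.2, j.2) j.1.1.
have WA_gram b x x' : WA b x x' = \sum_j aA b j x * (aA b j x')^*.
  exact: (to_B_entry U_extends_N psi_purifies_rho).
have WA_norm b : \sum_x WA b x x = 1 by exact: (to_B_norm N_channel U_extends_N rho_states psi_purifies_rho b).
have WE_gram b e e' : WE b e e' = \sum_s amp b s e * (amp b s e')^*.
  exact: (to_E_entry U_extends_N psi_purifies_rho).
have amp_norm b : \sum_e \sum_s amp b s e * (amp b s e)^* = 1.
  exact: (ket_amp_norm N_channel U_extends_N rho_states psi_purifies_rho b).
pose wP x t t' := WP x (phase_index t) (phase_index t').
have wPE x z s z' s' : wP x (z, s) (z', s') =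
  2^-1 * sgn R[i] (x * (z + z')) * \sum_e amp z s e * (amp z' s' e)^*.
  exact: phase_channel_entry.
have wP_gram := phase_kernel_gram wPE.
have wP_norm := phase_kernel_norm wPE amp_norm.
pose zA n i : R := oapp (fun o : 'I_(2 ^ n) =>
  Num.sqrt (fidelity (synth_past WA (arikan_mx n) o))) 0 (insub i).
(* Counted from the last position, so that the phase family satisfies the recursion of the past-bits
   channels. *)
pose zP n i : R := oapp (fun o : 'I_(2 ^ n) =>
  Num.sqrt (fidelity (synth_future WP (arikan_mx n)^T (rev_ord o)))) 0 (insub i).
have zA_ord n (o : 'I_(2 ^ n)) :
    zA n o = Num.sqrt (fidelity (synth_past WA (arikan_mx n) o)).
  by rewrite /zA valK.
have zP_ord n (o : 'I_(2 ^ n)) :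
    zP n o = Num.sqrt (fidelity (synth_future WP (arikan_mx n)^T (rev_ord o))).
  by rewrite /zP valK.
have zA_out n i : (2 ^ n <= i)%N -> zA n i = 0.
  by move=> Ni; rewrite /zA insubF// ltnNge Ni.
have zP_out n i : (2 ^ n <= i)%N -> zP n i = 0.
  by move=> Ni; rewrite /zP insubF// ltnNge Ni.
have id_bij m : bijective (@id 'I_m) by exists id.
have zA_synth n (i : 'I_(2 ^ n)) : exists d (W : cq_channel R d) idx,
    is_synth (i := i) WA (arikan_mx n) W idx /\ (zA n i)%:C%C = root_fidelity (W 0) (W 1).
  exists _, (synth_past WA (arikan_mx n) i), (@ket_index dB (2 ^ n) 'I_dB id _); split.
    exact: (synth_past_is_synth WA (id_bij dB)).
  by rewrite zA_ord; exact: sqrt_fidelity.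
have zP_synth n (i : 'I_(2 ^ n)) : exists d (W : cq_channel R d) idx,
    is_synth (i := i) wP (arikan_mx n) W idx /\ (zP n i)%:C%C = root_fidelity (W 0) (W 1).
  have [j ->] : exists j, i = rev_ord j by exists (rev_ord i); rewrite rev_ordK.
  have := synth_future_is_synth WP (phase_index_bij dB s1 s2) (arikan_mx n)^T j.
  move=> /(synth_future_past (@arikan_tr_rev n)) [idx idxE].
  exists _, (synth_future WP (arikan_mx n)^T j), idx; split=> //.
  by rewrite zP_ord rev_ordK; exact: sqrt_fidelity.
have tradeoff n (i : 'I_(2 ^ n)) : zA n i ^+ 2 + zP n (rev_ord i) ^+ 2 <= 1.
  have [D [D_channel DE]] := N_degradable.
  have [l [l_tp lE]] := kraus_decomposition D_channel.
  have A_synth := synth_past_is_synth WA (id_bij dB) (arikan_mx n) i.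
  have E_synth := synth_past_is_synth WE (id_bij dE) (arikan_mx n) i.
  have P_synth := synth_future_is_synth WP (phase_index_bij dB s1 s2) (arikan_mx n)^T i.
  have A_psd := synth_psd A_synth WA_gram.
  have E_psd := synth_psd E_synth WE_gram.
  have [idx' P_synth'] := synth_future_past (@arikan_tr_rev n) P_synth.
  have P_psd := synth_psd P_synth' wP_gram.
  have degraded := synth_degrade A_synth E_synth A_psd E_psd l_tp
    (fun b y y' => etrans (congr1 (fun Y : 'M[R[i]]_dE => Y y y') (esym (DE (rho b)))) (lE (WA b) y y')).
  have unc := synth_uncertainty WE_gram wPE amp_norm (@arikan_involutive n)
    E_synth P_synth E_psd P_psd.
  rewrite zA_ord zP_ord rev_ordK -lecR rmorphD !rmorphXn /= !sqrt_fidelity.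
  apply: le_trans unc; rewrite addrC lerD2l lerXn2r ?nnegrE ?root_fidelity_ge0//.
pose kap : R := Num.sqrt (1 / 2).
have kap1 : kap < 1 by rewrite /kap -[ltRHS]sqrtr1 ltr_sqrt; lra.
have kap_sqr : kap ^+ 2 = 1 / 2 by rewrite sqr_sqrtr; lra.
have zA0 := process_ge0 zA_synth zA_out; have zP0 := process_ge0 zP_synth zP_out.
have polA := polarization zA0 (process_le1 WA_gram WA_norm zA_synth zA_out)
  (process_minus WA_gram WA_norm zA_synth zA_out) (process_plus WA_gram WA_norm zA_synth zA_out)
  beta_gt0 beta_lt_half kap1.
have polP := polarization zP0 (process_le1 wP_gram wP_norm zP_synth zP_out)
  (process_minus wP_gram wP_norm zP_synth zP_out) (process_plus wP_gram wP_norm zP_synth zP_out)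
  beta_gt0 beta_lt_half kap1.
apply/cvgr0Pnorm_le => eps eps0.
have eps2 : 0 < eps / 2 by lra.
have [nA hA] := polA _ eps2; have [nP hP] := polP _ eps2.
exists (maxn nA nP) => // n /=; rewrite geq_max => /andP[/hA {}hA /hP {}hP].
have N0 : (0 : R) < (2 ^ n)%:R by rewrite ltr0n expn_gt0.
rewrite ger0_norm; last by rewrite /key_rate divr_ge0.
have -> : eps = eps / 2 + eps / 2 by lra.
apply: le_trans (lerD hA hP); rewrite /key_rate /avg -mulrDl ler_pM2r ?invr_gt0//.
(* Undoes the reversal in [zP], so that both terms refer to the same index i. *)
rewrite !big_mkord [X in _ + X](reindex_inj rev_ord_inj) -big_split/=.
rewrite -sum1_card natr_sum big_mkcond/=; apply: ler_sum => i _.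
case: ifPn => [|_]; last by rewrite addr_ge0.
rewrite !inE /is_good -!leNgt => /andP[bad_A bad_P].
rewrite -[(2 ^ n - i.+1)%N]/(val (rev_ord i)) zA_ord zP_ord rev_ordK bad_A bad_P /= -zA_ord.
have := tradeoff n i; rewrite zP_ord rev_ordK.
set p := Num.sqrt _; have p0 : 0 <= p by exact: sqrtr_ge0.
have := zA0 n i; move: (zA n i) => q q0 pq.
have k0 : 0 <= kap by exact: sqrtr_ge0.
(* If both root fidelities exceeded sqrt (1/2), their squares would add up to more than 1. *)
have [_|qk] := leP q kap; first by rewrite lerDl.
have [_|pk] := leP p kap; first by rewrite add0r.
by nra.
Qed.
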